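(* Let $n\geq 2$ and let $f\in R=\mathbb{C}[x_1,\dots,x_n]$ be homogeneous of degree $d$, with $\dim\operatorname{Sing} f^{-1}(0)\leq 1$ and $f$ not a polynomial of $n-1$ variables. Then $$\gamma_k-\mu'_k=\mu''_k+\mu''_{nd-k}-\tau_Z\qquad\text{for all }k\in\mathbb{Z}.$$
   Context: $R=\mathbb{C}[x_1,\dots,x_n]$ is graded by $\deg x_i=1$. $\Omega^j$ is the graded free $R$-module of algebraic differential $j$-forms on $\mathbb{C}^n$, with $\deg x_i=\deg dx_i=1$. $\operatorname{Sing} f^{-1}(0)\subset\mathbb{C}^n$ is the common zero set of the partial derivatives of $f$. ''$f$ is not a polynomial of $n-1$ variables'' means that no linear change of coordinates makes $f$ depend on only $n-1$ variables. $M:=\Omega^n/df\wedge\Omega^{n-1}$, graded so that $M_k$ consists of classes of $n$-forms of degree $k$. With $\mathfrak{m}=(x_1,\dots,x_n)$, $M':=\{a\in M\mid \mathfrak{m}^ja=0 \text{ for } j\gg 0\}$ and $M'':=M/M'$. Set $\mu'_k:=\dim_{\mathbb{C}}M'_k$, $\mu''_k:=\dim_{\mathbb{C}}M''_k$. The integers $\gamma_k$ are defined by $\sum_k\gamma_kt^k=(t^d-t)^n/(t-1)^n$. $Z:=\{f=0\}\subset Y:=\mathbb{P}^{n-1}$, $\Sigma:=\operatorname{Sing}Z$ is the (finite) image in $\mathbb{P}^{n-1}$ of $\operatorname{Sing}f^{-1}(0)\setminus\{0\}$, and $\tau_Z:=\sum_{z\in\Sigma}\dim_{\mathbb{C}}\mathcal{O}_{Y,z}/(h_z,\partial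 h_z)$, where $h_z$ is a local defining equation of $Z$ at $z$ ($h_z$ being $f$ divided by the $d$-th power of a linear form not vanishing at $z$) and $(\partial h_z)$ is the ideal generated by its partial derivatives. *)

(* Defs.v *)
From HB Require Import structures.
From mathcomp Require Import all_boot all_order all_algebra.
From mathcomp Require Import boolp classical_sets functions cardinality fsbigop.
From mathcomp Require Import reals complex mpoly.

Set Implicit Arguments.
Unset Strict Implicit.
Unset Printing Implicit Defensive.

Import Order.TTheory GRing.Theory Num.Theory.

Local Open Scope classical_set_scope.
Local Open Scope ring_scope.

Section Dimension.
Variables (K : fieldType) (V : lmodType K).

(* The classes of the b i form a basis of the image of U in V / W, where U and
   W are subspaces of V. *)
Definition basis_mod (U W : set V) (m : nat) (b : 'I_m -> V) : Prop :=
  [/\ forall i, U (b i),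
      forall u, U u -> exists c : 'I_m -> K, W (u - \sum_i c i *: b i)
    & forall c : 'I_m -> K, W (\sum_i c i *: b i) -> forall i, c i = 0].

(* dim_K U / (U `&` W); equal to 0 when this space is infinite dimensional. *)
Definition dim_quot (U W : set V) : nat :=
  xget 0%N [set m | exists b : 'I_m -> V, basis_mod U W b].

End Dimension.

Section Ideals.
Variable A : comNzRingType.

(* The O-linear combinations of elements of S, for a subring O of A. *)
Definition span_over (O S : set A) : set A :=
  [set a | exists s : seq (A * A),
     (forall x, x \in s -> O x.1 /\ S x.2) /\ a = \sum_(x <- s) x.1 * x.2].

Definition ideal_gen (S : set A) : set A := span_over setT S.

Definition ideal_pow (I : set A) (j : nat) : set A :=
  ideal_gen [set a | exists2 c : 'I_j -> A,
                       forall i, I (c i) & a = \prod_(i < j) c i].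

End Ideals.

Section AffineSpace.
Variables (K : fieldType) (n : nat).

Definition zeros (S : set {mpoly K[n]}) : set 'rV[K]_n :=
  [set v | forall p, S p -> p.@[v 0] = 0].

Definition zariski_closed (X : set 'rV[K]_n) : Prop := exists S, X = zeros S.

Definition zariski_irreducible (X : set 'rV[K]_n) : Prop :=
  [/\ zariski_closed X, X !=set0
    & forall Y Z, zariski_closed Y -> zariski_closed Z ->
        X = Y `|` Z -> X = Y \/ X = Z].

(* dim X <= m for a Zariski closed X: there is no strictly increasing chain
   Z 0, ..., Z m.+1 of irreducible closed subsets of X. *)
Definition zariski_dim_le (X : set 'rV[K]_n) (m : nat) : Prop :=
  forall Z : nat -> set 'rV[K]_n,
    (forall i, (i <= m.+1)%N -> zariski_irreducible (Z i) /\ Z i `<=` X) ->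
    ~ (forall i, (i <= m)%N -> Z i `<` Z i.+1).

Definition sing (f : {mpoly K[n]}) : set 'rV[K]_n :=
  zeros [set p | exists i : 'I_n, p = f^`M(i)].

Definition linear_subst (A : 'M[K]_n) (f : {mpoly K[n]}) : {mpoly K[n]} :=
  f \mPo [tuple \sum_(j < n) A i j *: 'X_j | i < n].

(* Some linear change of coordinates turns f into a polynomial in which one of
   the n variables does not occur. *)
Definition fewer_variables (f : {mpoly K[n]}) : Prop :=
  exists2 A : 'M[K]_n, A \in unitmx &
    exists i : 'I_n, forall m, m \in msupp (linear_subst A f) -> m i = 0%N.

End AffineSpace.

Section DifferentialForms.
Variables (K : fieldType) (n : nat).

(* All algebraic differential forms on K^n: w stands for \sum_J w J dx_J, with
   dx_J = dx_{j_1} /\ ... /\ dx_{j_r} for J = {j_1 < ... < j_r}. *)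
Definition form := {ffun {set 'I_n} -> {mpoly K[n]}}.

Definition is_form (j : nat) : set form :=
  [set w : form | forall J : {set 'I_n}, #|J| != j -> w J = 0].

(* deg x_i = deg dx_i = 1; the zero form has every degree. *)
Definition form_deg (k : int) : set form :=
  [set w : form | forall (J : {set 'I_n}) m, m \in msupp (w J) -> (mdeg m + #|J|)%:Z = k].

Definition form_mul (p : {mpoly K[n]}) (w : form) : form :=
  [ffun J => p * w J].

(* dx_I /\ dx_J = (-1) ^ wedge_inv I J dx_(I :|: J) for disjoint I, J. *)
Definition wedge_inv (I J : {set 'I_n}) : nat :=
  #|[pred p : 'I_n * 'I_n | [&& p.1 \in I, p.2 \in J & (p.2 < p.1)%N]]|.

Definition wedge (w e : form) : form :=
  [ffun J : {set 'I_n} => \sum_(I in powerset J)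
     (-1) ^+ wedge_inv I (J :\: I) * (w I * e (J :\: I))].

Definition dform (f : {mpoly K[n]}) : form :=
  [ffun J : {set 'I_n} => \sum_(i < n | J == [set i]%SET) f^`M(i)].

Variable f : {mpoly K[n]}.

(* The modules M = Omega^n / df /\ Omega^(n-1), M' and M'' = M / M' are handled
   through their preimages in Omega^n. *)
Definition Omega_top (k : int) : set form := is_form n `&` form_deg k.

Definition df_wedge : set form :=
  [set w : form | exists2 e, is_form n.-1 e & w = wedge (dform f) e].

Definition max_ideal : set {mpoly K[n]} :=
  ideal_gen [set p | exists i : 'I_n, p = 'X_i].

Definition M'_pre : set form :=
  [set w : form | is_form n w /\
     exists j0 : nat, forall j, (j0 <= j)%N ->
       forall p, ideal_pow max_ideal j p -> df_wedge (form_mul p w)].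

Definition mu' (k : int) : nat := dim_quot (Omega_top k `&` M'_pre) df_wedge.

Definition mu'' (k : int) : nat := dim_quot (Omega_top k) M'_pre.

End DifferentialForms.

Definition ratfun (K : fieldType) (m : nat) := {fraction {mpoly K[m]}}.

HB.instance Definition _ (K : fieldType) (m : nat) :=
  GRing.Field.on (ratfun K m).

Definition ratfun_scale (K : fieldType) (m : nat) (c : K) (q : ratfun K m) :
  ratfun K m := tofrac (c%:MP_[m]) * q.

Section RatfunScale.
Variables (K : fieldType) (m : nat).
Local Notation scale := (@ratfun_scale K m).

Fact ratfun_scaleA a b q : scale a (scale b q) = scale (a * b) q.
Proof. by rewrite /ratfun_scale mulrA -tofracM -mpolyCM. Qed.

Fact ratfun_scale1 : left_id 1 scale.
Proof. by move=> q; rewrite /ratfun_scale mpolyC1 tofrac1 mul1r. Qed.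

Fact ratfun_scaleDr : right_distributive scale +%R.
Proof. by move=> a p q; rewrite /ratfun_scale mulrDr. Qed.

Fact ratfun_scaleDl q : {morph scale^~ q : a b / a + b}.
Proof. by move=> a b; rewrite /ratfun_scale mpolyCD tofracD mulrDl. Qed.

End RatfunScale.

HB.instance Definition _ (K : fieldType) (m : nat) :=
  GRing.Zmodule_isLmodule.Build K (ratfun K m) (@ratfun_scaleA K m)
    (@ratfun_scale1 K m) (@ratfun_scaleDr K m) (@ratfun_scaleDl K m).

Section LocalRing.
Variables (K : fieldType) (m : nat).

(* The local ring at p of the affine space K^m. *)
Definition local_ring (p : 'rV[K]_m) : set (ratfun K m) :=
  [set q | exists a b : {mpoly K[m]},
             b.@[p 0] != 0 /\ q = tofrac a / tofrac b].

Definition tjurina_ideal (h : {mpoly K[m]}) (p : 'rV[K]_m) : set (ratfun K m) :=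
  span_over (local_ring p)
    [set q | q = tofrac h \/ exists j : 'I_m, q = tofrac (h^`M(j))].

Definition tjurina (h : {mpoly K[m]}) (p : 'rV[K]_m) : nat :=
  dim_quot (local_ring p) (tjurina_ideal h p).

End LocalRing.

Section ProjectiveHypersurface.
Variables (K : fieldType) (n : nat).

(* Points of P^(n-1) are the lines <[v]>, v != 0, of K^n.  On the chart
   x_i != 0, with coordinates x_j / x_i for j != i, the hypersurface f = 0 has
   the equation f / x_i ^ d = chart_eq f i. *)
Definition chart_eq (f : {mpoly K[n]}) (i : 'I_n) : {mpoly K[n.-1]} :=
  f \mPo [tuple if unlift i j is Some l then 'X_l else 1 | j < n].

Definition chart_pt (v : 'rV[K]_n) (i : 'I_n) : 'rV[K]_n.-1 :=
  \row_l (v 0 (lift i l) / v 0 i).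

(* The local Tjurina number does not depend on the chart; the default value is
   never used, since vpick z != 0 for a line z. *)
Definition tjurina_at (f : {mpoly K[n]}) (z : {vspace 'rV[K]_n}) : nat :=
  if [pick i | vpick z 0 i != 0] is Some i
  then tjurina (chart_eq f i) (chart_pt (vpick z) i) else 0%N.

Definition Sigma (f : {mpoly K[n]}) : set {vspace 'rV[K]_n} :=
  [set z | exists v, [/\ sing f v, v != 0 & z = <[v]>%VS]].

Definition tau_Z (f : {mpoly K[n]}) : nat :=
  (\sum_(z \in Sigma f) tjurina_at f z)%N.

End ProjectiveHypersurface.

Definition gamma_poly (n d : nat) : {poly int} :=
  ('X^d - 'X) ^+ n %/ ('X - 1) ^+ n.

(* The division is exact. *)
Lemma gamma_polyP (n d : nat) :
  gamma_poly n d * ('X - 1) ^+ n = ('X^d - 'X) ^+ n.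
Proof.
have mon : ('X - 1 : {poly int}) ^+ n \is monic.
  by rewrite monic_exp // -[1]/(1%:P) monicXsubC.
rewrite /gamma_poly; suff [q ->] : exists q : {poly int}, 'X^d - 'X = q * ('X - 1).
  by rewrite exprMn (Pdiv.IdomainMonic.mulpK mon).
have : root ('X^d - 'X : {poly int}) 1.
  by rewrite /root !hornerE expr1n subrr.
by move/factor_theorem.
Qed.

Definition gamma (n d : nat) (k : int) : int :=
  if k is Posz m then (gamma_poly n d)`_m else 0.

(* Main.v *)
Require Import Defs.
From HB Require Import structures.
From mathcomp Require Import all_boot all_order all_algebra.
From mathcomp Require Import boolp classical_sets functions cardinality fsbigop.
From mathcomp Require Import reals complex mpoly ring zify.

Set Implicit Arguments.
Unset Strict Implicit.
Unset Printing Implicit Defensive.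

Import Order.TTheory GRing.Theory Num.Theory.

Local Open Scope classical_set_scope.
Local Open Scope ring_scope.

(** Write S for the polynomial ring in n variables, J for the ideal of S
    generated by the n partial derivatives of f, which are forms of degree
    e = d - 1, and J'' for the set of a such that J contains the products of a
    with all forms of large degree. Contraction of n-forms identifies M with
    S/J shifted by n, M' with J''/J and M'' with S/J'', so everything is a
    statement about Hilbert functions.

    The projective singular locus is finite: a closed cone has finitely many
    irreducible components, and when its dimension is at most one they can only
    be lines and the origin [cone_lines_finite]. So there is a linear form l that
    vanishes at no singular point, and by the Nullstellensatz J + (l) contains
    all forms of large degree [good_form]. Dependencies among products of two
    forms of equal degree then show that generic combinations of the partial
    derivatives work [generic_comb, reduce_generators]: J = (g_1, ..., g_(n-1), g)
    where (g_1, ..., g_(n-1), l) also contains all forms of large degree.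

    Any n forms of positive degree with this property are a complete intersection [primary_CI]: they
    form a regular sequence, their quotient has Hilbert series
    prod_i (1 + t + ... + t^(d_i - 1)), and its socle lies in degree
    sum_i (d_i - 1). All three properties survive the exchange of one entry for a
    generic linear form, and they are clear for n independent linear forms. A
    quotient whose socle is one-dimensional carries a perfect pairing, and so the
    annihilator of g in it is dual to the quotient by g [gorenstein_duality].

    Apply this to I = (g_1, ..., g_(n-1), l^j), for large j. In a fixed degree I
    does not differ from (g_1, ..., g_(n-1)), so the exact sequence of
    multiplication by g expresses the Hilbert function of S/J through
    (1 + t + ... + t^(e-1))^n, which is t^(-n) times the generating series of the
    gamma_k, and through the annihilator of g. By duality the latter becomes the
    dimension of S/(J + (l^j)) in degree j + n(e-1) - k, and that is tau minus
    the dimension of S/J'' in degree n(e-1) - k, where tau is the Hilbert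
    function of S/J in large degree [hilbert_symmetry].

    It remains to see that tau is the total Tjurina number. In large degree S/J
    is the product of its localisations at the singular points
    [sum_of_multiplicities], and in a chart each of these becomes the Tjurina
    algebra, because by Euler's relation the local equation and its partial
    derivatives generate the same ideal as all partial derivatives of f
    [tjurina_stable, tau_stable]. *)

(** * Dimensions of quotients of subspaces *)

Definition subspace (K : fieldType) (V : lmodType K) (W : set V) : Prop :=
  W 0 /\ forall (a : K) u v, W u -> W v -> W (a *: u + v).

(** As in [basis_mod], W need not be contained in U: the dimension is that of the
    image of U in V / W. *)
Definition dimq (K : fieldType) (V : lmodType K) (U W : set V) (m : nat) :=
  exists b : 'I_m -> V, basis_mod U W b.

Definition spanq (K : fieldType) (V : lmodType K) (U W : set V) (m : nat) :=
  exists b : 'I_m -> V,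
    forall u, U u -> exists c : 'I_m -> K, W (u - \sum_i c i *: b i).

Section Dim.
Variables (K : fieldType) (V : lmodType K).
Implicit Types (U W : set V).

Lemma subspaceD W u v : subspace W -> W u -> W v -> W (u + v).
Proof. by case=> _ h hu hv; have := h 1 _ _ hu hv; rewrite scale1r. Qed.

Lemma subspaceZ W a u : subspace W -> W u -> W (a *: u).
Proof. by case=> h0 h hu; have := h a _ _ hu h0; rewrite addr0. Qed.

Lemma subspaceN W u : subspace W -> W u -> W (- u).
Proof. by move=> h hu; rewrite -scaleN1r; apply: subspaceZ. Qed.

Lemma subspaceB W u v : subspace W -> W u -> W v -> W (u - v).
Proof. by move=> h hu hv; apply: subspaceD => //; apply: subspaceN. Qed.

Lemma subspace_sum (I : Type) (r : seq I) (P : pred I) W (F : I -> V) :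
  subspace W -> (forall i, P i -> W (F i)) -> W (\sum_(i <- r | P i) F i).
Proof.
by move=> h hF; apply: big_ind => //; [case: h | move=> x y; apply: subspaceD].
Qed.

Lemma subspace_comb W m (c : 'I_m -> K) (b : 'I_m -> V) :
  subspace W -> (forall i, W (b i)) -> W (\sum_i c i *: b i).
Proof. by move=> h hb; apply: subspace_sum => // i _; apply: subspaceZ. Qed.

Lemma subspaceI U W : subspace U -> subspace W -> subspace (U `&` W).
Proof.
move=> [u0 hu] [w0 hw]; split; first by split.
by move=> a x y [? ?] [? ?]; split; [apply: hu | apply: hw].
Qed.

(** A nonzero row vector in the kernel of the coefficient matrix gives the
    dependency. *)
Lemma spanq_dep U W m k (v : 'I_k -> V) :
    subspace W -> spanq U W m -> (m < k)%N -> (forall i, U (v i)) ->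
  exists c : 'I_k -> K, (exists i, c i != 0) /\ W (\sum_i c i *: v i).
Proof.
move=> hW [b hb] ltmk hv.
have [A hA] := boolp.choice (fun i => hb _ (hv i)).
pose M : 'M[K]_(k, m) := \matrix_(i, j) A i j.
have kM : kermx M != 0.
  rewrite -mxrank_eq0 mxrank_ker subn_eq0 -ltnNge.
  exact: leq_ltn_trans (rank_leq_col _) ltmk.
pose u := nz_row (kermx M).
have uM : u *m M = 0 by apply/sub_kermxP; apply: nz_row_sub.
exists (fun i => u 0 i); split.
  have: u != 0 by rewrite nz_row_eq0.
  by move/rV0Pn=> [i hi]; exists i.
have -> : \sum_i u 0 i *: v i = \sum_i u 0 i *: (v i - \sum_j A i j *: b j).
  apply/esym; under eq_bigr do rewrite scalerBr.
  rewrite sumrB [X in _ - X](_ : _ = 0) ?subr0 //.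
  under eq_bigr do rewrite scaler_sumr.
  rewrite exchange_big /= big1 // => j _.
  under eq_bigr do rewrite scalerA.
  rewrite -scaler_suml.
  have /(congr1 (fun N : 'M[K]_(1, m) => N 0 j)) := uM.
  rewrite !mxE; under eq_bigr do rewrite mxE.
  by move->; rewrite scale0r.
exact: subspace_comb.
Qed.

Lemma dimq_span U W m : dimq U W m -> spanq U W m.
Proof. by case=> b [_ h _]; exists b. Qed.

Lemma dimq_le_span U W m k :
  subspace W -> spanq U W m -> dimq U W k -> (k <= m)%N.
Proof.
move=> hW hs [b [hb _ hi]]; case: leqP => // /(spanq_dep hW hs) /(_ hb).
by case=> c [[i /negP hc] /hi /(_ i) ci0]; case: hc; rewrite ci0.
Qed.

Lemma dimq_uniq U W m k : subspace W -> dimq U W m -> dimq U W k -> m = k.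
Proof.
move=> hW hm hk; apply/eqP; rewrite eqn_leq.
by rewrite (dimq_le_span hW (dimq_span hk) hm) (dimq_le_span hW (dimq_span hm) hk).
Qed.

(** An independent family in U of maximal size is a basis. *)
Lemma spanq_dimq U W m :
  subspace W -> spanq U W m -> exists2 k, (k <= m)%N & dimq U W k.
Proof.
move=> hW hs.
pose P k := exists2 v : 'I_k -> V, (forall i, U (v i))
  & forall c, W (\sum_i c i *: v i) -> forall i, c i = 0.
have P0 : exists k, `[< P k >].
  exists 0%N; apply/asboolP; exists (fun=> 0); first by case.
  by move=> c _ [].
have Pm k : `[< P k >] -> (k <= m)%N.
  case/asboolP=> v hv hi; case: leqP => // /(spanq_dep hW hs) /(_ hv).
  by case=> c [[i /negP hc] /hi /(_ i) ci0]; case: hc; rewrite ci0.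
case: (ex_maxnP P0 Pm) => k /asboolP [v hv hi] kmax.
exists k; first by apply: Pm; apply/asboolP; exists v.
exists v; split => // u hu.
apply: contrapT => nspan.
suff /kmax : `[< P k.+1 >] by rewrite ltnn.
apply/asboolP.
exists (fun i => if unlift ord_max i is Some j then v j else u).
  by move=> i; case: unliftP => [j|] _; [apply: hv | apply: hu].
move=> c; rewrite big_ord_recr /= unlift_none.
have e (j : 'I_k) : widen_ord (leqnSn k) j = lift ord_max j.
  by apply: val_inj; rewrite /= /bump leqNgt ltn_ord.
under eq_bigr do rewrite e liftK.
have [c0|c0] := eqVneq (c ord_max) 0.
  rewrite c0 scale0r addr0 => /hi hc i.
  by case: (unliftP ord_max i) => [j ->|-> //]; apply: hc.
move=> hc; case: nspan.
exists (fun j => - ((c ord_max)^-1 * c (lift ord_max j))).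
have := subspaceZ (c ord_max)^-1 hW hc.
rewrite scalerDr scalerA mulVf // scale1r addrC scaler_sumr.
congr W; congr (_ + _); rewrite -sumrN; apply: eq_bigr => j _.
by rewrite scaleNr opprK scalerA.
Qed.

Lemma spanq_sub U W m U0 W0 :
  spanq U W m -> U0 `<=` U -> W `<=` W0 -> spanq U0 W0 m.
Proof.
by move=> [b hb] hU hW; exists b => u /hU/hb [c hc]; exists c; apply: hW.
Qed.

(** Additivity of dimensions along W <= W0, in the form of an exact sequence
    0 -> (U cap W0) / W -> U / W -> U / W0 -> 0. *)
Lemma dimq_add U W W0 a b : subspace U -> subspace W -> subspace W0 ->
  W `<=` W0 -> dimq U W0 a -> dimq (U `&` W0) W b -> dimq U W (a + b).
Proof.
move=> hU hW hW0 sW [u [u1 u2 u3]] [v [v1 v2 v3]].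
exists (fun i => match fintype.split i with inl j => u j | inr j => v j end).
have E (c : 'I_(a + b) -> K) :
  \sum_i c i *: (match fintype.split i with inl j => u j | inr j => v j end) =
  \sum_i c (lshift b i) *: u i + \sum_i c (rshift a i) *: v i.
  rewrite big_split_ord; congr (_ + _); apply: eq_bigr => i _.
    by rewrite (fintype.unsplitK (inl i)).
  by rewrite (fintype.unsplitK (inr i)).
split.
- by move=> i; case: fintype.split => j; [apply: u1 | case: (v1 j)].
- move=> x hx; have [c hc] := u2 x hx.
  have [c' hc'] : exists c', W (x - \sum_i c i *: u i - \sum_i c' i *: v i).
    by apply: v2; split => //; apply: subspaceB => //; apply: subspace_comb.
  exists (fun i => match fintype.split i with inl j => c j | inr j => c' j end).
  rewrite E opprD addrA.
  under eq_bigr do rewrite (fintype.unsplitK (inl _)).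
  by under [X in _ - X]eq_bigr do rewrite (fintype.unsplitK (inr _)).
move=> c; rewrite E => hc.
have cl i : c (lshift b i) = 0.
  apply: (u3 (fun j => c (lshift b j))).
  rewrite -[X in W0 X](addrK (\sum_i c (rshift a i) *: v i)).
  apply: subspaceB => //; first exact: sW.
  by apply: subspace_comb => // j; case: (v1 j).
have cr i : c (rshift a i) = 0.
  apply: (v3 (fun j => c (rshift a j))).
  by move: hc; rewrite big1 ?add0r // => j _; rewrite cl scale0r.
by move=> i; rewrite -(fintype.splitK i); case: (fintype.split i).
Qed.

Lemma dim_quotE U W m : subspace W -> dimq U W m -> dim_quot U W = m.
Proof.
move=> hW hm; rewrite /dim_quot; case: xgetP => [k -> hk|/(_ m)] //.
exact: (dimq_uniq hW hk hm).
Qed.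

End Dim.

(** A linear map that induces an isomorphism U / W -> U' / W' carries a basis to
    a basis. *)
Lemma dimq_transport (K : fieldType) (V V' : lmodType K) (phi : V -> V')
    (U W : set V) (U' W' : set V') m :
    linear phi -> subspace U -> subspace W' ->
    (forall u, U u -> U' (phi u)) ->
    (forall u, U u -> (W' (phi u) <-> W u)) ->
    (forall u', U' u' -> exists2 u, U u & W' (u' - phi u)) ->
  dimq U W m -> dimq U' W' m.
Proof.
move=> lphi sU sW' hU hW hs [b [b1 b2 b3]].
pose phiL : {linear V -> V'} :=
  HB.pack phi (GRing.isLinear.Build K V V' _ phi lphi).
have E (c : 'I_m -> K) : phi (\sum_i c i *: b i) = \sum_i c i *: phi (b i).
  by rewrite -[phi]/(phiL : V -> V') linear_sum; apply: eq_bigr => i _; rewrite linearZ.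
have B u v : phi (u - v) = phi u - phi v.
  by rewrite -[phi]/(phiL : V -> V') linearB.
exists (phi \o b); split.
- by move=> i; apply: hU.
- move=> u' /hs [u hu hu']; have [c hc] := b2 u hu; exists c; rewrite -E.
  have -> : u' - phi (\sum_i c i *: b i) =
            (u' - phi u) + phi (u - \sum_i c i *: b i).
    by rewrite B addrA subrK.
  apply: subspaceD => //; apply/hW => //.
  by apply: subspaceB => //; apply: subspace_comb.
- move=> c; rewrite /= -E => hc; apply: b3; apply/hW => //.
  exact: subspace_comb.
Qed.

Section Pairing.
Variables (K : fieldType) (V V' : lmodType K) (beta : V -> V' -> K).
Hypothesis betal : forall u', scalar (beta^~ u').
Hypothesis betar : forall u, scalar (beta u).

(** With fewer basis vectors of U than of U', some nonzero combination of the
    latter would be orthogonal to U. *)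
Lemma pairing_le (U W : set V) (U' W' : set V') m m' :
    subspace U -> subspace U' ->
    (forall u u', U u -> U' u' -> W u -> beta u u' = 0) ->
    (forall u', U' u' -> (forall u, U u -> beta u u' = 0) -> W' u') ->
  dimq U W m -> dimq U' W' m' ->
  (m' <= m)%N.
Proof.
move=> sU sU' hW hW' [b [b1 b2 _]] [b' [b1' _ b3']].
have E u (c : 'I_m' -> K) :
    beta u (\sum_j c j *: b' j) = \sum_j c j * beta u (b' j).
  pose g : {scalar V'} := HB.pack (beta u) (GRing.isLinear.Build K V' K _ _ (betar u)).
  rewrite -[beta u]/(g : V' -> K) linear_sum; apply: eq_bigr => i _.
  by rewrite linearZ.
have E' u' (c : 'I_m -> K) :
    beta (\sum_j c j *: b j) u' = \sum_j c j * beta (b j) u'.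
  pose g : {scalar V} := HB.pack (beta^~ u') (GRing.isLinear.Build K V K _ _ (betal u')).
  rewrite -[LHS]/(g _) linear_sum; apply: eq_bigr => i _.
  by rewrite linearZ.
case: leqP => // ltm.
have : exists c : 'I_m' -> K, (exists j, c j != 0) /\
         [set w : 'rV[K]_m | w = 0] (\sum_j c j *: \row_i beta (b i) (b' j)).
  apply: (@spanq_dep _ _ setT _ m) => //.
    by split => // a u v -> ->; rewrite scaler0 addr0.
  exists (delta_mx 0) => u _; exists (fun i => u 0 i) => /=.
  by rewrite -row_sum_delta subrr.
case=> c [[j cj] hc].
suff cj0 : c j = 0 by rewrite cj0 eqxx in cj.
apply: b3'; apply: hW'; first exact: subspace_comb.
move=> u hu; have [t ht] := b2 u hu.
rewrite -[u](subrK (\sum_i t i *: b i)).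
set w := u - _; have hw : U w by apply: subspaceB => //; apply: subspace_comb.
have := betal (\sum_j c j *: b' j) 1 w (\sum_i t i *: b i).
rewrite scale1r => ->; rewrite hW //; last exact: subspace_comb.
rewrite mulr0 add0r E' big1 // => i _; rewrite E.
have /(congr1 (fun N : 'M[K]_(1, m) => N 0 i)) := hc.
rewrite summxE !mxE => hci; apply/eqP; rewrite mulf_eq0; apply/orP; right.
rewrite -[X in _ == X]hci; apply/eqP/eq_bigr => k _.
by rewrite !mxE.
Qed.

End Pairing.

(** A bilinear form that induces a nondegenerate pairing of U / W and U' / W'
    forces these spaces to have the same dimension. *)
Lemma dimq_pairing (K : fieldType) (V V' : lmodType K) (beta : V -> V' -> K)
    (U W : set V) (U' W' : set V') m m' :
    (forall u', scalar (beta^~ u')) -> (forall u, scalar (beta u)) ->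
    subspace U -> subspace U' ->
    (forall u u', U u -> U' u' -> W u \/ W' u' -> beta u u' = 0) ->
    (forall u, U u -> (forall u', U' u' -> beta u u' = 0) -> W u) ->
    (forall u', U' u' -> (forall u, U u -> beta u u' = 0) -> W' u') ->
  dimq U W m -> dimq U' W' m' -> m = m'.
Proof.
move=> bl br sU sU' h0 hW hW' hm hm'; apply/eqP; rewrite eqn_leq.
apply/andP; split.
  apply: (pairing_le (beta := fun u' u => beta u u') br bl sU' sU _ _ hm' hm).
    by move=> u' u hu' hu hw; apply: h0 => //; right.
  by move=> u hu h; apply: hW.
apply: (pairing_le bl br sU sU' _ _ hm hm') => //.
by move=> u u' hu hu' hw; apply: h0 => //; left.
Qed.

(** * Homogeneous ideals and their Hilbert functions *)

Section Ideals.
Variables (K : fieldType) (n : nat).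
Notation S := {mpoly K[n]}.
Implicit Types (I : set S) (s : seq S) (a b c u v p q : S).

Definition ideal I : Prop :=
  [/\ I 0, forall a b, I a -> I b -> I (a + b) & forall c a, I a -> I (c * a)].

Definition adjoin I u : set S := [set a | exists c, I (a - c * u)].

Definition colon I u : set S := [set a | I (u * a)].

Fixpoint gen_ideal s : set S := if s is u :: s' then adjoin (gen_ideal s') u else [set 0].

Definition rad I : set S := [set a | exists N, I (a ^+ N)].

Definition graded I : Prop := forall k a, I a -> I (pihomog mdeg k a).

(** The ideal contains a power of the ideal generated by the variables. *)
Definition primary I : Prop := forall i : 'I_n, rad I 'X_i.

Definition homogs (k : nat) : set S := [set p | p \is k.-homog].

Section IdealTheory.
Variable I : set S.
Hypothesis hI : ideal I.

Lemma ideal0 : I 0. Proof. by case: hI. Qed.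

Lemma idealD a b : I a -> I b -> I (a + b).
Proof. by case: hI => _ h _; apply: h. Qed.

Lemma idealM c a : I a -> I (c * a).
Proof. by case: hI => _ _; apply. Qed.

Lemma idealMr c a : I a -> I (a * c).
Proof. by rewrite mulrC; apply: idealM. Qed.

Lemma idealN a : I a -> I (- a).
Proof. by rewrite -mulN1r; apply: idealM. Qed.

Lemma idealB a b : I a -> I b -> I (a - b).
Proof. by move=> ha hb; apply: idealD => //; apply: idealN. Qed.

Lemma idealZ (t : K) a : I a -> I (t *: a).
Proof. by rewrite -mul_mpolyC; apply: idealM. Qed.

Lemma ideal_subspace : subspace I.
Proof.
by split=> [|t u v hu hv]; [exact: ideal0 | apply: idealD => //; apply: idealZ].
Qed.

Lemma ideal_sum (T : Type) (r : seq T) (P : pred T) (F : T -> S) :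
  (forall i, P i -> I (F i)) -> I (\sum_(i <- r | P i) F i).
Proof. by move=> hF; apply: big_ind => //; [exact: ideal0 | exact: idealD]. Qed.

Lemma ideal_sum_seq (T : eqType) (r : seq T) (F : T -> S) :
  (forall i, i \in r -> I (F i)) -> I (\sum_(i <- r) F i).
Proof.
move=> hF; rewrite big_seq; apply: big_ind => //; [exact: ideal0 | exact: idealD].
Qed.

Lemma ideal_trans a b : I (a - b) -> I b -> I a.
Proof. by move=> h1 h2; rewrite -(subrK b a); apply: idealD. Qed.

Lemma ideal_transl a b : I (a - b) -> I a -> I b.
Proof. by move=> h1 h2; rewrite -(subKr a b); apply: idealB. Qed.

Lemma rad_ideal : ideal (rad I).
Proof.
split.
- by exists 1%N; rewrite expr1; apply: ideal0.
- move=> a b [N hN] [M hM]; exists (N + M)%N; rewrite exprDn.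
  apply: ideal_sum => i _; rewrite -mulr_natl; apply: idealM.
  have [le|lt] := leqP M i.
    have -> : b ^+ i = b ^+ (i - M) * b ^+ M by rewrite -exprD subnK.
    by rewrite mulrA; apply: idealM.
  have le : (N <= N + M - i)%N by lia.
  have -> : a ^+ (N + M - i) = a ^+ (N + M - i - N) * a ^+ N by rewrite -exprD subnK.
  by rewrite -mulrA; apply: idealM; apply: idealMr.
- by move=> c a [N hN]; exists N; rewrite exprMn; apply: idealM.
Qed.

Lemma sub_rad : I `<=` rad I.
Proof. by move=> a ha; exists 1%N; rewrite expr1. Qed.

Lemma radX a N : rad I (a ^+ N) -> rad I a.
Proof. by case=> M hM; exists (N * M)%N; rewrite exprM. Qed.

Lemma adjoin_ideal u : ideal (adjoin I u).
Proof.
split.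
- by exists 0; rewrite mul0r subrr; apply: ideal0.
- move=> a b [c hc] [d hd]; exists (c + d).
  by rewrite mulrDl opprD addrACA; apply: idealD.
- by move=> c a [d hd]; exists (c * d); rewrite -mulrA -mulrBr; apply: idealM.
Qed.

Lemma colon_ideal u : ideal (colon I u).
Proof.
split; rewrite /colon /=.
- by rewrite mulr0; apply: ideal0.
- by move=> a b; rewrite mulrDr; apply: idealD.
- by move=> c a h; rewrite mulrCA; apply: idealM.
Qed.

Lemma sub_adjoin u : I `<=` adjoin I u.
Proof. by move=> a ha; exists 0; rewrite mul0r subr0. Qed.

Lemma adjoin_gen u : adjoin I u u.
Proof. by exists 1; rewrite mul1r subrr; apply: ideal0. Qed.

Lemma sub_colon u : I `<=` colon I u.
Proof. by move=> a ha; apply: idealM. Qed.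

Lemma adjoin_sub u (I' : set S) : ideal I' -> I `<=` I' -> I' u -> adjoin I u `<=` I'.
Proof.
move=> [_ hD hM] hs hu a [c hc]; rewrite -(subrK (c * u) a).
by apply: hD; [apply: hs | apply: hM].
Qed.

End IdealTheory.

Lemma rad_mono I I' : I `<=` I' -> rad I `<=` rad I'.
Proof. by move=> h a [N hN]; exists N; apply: h. Qed.

Lemma rad_rad I I' : ideal I' -> I `<=` rad I' -> rad I `<=` rad I'.
Proof.
by move=> hI' h a [N hN]; apply: radX; apply: h; exact: hN.
Qed.

Lemma rad_adjoin I I' u : ideal I' -> I `<=` I' -> rad I' u ->
  rad (adjoin I u) `<=` rad I'.
Proof.
move=> hI' hs hu; apply: rad_rad => //; apply: adjoin_sub => //.
  exact: rad_ideal.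
by move=> a /hs; apply: sub_rad.
Qed.

Lemma gen_ideal_ideal s : ideal (gen_ideal s).
Proof.
elim: s => [|u s ih]; last exact: adjoin_ideal.
by split => // [a b -> -> | c a ->] /=; rewrite ?addr0 ?mulr0.
Qed.

Lemma mem_gen_ideal s u : u \in s -> gen_ideal s u.
Proof.
elim: s => // v s ih; rewrite inE => /orP[/eqP->|/ih h].
  exact: adjoin_gen (gen_ideal_ideal s) _.
exact: sub_adjoin.
Qed.

Lemma gen_ideal_sub s I : ideal I -> (forall u, u \in s -> I u) -> gen_ideal s `<=` I.
Proof.
move=> hI; elim: s => [_ a -> | u s ih h]; first exact: ideal0.
apply: adjoin_sub => //; last by apply: h; rewrite mem_head.
by apply: ih => v hv; apply: h; rewrite inE hv orbT.
Qed.

Lemma gen_ideal_mono s t : {subset s <= t} -> gen_ideal s `<=` gen_ideal t.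
Proof.
by move=> h; apply: gen_ideal_sub (gen_ideal_ideal t) _ => u /h; apply: mem_gen_ideal.
Qed.

Lemma gen_ideal_eq s t : s =i t -> gen_ideal s = gen_ideal t.
Proof.
by move=> h; apply/seteqP; split; apply: gen_ideal_mono => x; rewrite h.
Qed.

Lemma primary_mono I I' : I `<=` I' -> primary I -> primary I'.
Proof. by move=> h hI i; apply: rad_mono (hI i). Qed.

Lemma primary_rad I I' : ideal I' -> I `<=` rad I' -> primary I -> primary I'.
Proof. by move=> hI' h hI i; apply: (rad_rad hI' h). Qed.

Lemma ideal_monomials I p : ideal I -> (forall m, m \in msupp p -> I 'X_[m]) -> I p.
Proof.
move=> hI h; rewrite [p]mpolyE.
by apply: ideal_sum_seq => // m hm; apply: idealZ => //; apply: h.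
Qed.

(** If every N_i-th power of a variable lies in I, then so does every monomial of
    degree larger than the sum of the N_i. *)
Lemma primary_degE I : ideal I -> primary I ->
  exists k0, forall p, (forall m, m \in msupp p -> (k0 <= mdeg m)%N) -> I p.
Proof.
move=> hI hm; have [N hN] := boolp.choice hm.
pose M := (\sum_i N i)%N; exists M.+1 => p hp.
apply: ideal_monomials => // m /hp hdeg.
have [i hi] : exists i, (N i <= m i)%N.
  apply: contrapT => /forallNP h.
  suff : (mdeg m <= M)%N by rewrite leqNgt hdeg.
  rewrite mdegE; apply: leq_sum => i _.
  by move/negP: (h i); rewrite -ltnNge; apply: ltnW.
have le : (U_(i) *+ N i <= m)%MM.
  apply/mnm_lepP => j; rewrite mulmnE mnm1E.
  by case: eqVneq => [<-|]; rewrite ?mul1n.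
by rewrite -(submK le) mpolyXD -mpolyXn; apply: idealM.
Qed.

Lemma primary_deg I : ideal I -> primary I ->
  exists k0, forall k p, (k0 <= k)%N -> homogs k p -> I p.
Proof.
move=> hI hm; have [k0 h] := primary_degE hI hm; exists k0 => k p le hp.
by apply: h => m hmm; rewrite (dhomog_mf hp hmm).
Qed.

Lemma primary_rad_homog I d p : ideal I -> primary I -> (0 < d)%N ->
  p \is d.-homog -> rad I p.
Proof.
move=> hI hm d0 hp; have [k0 h] := primary_deg hI hm.
by exists k0; apply: (h (d * k0)%N); [rewrite leq_pmull | apply: dhomogMn].
Qed.

Lemma homogs_subspace k : subspace (homogs k).
Proof.
split; first exact: dhomog0.
by move=> a u v hu hv; apply: dhomogD => //; apply: dhomogZ.
Qed.

Lemma homogsM k l p q : homogs k p -> homogs l q -> homogs (k + l) (p * q).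
Proof. exact: dhomogM. Qed.

Lemma homogs_var i : homogs 1 ('X_i : S).
Proof. by rewrite /homogs /= dhomogX; apply/eqP; apply: mdeg1. Qed.

Lemma pihomog_homog k l p : homogs k p -> pihomog mdeg l p = if l == k then p else 0.
Proof.
by move=> hp; case: eqVneq => [->|ne]; [apply: pihomog_dE | apply: pihomog_ne0 hp; rewrite eq_sym].
Qed.

Lemma pihomog_sum p : exists N : nat, p = \sum_(i < N) pihomog mdeg i p.
Proof. by exists (mmeasure mdeg p); exact: pihomog_partitionE (leqnn _). Qed.

(** Graded components commute with multiplication by a form. *)
Lemma pihomogM d k p u : u \is d.-homog ->
  pihomog mdeg k (p * u) = if (d <= k)%N then pihomog mdeg (k - d) p * u else 0.
Proof.
move=> hu; have [N e] := pihomog_sum p.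
have h i j : pihomog mdeg i (pihomog mdeg j p * u) =
    if i == (j + d)%N then pihomog mdeg j p * u else 0.
  by apply: pihomog_homog; apply: homogsM => //; apply: pihomogP.
rewrite {1}e mulr_suml raddf_sum /=.
case: leqP => [le|lt].
  rewrite {2}e raddf_sum /= mulr_suml; apply: eq_bigr => i _.
  rewrite h (pihomog_homog _ (pihomogP _ _ _)).
  have -> : (k == i + d)%N = (k - d == i)%N by lia.
  by case: ifP => // _; rewrite mul0r.
rewrite big1 // => i _; rewrite h; case: eqP => //; lia.
Qed.

Lemma adjoin_graded I d u : ideal I -> graded I -> u \is d.-homog -> graded (adjoin I u).
Proof.
move=> hI gI hu k a [c hc]; have := gI k _ hc.
rewrite raddfB /= (pihomogM _ _ hu); case: leqP => _ h.
  by exists (pihomog mdeg (k - d) c).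
by exists 0; rewrite mul0r.
Qed.

Lemma colon_graded I d u : graded I -> u \is d.-homog -> graded (colon I u).
Proof.
move=> gI hu k a; rewrite /colon /= => /(gI (k + d)%N).
by rewrite mulrC (pihomogM _ _ hu) leq_addl addnK mulrC.
Qed.

Lemma gen_ideal_graded s :
  (forall u, u \in s -> exists d, u \is d.-homog) -> graded (gen_ideal s).
Proof.
elim: s => [_ k a -> | u s ih h] /=; first by rewrite raddf0.
have [d hd] := h u (mem_head _ _).
apply: adjoin_graded hd; first exact: gen_ideal_ideal.
by apply: ih => v hv; apply: h; rewrite inE hv orbT.
Qed.

(** ** Hilbert functions *)

Definition hilbert I k : nat := dim_quot (homogs k) I.

Lemma homogs_span I k : ideal I -> exists N, spanq (homogs k) I N.
Proof.
move=> hI; exists #|{: 'X_{1..n < k.+1}}|, (fun i => 'X_[(enum_val i : 'X_{1..n < k.+1})]) => p hp.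
have hs : (msize p <= k.+1)%N.
  have [->|p0] := eqVneq p 0; first by rewrite msize0.
  by rewrite -mlead_deg // (dhomog_mf hp) // mlead_supp.
exists (fun i => p@_(enum_val i : 'X_{1..n < k.+1})).
rewrite {1}(mpolywE hs) (reindex _ (onW_bij _ (enum_val_bij _))) subrr.
exact: ideal0.
Qed.

Lemma hilbertP I k : ideal I -> dimq (homogs k) I (hilbert I k).
Proof.
move=> hI; have [N hN] := homogs_span k hI; have sI := ideal_subspace hI.
by have [m _ hm] := spanq_dimq sI hN; rewrite /hilbert (dim_quotE sI hm).
Qed.

Lemma hilbert_dimq I k m : ideal I -> dimq (homogs k) I m -> hilbert I k = m.
Proof. by move=> hI; apply: dim_quotE; apply: ideal_subspace. Qed.

Lemma hilbert_mono I I' k : ideal I -> ideal I' -> (forall a, homogs k a -> I a -> I' a) ->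
  (hilbert I' k <= hilbert I k)%N.
Proof.
move=> hI hI' h; apply: (dimq_le_span (ideal_subspace hI') _ (hilbertP k hI')).
have [b [b1 b2 b3]] := hilbertP k hI; exists b => u hu; have [c hc] := b2 u hu.
exists c; apply: h => //; apply: subspaceB => //; first exact: homogs_subspace.
by apply: subspace_comb => //; apply: homogs_subspace.
Qed.

Lemma hilbert_eq I I' k : ideal I -> ideal I' -> (forall a, homogs k a -> (I a <-> I' a)) ->
  hilbert I k = hilbert I' k.
Proof.
by move=> hI hI' h; apply/eqP; rewrite eqn_leq; apply/andP; split;
  apply: hilbert_mono => // a /h ->.
Qed.

Lemma hilbert_eq0 I k : ideal I -> (hilbert I k = 0%N) <-> homogs k `<=` I.
Proof.
move=> hI; split => [h0 p hp|h].
  have := hilbertP k hI; rewrite h0 => -[b [_ /(_ p hp) [c]]].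
  by rewrite big_ord0 subr0.
apply: (hilbert_dimq hI); exists (fun=> 0); split => //; first by case.
  by move=> u hu; exists (fun=> 0); rewrite big_ord0 subr0; apply: h.
by move=> c _ [].
Qed.

(** The exact sequence 0 -> S/(I : u) -> S/I -> S/(I + u) -> 0 in one degree. *)
Lemma hilbert_exact I d u k : ideal I -> graded I -> u \is d.-homog ->
  hilbert I (k + d) = (hilbert (adjoin I u) (k + d) + hilbert (colon I u) k)%N.
Proof.
move=> hI gI hu; apply: hilbert_dimq => //.
have sS l := homogs_subspace l; have sI := ideal_subspace hI.
have hA := adjoin_ideal hI u; have sA := ideal_subspace hA.
apply: (dimq_add _ sI sA (sub_adjoin u) (hilbertP _ hA)) => //.
apply: (dimq_transport (phi := fun a => u * a) _ (sS k) sI _ _ _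
          (hilbertP k (colon_ideal hI u))) => //.
- by move=> t x y; rewrite mulrDr scalerAr.
- move=> a ha; split; first by rewrite addnC; apply: homogsM.
  by rewrite mulrC; exists a; rewrite subrr; apply: ideal0.
- move=> b [hb [c hc]]; exists (pihomog mdeg k c); first exact: pihomogP.
  have := gI (k + d)%N _ hc; rewrite raddfB /= (pihomogM _ _ hu) leq_addl addnK.
  by rewrite (pihomog_dE hb) mulrC.
Qed.

(** Multiples of u only appear in degree d and above. *)
Lemma hilbert_exact_lt I d u k : ideal I -> graded I -> u \is d.-homog -> (k < d)%N ->
  hilbert I k = hilbert (adjoin I u) k.
Proof.
move=> hI gI hu lt; apply: hilbert_eq => //; first exact: adjoin_ideal.
move=> a ha; split; first exact: sub_adjoin.
case=> c /(gI k); rewrite raddfB /= (pihomogM _ _ hu) leqNgt lt /= subr0.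
by rewrite (pihomog_dE ha).
Qed.

(** Multiplication by u is onto modulo I in large degrees when I + u is
    primary to the ideal of the variables. *)
Lemma hilbert_bounded I d u : ideal I -> graded I -> u \is d.-homog -> (0 < d)%N ->
  primary (adjoin I u) -> exists D, forall k, (hilbert I k <= D)%N.
Proof.
move=> hI gI hu d0 hm; have hA := adjoin_ideal hI u.
have [k0 hk0] := primary_deg hA hm.
exists (\sum_(i < k0 + d) hilbert I i)%N => k.
have [l] := ubnP k; elim: l k => // l ih k; rewrite ltnS => lek.
have [lt|le] := ltnP k (k0 + d).
  by rewrite (bigD1 (Ordinal lt)) //= leq_addr.
have dk : (d <= k)%N by lia.
rewrite -(subnK dk) (hilbert_exact _ hI gI hu) (_ : hilbert (adjoin I u) _ = 0)%N.
  rewrite add0n; apply: leq_trans (ih (k - d)%N _); last by lia.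
  by apply: hilbert_mono => //; [exact: colon_ideal | move=> a _; apply: sub_colon].
by apply/hilbert_eq0 => // p; apply: hk0; lia.
Qed.

End Ideals.

(** * Exchange of generators *)

Lemma poly_nonroot (K : numFieldType) (p : {poly K}) :
  p != 0 -> exists u, p.[u] != 0.
Proof.
move=> p0; apply: contrapT => /forallNP h.
pose r := [seq (k%:R : K) | k <- iota 0 (size p)].
have ur : uniq r by rewrite map_inj_uniq ?iota_uniq //; apply: mulrIn; apply: oner_neq0.
have ar : all (root p) r.
  by apply/allP => x _; rewrite /root; apply/negPn/negP/h.
by have := max_poly_roots p0 ar ur; rewrite size_map size_iota ltnn.
Qed.

Section Exchange.
Variables (K : numFieldType) (n : nat).
Notation S := {mpoly K[n]}.
Implicit Types (I C : set S) (s : seq S) (a b c u v p q f g : S).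

(** The D + 1 products g ^ i * f ^ (D - i) are dependent modulo I; for a u which
    is not a root of the dependency, a power of f lies in I + (g - u f). *)
Lemma generic_pair I D e g f : ideal I -> (forall k, (hilbert I k <= D)%N) ->
    g \is e.-homog -> f \is e.-homog ->
  exists u : K, rad (adjoin I (g - u *: f)) f.
Proof.
move=> hI hD hg hf'.
pose v (i : 'I_D.+1) := g ^+ i * f ^+ (D - i).
have hv i : homogs (e * D)%N (v i).
  have -> : (e * D = e * i + e * (D - i))%N.
    by rewrite -mulnDr subnKC // -ltnS.
  by apply: homogsM; apply: dhomogMn.
have [c [[i0 hi0] hc]] := spanq_dep (ideal_subspace hI)
  (dimq_span (hilbertP (e * D) hI)) (hD _ : (_ < D.+1)%N) hv.
pose P := \poly_(i < D.+1) (if insub i is Some j then c j else 0).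
have cE (i : 'I_D.+1) : P`_i = c i by rewrite coef_poly ltn_ord valK.
have P0 : P != 0.
  by apply: contra_neq hi0 => P0; rewrite -cE P0 coef0.
have [u hu] := poly_nonroot P0; exists u, D.
have hA := adjoin_ideal hI (g - u *: f).
suff : adjoin I (g - u *: f) (P.[u] *: f ^+ D).
  by move/(idealZ hA P.[u]^-1); rewrite scalerA mulVf // scale1r.
apply: (ideal_transl hA _ (sub_adjoin _ hc)).
have -> : P.[u] *: f ^+ D = \sum_i c i *: ((u *: f) ^+ i * f ^+ (D - i)).
  rewrite horner_poly scaler_suml; apply: eq_bigr => i _.
  rewrite valK exprZn -scalerAl -exprD subnKC; last by rewrite -ltnS.
  by rewrite scalerA.
rewrite -sumrB; apply: ideal_sum => // i _.
rewrite -scalerBr -mulrBl; apply: idealZ => //; apply: idealMr => //.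
rewrite subrXX; apply: idealMr => //; exact: adjoin_gen.
Qed.

(** The form g absorbs the members of s one after the other: whatever is
    nilpotent modulo an earlier combination stays so modulo the later ones. *)
Lemma generic_comb I D e g s : ideal I -> (forall k, (hilbert I k <= D)%N) ->
    g \is e.-homog -> {in s, forall f, f \is e.-homog} ->
  exists g', [/\ g' \is e.-homog, gen_ideal s (g' - g)
    & {in g :: s, forall f, rad (adjoin I g') f}].
Proof.
move=> hI hD; elim: s g => [|f s ih] g hg hs.
  exists g; split => //; first by rewrite subrr; apply: ideal0; apply: gen_ideal_ideal.
  by move=> x; rewrite inE => /eqP ->; exists 1%N; rewrite expr1; apply: adjoin_gen.
have hf' : f \is e.-homog by apply: hs; rewrite mem_head.
have [u hu] := generic_pair hI hD hg hf'.
have h1 : g - u *: f \is e.-homog by apply: rpredB => //; apply: rpredZ.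
have [|g' [h2 h3 h4]] := ih _ h1.
  by move=> x hx; apply: hs; rewrite inE hx orbT.
have hs' := gen_ideal_ideal (f :: s).
have hA := adjoin_ideal hI g'.
have hr : rad (adjoin I g') f.
  apply: (rad_adjoin hA (@sub_adjoin _ _ I g') _ hu).
  by apply: h4; rewrite mem_head.
exists g'; split => //.
  have -> : g' - g = (g' - (g - u *: f)) - u *: f by rewrite opprB addrA addrAC addrK.
  apply: idealB => //; last by apply: idealZ => //; apply: mem_gen_ideal; rewrite mem_head.
  exact: sub_adjoin.
move=> x; rewrite !inE => /or3P[/eqP->|/eqP-> //|hx].
  rewrite -(subrK (u *: f) g); have hR := rad_ideal hA.
  apply: idealD => //; last exact: idealZ.
  by apply: h4; rewrite mem_head.
by apply: h4; rewrite inE hx orbT.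
Qed.

(** A generic combination of the variables makes all of them nilpotent. *)
Lemma generic_linear I d u : ideal I -> graded I -> u \is d.-homog -> (0 < d)%N ->
  primary (adjoin I u) -> exists2 l, l \is 1.-homog & primary (adjoin I l).
Proof.
move=> hI gI hu d0 hm; have [D hD] := hilbert_bounded hI gI hu d0 hm.
have hX : {in [seq 'X_i | i <- enum 'I_n], forall f : S, f \is 1.-homog}.
  by move=> x /mapP[i _ ->]; apply: homogs_var.
have [l [h1 _ h3]] := generic_comb hI hD (dhomog0 _ mdeg 1) hX.
exists l => // i; apply: h3; rewrite inE; apply/orP; right.
by apply/mapP; exists i => //; rewrite mem_enum.
Qed.

(** * Homogeneous complete intersections *)

Definition nonzerodiv I u : Prop := forall a, I (u * a) -> I a.

(** The sequence is read from its end: each entry is regular modulo those that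
    follow it. *)
Fixpoint regular s : Prop :=
  if s is u :: s' then nonzerodiv (gen_ideal s') u /\ regular s' else True.

Lemma nonzerodivX I u N : nonzerodiv I u -> nonzerodiv I (u ^+ N).
Proof.
move=> h; elim: N => [|N ih] a; first by rewrite expr0 mul1r.
by rewrite exprS -mulrA => /h/ih.
Qed.

(** If a power of u is a multiple of v modulo I, then v divides a nonzerodivisor. *)
Lemma nonzerodiv_rad I u v : ideal I -> nonzerodiv I u -> rad (adjoin I v) u -> nonzerodiv I v.
Proof.
move=> hI hu [N [c hc]] a hva; apply: (nonzerodivX (N := N) hu).
rewrite -(subrK (c * v) (u ^+ N)) mulrDl; apply: idealD => //.
  exact: idealMr.
by rewrite -mulrA; apply: idealM.
Qed.

Lemma nonzerodiv_homog I d u : ideal I -> graded I -> u \is d.-homog ->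
  (forall k a, homogs k a -> I (u * a) -> I a) -> nonzerodiv I u.
Proof.
move=> hI gI hu h a hua; have [N ->] := pihomog_sum a.
apply: ideal_sum => // i _; apply: (h i); first exact: pihomogP.
exact: colon_graded gI hu i a hua.
Qed.

(** Regular sequences of forms of positive degree can be permuted; without a
    grading the second half of the argument would fail. *)
Lemma nonzerodiv_swap C d u e v : ideal C -> graded C -> u \is d.-homog ->
  v \is e.-homog -> (0 < e)%N -> nonzerodiv C v -> nonzerodiv (adjoin C v) u ->
  nonzerodiv C u /\ nonzerodiv (adjoin C u) v.
Proof.
move=> hC gC hu hv e0 nv nu; split.
  apply: (nonzerodiv_homog hC gC hu) => k; have [l] := ubnP k.
  elim: l k => // l ih k; rewrite ltnS => lek a ha hua.
  have /nu [c /(gC k)] : adjoin C v (u * a) by apply: sub_adjoin.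
  rewrite raddfB /= (pihomog_dE ha) (pihomogM _ _ hv).
  case: leqP => [le|_]; last by rewrite subr0.
  set c' := pihomog _ _ _ => hc; apply: (ideal_trans hC hc); apply: idealMr => //.
  apply: (ih (k - e)%N); [lia | exact: pihomogP | apply: nv].
  rewrite mulrC -mulrA; apply: (ideal_transl hC _ hua).
  by rewrite -mulrBr; apply: idealM.
move=> a [c hc].
have [b hb] : adjoin C v c.
  apply: nu; exists a; rewrite -opprB; apply: idealN => //.
  by rewrite mulrC (mulrC u).
exists b; apply: nv; rewrite mulrBr.
have -> : v * a - v * (b * u) = v * a - c * u + u * (c - b * v) by ring.
by apply: idealD => //; apply: idealM.
Qed.

Definition pos_homogs s := forall u, u \in s -> exists2 d, (0 < d)%N & u \is d.-homog.

Lemma pos_homogs_graded s : pos_homogs s -> graded (gen_ideal s).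
Proof. by move=> h; apply: gen_ideal_graded => u /h [d _ hd]; exists d. Qed.

Lemma pos_homogs_cons u s : pos_homogs (u :: s) ->
  (exists2 d, (0 < d)%N & u \is d.-homog) /\ pos_homogs s.
Proof.
move=> h; split; first by apply: h; rewrite mem_head.
by move=> v hv; apply: h; rewrite inE hv orbT.
Qed.

(** Bringing an entry to the front by exchanging neighbours. *)
Lemma regular_front s1 u s2 : pos_homogs (s1 ++ u :: s2) -> regular (s1 ++ u :: s2) ->
  regular (u :: s1 ++ s2).
Proof.
elim: s1 => // w s1 ih /pos_homogs_cons[[e e0 he] hh] [nw /(ih hh) [nu rs]].
have [d d0 hd] : exists2 d, (0 < d)%N & u \is d.-homog.
  by apply: hh; rewrite mem_cat mem_head orbT.
have hg : graded (gen_ideal (s1 ++ s2)).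
  apply: pos_homogs_graded => x hx; apply: hh; move: hx.
  by rewrite !mem_cat inE => /orP[->//|->]; rewrite !orbT.
have nw' : nonzerodiv (gen_ideal (u :: s1 ++ s2)) w.
  have <- // : gen_ideal (s1 ++ u :: s2) = gen_ideal (u :: s1 ++ s2).
  by apply: gen_ideal_eq => x; rewrite !(mem_cat, inE) orbCA.
have [nw2 nu2] := nonzerodiv_swap (gen_ideal_ideal _) hg he hd d0 nu nw'.
by split => //; split.
Qed.

(** ** Sequences of linear forms *)

(** An ideal generated by variables is spanned by monomials. *)
Lemma gen_ideal_vars (r : seq 'I_n) a : gen_ideal [seq 'X_i | i <- r] a <->
  (forall m, m \in msupp a -> exists2 i, i \in r & (0 < m i)%N).
Proof.
split; last first.
  move=> h; apply: ideal_monomials; first exact: gen_ideal_ideal.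
  move=> m /h [i hi mi].
  have le : (U_(i) <= m)%MM by rewrite lep1mP -lt0n.
  rewrite -(submK le) mpolyXD; apply: idealM; first exact: gen_ideal_ideal.
  by apply: mem_gen_ideal; apply: map_f.
pose I : set S := [set a : S | forall m : 'X_{1..n}, (forall i, i \in r -> m i = 0%N) -> a@_m = 0].
have hI : ideal I.
  split; rewrite /I /=.
  - by move=> m _; rewrite mcoeff0.
  - by move=> x y hx hy m hm; rewrite mcoeffD hx // hy // addr0.
  - move=> c x hx m hm; rewrite mcoeffM big1 // => -[k1 k2] /= /eqP e.
    rewrite hx ?mulr0 // => i hi; have := hm i hi.
    by move: e => /(congr1 (fun t : 'X_{1..n} => t i)); rewrite mnmDE; lia.
have : gen_ideal [seq 'X_i | i <- r] `<=` I.
  apply: gen_ideal_sub => // x /mapP[i hi ->] m hm.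
  rewrite mcoeffX; case: eqP => // e; have := hm i hi.
  by rewrite -e mnm1E eqxx.
move=> hs /hs hIa m; rewrite mcoeff_msupp => am; apply: contrapT => h.
move/eqP: am; apply; apply: hIa => i hi; apply/eqP; rewrite -leqn0 leqNgt.
by apply/negP => lt; apply: h; exists i.
Qed.

Lemma regular_vars (r : seq 'I_n) : uniq r -> regular [seq 'X_i | i <- r].
Proof.
elim: r => //= i r ih /andP[ir ur]; split; last exact: ih.
move=> a /gen_ideal_vars h; apply/gen_ideal_vars => m hm.
have : (U_(i) + m)%MM \in msupp ('X_i * a).
  by rewrite mulrC mcoeff_msupp mcoeffMX -mcoeff_msupp.
move/h => [j hj]; rewrite mnmDE mnm1E; case: eqVneq => [e|_].
  by rewrite e hj in ir.
by rewrite add0n; exists j.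
Qed.

End Exchange.

Section Morphism.
Variables (K : numFieldType) (n : nat) (phi psi : {rmorphism {mpoly K[n]} -> {mpoly K[n]}}).
Hypotheses (phiK : cancel phi psi) (psiK : cancel psi phi).

Lemma gen_ideal_morph s a : gen_ideal (map phi s) (phi a) <-> gen_ideal s a.
Proof.
elim: s a => [|u s ih] a /=.
  by split => [h|->]; [rewrite -(phiK a) h rmorph0 | rewrite rmorph0].
split=> -[c hc].
  by exists (psi c); apply/ih; rewrite rmorphB rmorphM /= psiK.
by exists (phi c); rewrite -rmorphM -rmorphB; apply/ih.
Qed.

Lemma regular_morph s : regular s -> regular (map phi s).
Proof.
elim: s => //= u s ih [nu /ih]; split => // a h.
rewrite -(psiK a); apply/gen_ideal_morph; apply: nu; apply/gen_ideal_morph.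
by rewrite rmorphM /= psiK.
Qed.

End Morphism.

(** 1 + t + ... + t ^ (d - 1), the Hilbert series of K[x] / (x ^ d). *)
Definition geom (d : nat) : {poly int} := \poly_(i < d) 1.

Lemma geomS d : geom d.+1 = geom d + 'X^d.
Proof.
apply/polyP => i; rewrite coefD !coef_poly coefXn; case: (ltngtP i d) => h.
- by rewrite ltnS ltnW // addr0.
- by rewrite ltnS leqNgt h.
- by rewrite h ltnSn.
Qed.

Section CompleteIntersection.
Variables (K : numFieldType) (n : nat).
Notation S := {mpoly K[n]}.
Implicit Types (I C : set S) (s : seq S) (a b c u v p f g : S).
(** Generators are listed together with their degrees. *)
Implicit Types (t : seq (S * nat)).

Definition homog_gens t := all (fun x => (0 < x.2)%N && (x.1 \is x.2.-homog)) t.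

Definition ci_series t : {poly int} := \prod_(x <- t) geom x.2.

Definition ci_socle t : nat := (\sum_(x <- t) x.2.-1)%N.

Definition socle_in I (r : nat) : Prop :=
  forall k a, homogs k a -> (forall i : 'I_n, I ('X_i * a)) -> I a \/ k = r.

(** The three properties of complete intersections that pass from one sequence to
    another when an entry is exchanged; the quotient by [unzip1 t] has socle in
    degree the sum of the d_i - 1. *)
Definition CI t : Prop :=
  [/\ regular (unzip1 t), forall k, (hilbert (gen_ideal (unzip1 t)) k)%:Z = (ci_series t)`_k
    & socle_in (gen_ideal (unzip1 t)) (ci_socle t)].

Lemma homog_gens_pos t : homog_gens t -> pos_homogs (unzip1 t).
Proof.
move=> /allP h u /mapP[x /h /andP[h1 h2] ->]; by exists x.2.
Qed.

(** Both quotients have the Hilbert series of S / C times 1 - t or 1 - t ^ d, and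
    1 - t ^ d is 1 - t times [geom d]. *)
Lemma ci_series_exchange C l g d (Q : {poly int}) : ideal C -> graded C ->
    l \is 1.-homog -> g \is d.-homog -> nonzerodiv C l -> nonzerodiv C g ->
    (forall k, (hilbert (adjoin C l) k)%:Z = Q`_k) ->
  forall k, (hilbert (adjoin C g) k)%:Z = (geom d * Q)`_k.
Proof.
move=> hC gC hl hg nl ng hQ.
have cE u k : nonzerodiv C u -> hilbert (colon C u) k = hilbert C k.
  move=> nu; apply: hilbert_eq => //; first exact: colon_ideal.
  by move=> a _; split; [apply: nu | apply: sub_colon].
have E e k : (geom e * Q)`_k =
    (hilbert C k)%:Z - (if (e <= k)%N then (hilbert C (k - e))%:Z else 0).
  elim: e => [|e ih].
    rewrite (_ : geom 0 = 0) ?mul0r ?coef0 ?subn0 ?subrr //.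
    by apply/polyP => i; rewrite coef_poly coef0.
  rewrite geomS mulrDl coefD ih coefXnM.
  case: ltngtP => h.
  - by rewrite addr0.
  - rewrite -hQ; have -> : (k - e = (k - e.+1) + 1)%N by lia.
    by rewrite (hilbert_exact _ hC gC hl) (cE l) //; lia.
  - by rewrite h subnn -hQ -(hilbert_exact_lt hC gC hl) //; lia.
move=> k; rewrite E; case: leqP => h.
  have {1 2}-> : k = ((k - d) + d)%N by lia.
  rewrite (hilbert_exact _ hC gC hg) (cE g) //; lia.
by rewrite -(hilbert_exact_lt hC gC hg) // subr0.
Qed.

Lemma ideal_linear I l a : ideal I -> l \is 1.-homog ->
  (forall i : 'I_n, I ('X_i * a)) -> I (l * a).
Proof.
move=> hI hl ha; have hJ : ideal (colon I a) by exact: colon_ideal.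
rewrite mulrC; apply: (ideal_monomials hJ) => m /(dhomog_mf hl) /eqP.
by rewrite mdeg_eq1 => /existsP[i /eqP ->]; rewrite /colon /= mulrC.
Qed.

(** Both C + l and C + g are compared with C + l ^ N, where l ^ N = c g modulo C:
    multiplication by l ^ (N - 1), respectively by c, embeds the quotient by the
    former ideals in the quotient by C + l ^ N, and the socle of the latter lies
    in the first image. *)
Lemma socle_exchange C l g d r : ideal C -> graded C ->
    l \is 1.-homog -> g \is d.-homog -> (0 < d)%N -> nonzerodiv C l ->
    rad (adjoin C g) l -> socle_in (adjoin C l) r ->
  socle_in (adjoin C g) (r + d.-1).
Proof.
move=> hC gC hl hg d0 nl [N0 hN0] hs.
have hA u : ideal (adjoin C u) by apply: adjoin_ideal.
pose N := (N0 + d)%N.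
have [c hc hcg] : exists2 c, homogs (N - d) c & C (l ^+ N - c * g).
  have [c hc] : adjoin C g (l ^+ N) by rewrite /N addnC exprD; apply: idealM.
  exists (pihomog mdeg (N - d) c); first exact: pihomogP.
  have := gC N _ hc; rewrite raddfB /= (pihomogM _ _ hg).
  have hlN : l ^+ N \is N.-homog by have := dhomogMn N hl; rewrite mul1n.
  by rewrite (pihomog_dE hlN) /N leq_addl.
have nc : nonzerodiv C c.
  move=> a ha; apply: (nonzerodivX (N := N) nl).
  apply: (ideal_trans hC (b := g * (c * a))); last exact: idealM.
  by rewrite mulrCA !mulrA -mulrBl; apply: idealMr => //; rewrite mulrC.
have N1 : N = (N.-1).+1 by rewrite prednK // /N; lia.
have AE u v : C (u - v) -> adjoin C u `<=` adjoin C v.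
  move=> huv a [s hsu]; exists s.
  have -> : a - s * v = (a - s * u) + s * (u - v) by ring.
  by apply: idealD => //; apply: idealM.
have hAl : adjoin C (l ^+ N) = adjoin C (c * g).
  apply/seteqP; split; apply: AE => //.
  by rewrite -opprB; apply: idealN.
have up : socle_in (adjoin C (l ^+ N)) (r + N.-1).
  move=> k b hb hX.
  have [s hs1] := ideal_linear (hA _) hl hX.
  have : C (b - s * l ^+ N.-1).
    apply: nl; rewrite mulrBr; have <- // : s * l ^+ N = l * (s * l ^+ N.-1).
    by rewrite {1}N1 exprS; ring.
  move/(gC k); rewrite raddfB /= (pihomog_dE hb).
  have hlN : l ^+ N.-1 \is N.-1.-homog by have := dhomogMn N.-1 hl; rewrite mul1n.
  rewrite (pihomogM _ _ hlN); case: leqP => [le|_]; last first.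
    by rewrite subr0 => h; left; apply: sub_adjoin.
  set s' := pihomog _ _ _ => hs'.
  have hX' i : adjoin C l ('X_i * s').
    have [e he] : adjoin C (l ^+ N) ('X_i * (s' * l ^+ N.-1)).
      apply: (ideal_transl (hA _) _ (hX i)).
      by rewrite -mulrBr; apply: sub_adjoin; apply: idealM.
    exists e; apply: (nonzerodivX (N := N.-1) nl).
    have <- // : 'X_i * (s' * l ^+ N.-1) - e * l ^+ N
       = l ^+ N.-1 * ('X_i * s' - e * l).
    by rewrite {2}N1 exprS; ring.
  have [[e he]|e] := hs _ _ (pihomogP _ _ _) hX'; last first.
    by right; rewrite -e subnK.
  left; apply: (ideal_trans (hA _) (sub_adjoin _ hs')); exists e.
  have -> : s' * l ^+ N.-1 - e * l ^+ N = (s' - e * l) * l ^+ N.-1.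
    by rewrite {2}N1 exprS; ring.
  exact: idealMr.
move=> k b hb hX.
have hcb : homogs (N - d + k) (c * b) by apply: homogsM.
have [|h|e] := up _ _ hcb.
- move=> i; have [e he] := hX i; rewrite hAl; exists e.
  have -> : 'X_i * (c * b) - e * (c * g) = c * ('X_i * b - e * g) by ring.
  exact: idealM.
- move: h; rewrite hAl => -[e he]; left; exists e; apply: nc.
  by have <- // : c * b - e * (c * g) = c * (b - e * g) by ring.
- by right; rewrite /N in e *; lia.
Qed.

Lemma CI_exchange C l g d t : gen_ideal (unzip1 t) = C -> homog_gens t ->
    l \is 1.-homog -> g \is d.-homog -> (0 < d)%N -> primary (adjoin C g) ->
    CI ((l, 1%N) :: t) -> CI ((g, d) :: t).
Proof.
move=> eC ht hl hg d0 hm [[nl rt] hH hS]; rewrite /= eC in nl hH hS *.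
have hC : ideal C by rewrite -eC; apply: gen_ideal_ideal.
have gC : graded C by rewrite -eC; apply/pos_homogs_graded/homog_gens_pos.
have hr : rad (adjoin C g) l by apply: primary_rad_homog hl => //; apply: adjoin_ideal.
have ng : nonzerodiv C g by apply: nonzerodiv_rad hr.
have g1 : geom 1 = 1 by apply/polyP => i; rewrite coef_poly coef1; case: i.
split; rewrite /= ?eC; first by [].
  have hH' k : (hilbert (adjoin C l) k)%:Z = (ci_series t)`_k.
    by rewrite hH /ci_series big_cons g1 mul1r.
  by rewrite /ci_series big_cons; apply: ci_series_exchange hH'.
have -> : ci_socle ((g, d) :: t) = (ci_socle t + d.-1)%N by rewrite /ci_socle big_cons addnC.
have hS' : socle_in (adjoin C l) (ci_socle t) by move: hS; rewrite /ci_socle big_cons.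
exact: socle_exchange hS'.
Qed.

Lemma CI_front t1 x t2 : homog_gens (t1 ++ x :: t2) -> CI (t1 ++ x :: t2) ->
  CI (x :: t1 ++ t2).
Proof.
have hp : perm_eq (x :: t1 ++ t2) (t1 ++ x :: t2).
  by rewrite -cat1s perm_catCA.
move=> /homog_gens_pos hh [h1 h2 h3].
have e : gen_ideal (unzip1 (x :: t1 ++ t2)) = gen_ideal (unzip1 (t1 ++ x :: t2)).
  by apply/gen_ideal_eq/perm_mem/perm_map.
split.
- move: hh h1; rewrite /unzip1 /= !map_cat /=; exact: regular_front.
- by move=> k; rewrite e h2 /ci_series (perm_big _ hp).
- by rewrite e /ci_socle (perm_big _ hp).
Qed.

End CompleteIntersection.

Section LinearForms.
Variables (K : numFieldType) (n : nat).
Notation S := {mpoly K[n]}.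

Lemma linear_formE (l : S) : l \is 1.-homog -> l = \sum_(j < n) l@_(U_(j)) *: 'X_j.
Proof.
move=> hl; apply/mpolyP => m; rewrite raddf_sum /=.
have [h|h] := boolP (mdeg m == 1%N); last first.
  rewrite (dhomog_nemf_coeff hl h) big1 // => i _.
  rewrite mcoeffZ mcoeffX; case: eqP => [e|]; last by rewrite mulr0.
  by rewrite -e mdeg1 eqxx in h.
move: h; rewrite mdeg_eq1 => /existsP[i /eqP ->].
rewrite (bigD1 i) //= mcoeffZ mcoeffX eqxx mulr1 big1 ?addr0 // => j ji.
rewrite mcoeffZ mcoeffX; case: eqP; rewrite ?mulr0 // => /eqP.
by rewrite eq_mnm1 (negbTE ji).
Qed.

Lemma eval_ideal (v : 'I_n -> K) : ideal [set p : S | p.@[v] = 0].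
Proof.
split=> /= [|a b ha hb|c a ha]; first exact: meval0.
  by rewrite mevalD ha hb addr0.
by rewrite mevalM ha mulr0.
Qed.

Variable l : 'I_n -> S.
Hypothesis hl : forall i, l i \is 1.-homog.
Let lst := [seq l i | i <- enum 'I_n].
Hypothesis hm : primary (gen_ideal lst).

Let A : 'M[K]_n := \matrix_(i, j) (l i)@_(U_(j)).

Let lE i : l i = \sum_j A i j *: 'X_j.
Proof. by rewrite {1}(linear_formE (hl i)); apply: eq_bigr => j _; rewrite mxE. Qed.

(** A nonzero vector in the kernel would be a common zero of the forms, hence of
    powers of all variables. *)
Let A_unit : A \in unitmx.
Proof.
rewrite -unitmx_tr -row_free_unit -kermx_eq0; apply/negPn/negP => h.
pose u := nz_row (kermx A^T).
have u0 : u != 0 by rewrite nz_row_eq0.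
have uA : u *m A^T = 0 by apply/sub_kermxP; apply: nz_row_sub.
have hu i : (l i).@[fun j => u 0 j] = 0.
  rewrite lE raddf_sum /=.
  have /(congr1 (fun N : 'M[K]_(1, n) => N 0 i)) := uA; rewrite !mxE => hu; rewrite -[RHS]hu.
  by apply: eq_bigr => j _; rewrite mevalZ mevalXU !mxE mulrC.
have := gen_ideal_sub (eval_ideal (fun j => u 0 j)) (s := lst).
move=> /(_ _) hs.
case/rV0Pn: u0 => i; apply/negP/negPn; have [N hN] := hm i.
have {hN} : ('X_i ^+ N : S).@[fun j => u 0 j] = 0.
  by apply: hs hN => x /mapP[j _ ->].
by rewrite rmorphXn /= mevalXU => /eqP; rewrite expf_eq0 => /andP[].
Qed.

Let B := invmx A.

Let phi : {rmorphism S -> S} := comp_mpoly [tuple l i | i < n].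
Let psi : {rmorphism S -> S} :=
  comp_mpoly [tuple \sum_j B i j *: ('X_j : S) | i < n].

Let comp_linear (c : 'I_n -> K) (t : n.-tuple S) :
  (\sum_j c j *: ('X_j : S)) \mPo t = \sum_j c j *: tnth t j.
Proof.
rewrite raddf_sum /=; apply: eq_bigr => j _.
by rewrite comp_mpolyZ comp_mpolyXU (tnth_nth 0).
Qed.

Let comp_comp (t s : n.-tuple S) : (forall i, tnth t i \mPo s = 'X_i) ->
  forall p, (p \mPo t) \mPo s = p.
Proof.
move=> h p; rewrite -[RHS]comp_mpoly_id; elim/mpolyind: p => [|c m p _ _ ih].
  by rewrite !comp_mpoly0.
rewrite !comp_mpolyD ih; congr (_ + _); rewrite !comp_mpolyZ; congr (_ *: _).
rewrite !comp_mpolyX rmorph_prod; apply: eq_bigr => i _.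
by rewrite rmorphXn /= h tnth_mktuple.
Qed.

Let phiK : cancel phi psi.
Proof.
apply: comp_comp => i; rewrite tnth_mktuple lE comp_linear.
under eq_bigr do rewrite tnth_mktuple scaler_sumr.
rewrite exchange_big /= (bigD1 i) //= [X in _ + X]big1 ?addr0.
  under eq_bigr do rewrite scalerA.
  rewrite -scaler_suml (_ : \sum_j _ = (A *m B) i i); last by rewrite mxE.
  by rewrite /B mulmxV // mxE eqxx scale1r.
move=> j ji; under eq_bigr do rewrite scalerA.
rewrite -scaler_suml (_ : \sum_j _ = (A *m B) i j); last by rewrite mxE.
by rewrite /B mulmxV // mxE eq_sym (negbTE ji) scale0r.
Qed.

Let psi_l i : \sum_j B i j *: l j = 'X_i.
Proof.
under eq_bigr do rewrite lE scaler_sumr.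
rewrite exchange_big /= (bigD1 i) //= [X in _ + X]big1 ?addr0.
  under eq_bigr do rewrite scalerA.
  rewrite -scaler_suml (_ : \sum_j _ = (B *m A) i i); last by rewrite mxE.
  by rewrite /B mulVmx // mxE eqxx scale1r.
move=> j ji; under eq_bigr do rewrite scalerA.
rewrite -scaler_suml (_ : \sum_j _ = (B *m A) i j); last by rewrite mxE.
by rewrite /B mulVmx // mxE eq_sym (negbTE ji) scale0r.
Qed.

Let psiK : cancel psi phi.
Proof.
apply: comp_comp => i; rewrite tnth_mktuple comp_linear.
by rewrite -[RHS]psi_l; apply: eq_bigr => j _; rewrite tnth_mktuple.
Qed.

(** A linear change of coordinates reduces to the sequence of the variables, for
    which the quotient is the ground field. *)
Lemma CI_linear : CI [seq (l i, 1%N) | i <- enum 'I_n].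
Proof.
have e1 : unzip1 [seq (l i, 1%N) | i <- enum 'I_n] = lst.
  by rewrite /unzip1 -map_comp.
have hI := gen_ideal_ideal lst.
have hX i : gen_ideal lst 'X_i.
  rewrite -psi_l; apply: ideal_sum => // j _; apply: idealZ => //.
  by apply: mem_gen_ideal; apply: map_f; rewrite mem_enum.
have hdeg p : (forall m, m \in msupp p -> (0 < mdeg m)%N) -> gen_ideal lst p.
  move=> h; apply: ideal_monomials => // m /h.
  rewrite lt0n mdeg_eq0 => /eqP hm0.
  have [i hi] : exists i, (0 < m i)%N.
    apply: contrapT => /forallNP h'; apply: hm0; apply/mnmP => i.
    by move/negP: (h' i); rewrite -leqNgt leqn0 mnm0E => /eqP.
  have le : (U_(i) <= m)%MM by rewrite lep1mP -lt0n.
  by rewrite -(submK le) mpolyXD; apply: idealM.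
have hpos k p : homogs k p -> (0 < k)%N -> gen_ideal lst p.
  by move=> hp k0; apply: hdeg => m /(dhomog_mf hp) ->.
have h0 p : gen_ideal lst p -> p.@[fun=> 0] = 0.
  apply: (gen_ideal_sub (eval_ideal _)) => x /mapP[j _ ->] /=.
  rewrite lE raddf_sum /= big1 // => k _.
  by rewrite mevalZ mevalXU mulr0.
have g1 : geom 1 = 1 by apply/polyP => i; rewrite coef_poly coef1; case: i.
split; rewrite ?e1.
- have -> : lst = map phi [seq 'X_i | i <- enum 'I_n].
    rewrite -[RHS]map_comp; apply: eq_map => i /=.
    by rewrite comp_mpolyXU -tnth_nth tnth_mktuple.
  by apply: (regular_morph phiK psiK); apply: regular_vars; apply: enum_uniq.
- move=> k.
  have -> : ci_series [seq (l i, 1%N) | i <- enum 'I_n] = 1.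
    by rewrite /ci_series big_map big1.
  rewrite coef1; case: posnP => [->|k0].
    rewrite (_ : hilbert _ _ = 1%N) //; apply: (hilbert_dimq hI).
    exists (fun=> 1); split; first by move=> _; apply: dhomog1.
      move=> p hp; exists (fun=> p@_0); rewrite big_ord1.
      apply: hdeg => m; rewrite mcoeff_msupp mcoeffB mcoeffZ mcoeff1.
      case: (eqVneq m 0%MM) => [->|m0 _]; first by rewrite mulr1 subrr eqxx.
      by rewrite lt0n mdeg_eq0.
    move=> c; rewrite big_ord1 => /h0; rewrite mevalZ meval1 mulr1 => c0 i.
    by rewrite ord1.
  rewrite (_ : hilbert _ _ = 0%N) //; apply/(hilbert_eq0 _ hI) => p hp.
  exact: hpos hp k0.
move=> k a ha _; have [->|k0] := posnP k.
  by right; rewrite /ci_socle big_map big1.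
by left; apply: hpos ha k0.
Qed.

End LinearForms.

Section CITheorem.
Variables (K : numFieldType) (n : nat).
Notation S := {mpoly K[n]}.
Implicit Types (t : seq (S * nat)).

Let linear t := all (fun x => x.2 == 1%N) t.

Lemma CI_all_linear t : size t = n -> homog_gens t -> linear t ->
  primary (gen_ideal (unzip1 t)) -> CI t.
Proof.
move=> st /allP ht /allP lt hm.
pose l (i : 'I_n) : S := (nth (0, 1%N) t i).1.
have et : t = [seq (l i, 1%N) | i <- enum 'I_n].
  apply: (@eq_from_nth _ (0, 1%N)); first by rewrite size_map size_enum_ord.
  rewrite st => i hi; rewrite (nth_map (Ordinal hi)) ?size_enum_ord //.
  rewrite /l nth_enum_ord // [LHS]surjective_pairing; congr (_, _).
  by apply/eqP/lt/mem_nth; rewrite st.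
have eu : unzip1 t = [seq l i | i <- enum 'I_n].
  by rewrite et /unzip1 -map_comp.
rewrite et; apply: CI_linear; last by rewrite -eu.
move=> i; have /ht/andP[_] := mem_nth (0, 1%N) (eq_ind_r (fun m => (i < m)%N) (ltn_ord i) st).
by have /lt/eqP-> := mem_nth (0, 1%N) (eq_ind_r (fun m => (i < m)%N) (ltn_ord i) st).
Qed.

(** The entries are exchanged for generic linear forms one after the other; the
    induction is on the number of entries before the linear ones. *)
Theorem primary_CI t : size t = n -> homog_gens t -> primary (gen_ideal (unzip1 t)) -> CI t.
Proof.
suff T a b : size (a ++ b) = n -> homog_gens (a ++ b) -> linear b ->
    primary (gen_ideal (unzip1 (a ++ b))) -> CI (a ++ b).
  by move=> h1 h2 h3; have := T t [::]; rewrite cats0; apply.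
elim: a b => [|[g d] a ih] b; first exact: CI_all_linear.
rewrite /= => st /andP[/andP[/= d0 hg] ht] hb.
set C := gen_ideal (unzip1 (a ++ b)) => hm.
have hC : ideal C by apply: gen_ideal_ideal.
have gC : graded C by apply/pos_homogs_graded/homog_gens_pos.
have [l hl hml] := generic_linear hC gC hg d0 hm.
apply: (CI_exchange (C := C) (l := l)) => //.
move: ht; rewrite /homog_gens all_cat => /andP[ha hb'].
have hh : homog_gens (a ++ (l, 1%N) :: b) by rewrite /homog_gens all_cat ha /= hl.
apply: CI_front => //; apply: ih => //.
- by apply: etrans st; rewrite !size_cat /= addnS.
suff -> : gen_ideal (unzip1 (a ++ (l, 1%N) :: b)) = adjoin C l by [].
rewrite -[adjoin C l]/(gen_ideal (l :: unzip1 (a ++ b))); apply: gen_ideal_eq => x.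
by rewrite /unzip1 !map_cat /= !(mem_cat, inE) orbCA.
Qed.

End CITheorem.

(** * Duality *)

Section Duality.
Variables (K : numFieldType) (n : nat).
Notation S := {mpoly K[n]}.
Implicit Types (I C J : set S) (s : seq S) (a b c u v p f g : S).

(** The quotient of I' by I vanishes in a degree where both have the same
    codimension. *)
Lemma hilbert_eq_sub I I' k : ideal I -> ideal I' -> I `<=` I' -> hilbert I k = hilbert I' k ->
  forall a, homogs k a -> I' a -> I a.
Proof.
move=> hI hI' h e a ha h'; have sI := ideal_subspace hI.
have sI' := ideal_subspace hI'; have sS := @homogs_subspace K n k.
have sub : homogs k `&` I' `<=` @homogs K n k by move=> x [].
have [m _ hm] := spanq_dimq sI (spanq_sub (dimq_span (hilbertP k hI)) sub (@subset_refl _ I)).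
have := hilbert_dimq hI (dimq_add sS sI sI' h (hilbertP k hI') hm).
rewrite e -[LHS]addn0 => /addnI m0; move: hm; rewrite -m0 => -[b [_ /(_ a) hb _]].
by have [|c] := hb; rewrite ?big_ord0 ?subr0.
Qed.

Lemma geom_monic d : (0 < d)%N -> geom d \is monic /\ size (geom d) = d.
Proof.
case: d => // d _; have s : size (geom d.+1) = d.+1.
  by apply: size_poly_eq; rewrite oner_eq0.
by rewrite monicE lead_coefE s coef_poly ltnSn.
Qed.

Lemma ci_series_monic (t : seq (S * nat)) : homog_gens t ->
  ci_series t \is monic /\ size (ci_series t) = (ci_socle t).+1.
Proof.
rewrite /ci_series /ci_socle; elim: t => [_|x t ih]; first by rewrite !big_nil monic1 size_poly1.
rewrite !big_cons => /andP[/andP[d0 _] /ih [m s]].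
have [m' s'] := geom_monic d0; split; first by rewrite monicMl.
rewrite size_monicM ?monic_neq0 // s s'; lia.
Qed.

Section Gorenstein.
Variable t : seq (S * nat).
Hypotheses (ht : homog_gens t) (hCI : CI t).
Let I := gen_ideal (unzip1 t).
Let r := ci_socle t.

Let hI : ideal I. Proof. exact: gen_ideal_ideal. Qed.

Let hilbert_top : hilbert I r = 1%N.
Proof.
have [_ /(_ r) h _] := hCI; have [m s] := ci_series_monic ht.
move: m; rewrite monicE lead_coefE s /= -h => /eqP; rewrite /I /r; lia.
Qed.

Let above k a : (r < k)%N -> homogs k a -> I a.
Proof.
move=> lt; suff /(hilbert_eq0 k hI) : hilbert I k = 0%N by apply.
have [_ /(_ k) h _] := hCI; have [_ s] := ci_series_monic ht.
by move: h; rewrite nth_default ?s // => -[].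
Qed.

(** A form outside I of degree below the socle has a multiple by a variable
    outside I, so it can be multiplied up to the socle. *)
Let nondeg k a : (k <= r)%N -> homogs k a -> ~ I a ->
  exists2 b, homogs (r - k) b & ~ I (a * b).
Proof.
have [m] := ubnP (r - k)%N; elim: m k a => // m ih k a; rewrite ltnS => lem ler ha na.
move: ler; rewrite leq_eqVlt => /orP[/eqP e|lt].
  by exists 1; [rewrite e subnn; apply: dhomog1 | rewrite mulr1].
have [_ _ hs] := hCI.
have [i hi] : exists i : 'I_n, ~ I ('X_i * a).
  apply: contrapT => h.
  have [i|//|e] := hs _ _ ha; last by move: lt; rewrite e /r ltnn.
  by apply: contrapT => h'; apply: h; exists i.
have ha' : homogs k.+1 ('X_i * a) by rewrite -add1n; apply: homogsM => //; apply: homogs_var.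
have [||b hb nb] := ih k.+1 _ _ _ ha' hi; [lia | by [] | ].
exists (b * 'X_i); last by have <- : 'X_i * a * b = a * (b * 'X_i) by ring.
have -> : (r - k = (r - k.+1) + 1)%N by lia.
by apply: homogsM => //; apply: homogs_var.
Qed.

(** The projection onto the one-dimensional socle. *)
Let dual_form : exists2 lam : S -> K, scalar lam
  & forall u, homogs r u -> (lam u = 0 <-> I u).
Proof.
have := hilbertP r hI; rewrite hilbert_top => -[b [hb hs hi]].
have h u : exists c : K, I (pihomog mdeg r u - c *: b ord0).
  have [c] := hs _ (pihomogP mdeg r u); rewrite big_ord1 => hc.
  by exists (c ord0).
have [lam hlam] := boolp.choice h.
have hi' (c : K) : I (c *: b ord0) -> c = 0.
  by move=> hc; apply: (hi (fun=> c) _ ord0); rewrite big_ord1.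
exists lam => [x u v|u hu].
  apply/eqP; rewrite -subr_eq0; apply/eqP/hi'.
  have -> : (lam (x *: u + v) - (x * lam u + lam v)) *: b ord0 =
    x *: (pihomog mdeg r u - lam u *: b ord0) + (pihomog mdeg r v - lam v *: b ord0)
    - (pihomog mdeg r (x *: u + v) - lam (x *: u + v) *: b ord0).
    rewrite linearP /= scalerBl scalerDl scalerBr scalerA.
    rewrite -!mul_mpolyC !mpolyCM; ring.
  by apply: idealB => //; apply: idealD => //; apply: idealZ.
have := hlam u; rewrite (pihomog_dE hu) => hu'; split => [e|h'].
  by move: hu'; rewrite e scale0r subr0.
by apply: hi'; apply: (ideal_transl hI hu').
Qed.

(** The pairing (a, b) |-> lam (g a b) has kernel I : g on both sides. *)
Lemma colon_sym d g k k' : g \is d.-homog -> (k + k' + d)%N = r ->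
  hilbert (colon I g) k = hilbert (colon I g) k'.
Proof.
move=> hg er; have [lam lin hlam] := dual_form.
have hC := colon_ideal hI g.
have hab a b : homogs k a -> homogs k' b -> homogs r (g * (a * b)).
  by move=> ha hb; rewrite -er addnC; apply: homogsM => //; apply: homogsM.
have sS i := @homogs_subspace K n i.
apply: (dimq_pairing (beta := fun a b => lam (g * (a * b))) _ _ (sS k) (sS k')
  _ _ _ (hilbertP k hC) (hilbertP k' hC)).
- by move=> b x u v; rewrite -lin mulrDl mulrDr -scalerAl -scalerAr.
- by move=> a x u v; rewrite -lin !mulrDr -!scalerAr.
- move=> a b ha hb h; apply/hlam; first exact: hab.
  case: h => h; last by rewrite (mulrC a) mulrA; apply: idealMr.
  by rewrite mulrA; apply: idealMr.
- move=> a ha h; apply: contrapT => na.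
  have hga : homogs (d + k) (g * a) by apply: homogsM.
  have [|b hb nb] := nondeg _ hga na; first by lia.
  apply: nb; rewrite -mulrA.
  have hb' : homogs k' b by move: hb; have -> : (r - (d + k) = k')%N by lia.
  by apply/hlam; [apply: hab | apply: h].
- move=> b hb h; apply: contrapT => nb.
  have hgb : homogs (d + k') (g * b) by apply: homogsM.
  have [|a ha na] := nondeg _ hgb nb; first by lia.
  apply: na; rewrite -mulrA (mulrC b).
  have ha' : homogs k a by move: ha; have -> : (r - (d + k') = k)%N by lia.
  by apply/hlam; [apply: hab | apply: h].
Qed.

(** The annihilator of g in the Gorenstein algebra S / I is dual to the quotient
    by g. *)
Lemma gorenstein_duality d g k : g \is d.-homog -> (k <= r)%N ->
  (hilbert (adjoin I g) (r - k) + hilbert (colon I g) k)%N = hilbert I k.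
Proof.
move=> hg le; have gI : graded I by apply/pos_homogs_graded/homog_gens_pos.
have sym : hilbert I k = hilbert I (r - k).
  have c1 i : hilbert (colon I 1) i = hilbert I i.
    apply: hilbert_eq => //; first exact: colon_ideal.
    by move=> a _; rewrite /colon /= mul1r.
  rewrite -!c1; apply: (@colon_sym 0%N); [exact: dhomog1 | lia].
have [le'|lt] := leqP d (r - k); last first.
  rewrite -(hilbert_exact_lt hI gI hg lt) -sym (_ : hilbert (colon I g) k = 0%N) ?addn0 //.
  apply/hilbert_eq0; first exact: colon_ideal.
  move=> a ha; apply: (above (k := (d + k)%N)); first by lia.
  exact: homogsM.
have e : (r - k = (r - k - d) + d)%N by lia.
rewrite sym {2}e (hilbert_exact _ hI gI hg) -e; congr (_ + _)%N.
by apply: colon_sym hg _; lia.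
Qed.

End Gorenstein.
End Duality.

(** * The Hilbert function of an almost complete intersection of dimension one *)

Lemma geom_mul d : geom d * (1 - 'X) = 1 - 'X^d.
Proof.
elim: d => [|d ih].
  by rewrite expr0 subrr (_ : geom 0 = 0) ?mul0r //; apply/polyP => i; rewrite coef_poly coef0.
by rewrite geomS mulrDl ih exprS; ring.
Qed.

(** Multiplying by 1 - t ^ e turns [geom j] into [geom e] times 1 - t ^ j, and the
    last factor is invisible below degree j. *)
Lemma geom_coef_cut e j m k : (k < j)%N ->
  (geom j * geom e ^+ m)`_k -
    (if (e <= k)%N then (geom j * geom e ^+ m)`_(k - e) else 0) =
  (geom e ^+ m.+1)`_k.
Proof.
move=> lt; set H := geom j * _.
have x0 : (1 - 'X : {poly int}) != 0.
  by rewrite -opprB oppr_eq0 polyXsubC_eq0.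
have E : (1 - 'X^e) * H = geom e ^+ m.+1 * (1 - 'X^j).
  by rewrite -!geom_mul /H exprS; ring.
have /(congr1 (fun p : {poly int} => p`_k)) := E.
rewrite mulrBl mulrBr mul1r mulr1 !coefB coefXnM coefMXn lt subr0 => <-.
by rewrite ltnNge; case: leqP.
Qed.

Section Curve.
Variables (K : numFieldType) (n : nat).
Notation S := {mpoly K[n]}.
Implicit Types (I J : set S) (s c : seq S) (a b u v p f g l : S).

Definition sat J l : set S := [set a | exists M, J (l ^+ M * a)].

Lemma sat_ideal J l : ideal J -> ideal (sat J l).
Proof.
move=> hJ; split; rewrite /sat /=.
- by exists 0%N; rewrite mulr0; apply: ideal0.
- move=> a b [M hM] [N hN]; exists (M + N)%N; rewrite exprD mulrDr.
  apply: idealD => //; last by rewrite -mulrA; apply: idealM.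
  by rewrite -mulrA mulrCA; apply: idealM.
- by move=> c a [M hM]; exists M; rewrite mulrCA; apply: idealM.
Qed.

Lemma sub_sat J l : J `<=` sat J l.
Proof. by move=> a ha; exists 0%N; rewrite mul1r. Qed.

(** Since multiplication by l is onto modulo J in large degrees, the dimensions
    finally do not increase, so they stabilise and l becomes injective. *)
Lemma hilbert_stable J l : ideal J -> graded J -> l \is 1.-homog -> primary (adjoin J l) ->
  exists k1 tau, forall k, (k1 <= k)%N -> hilbert J k = tau /\
    (forall a, homogs k a -> sat J l a -> J a).
Proof.
move=> hJ gJ hl hm; have hA := adjoin_ideal hJ l; have hC := colon_ideal hJ l.
have [k0 hk0] := primary_deg hA hm.
have E k : (k0 <= k)%N -> hilbert J k.+1 = hilbert (colon J l) k.
  move=> le; rewrite -addn1 (hilbert_exact _ hJ gJ hl) (_ : hilbert (adjoin J l) _ = 0%N) //.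
  by apply/hilbert_eq0 => // a; apply: hk0; lia.
have le1 k : (k0 <= k)%N -> (hilbert J k.+1 <= hilbert J k)%N.
  by move=> le; rewrite E //; apply: hilbert_mono => // a _; apply: sub_colon.
pose P m := `[< exists2 k, (k0 <= k)%N & hilbert J k = m >].
have exP : exists m, P m by exists (hilbert J k0); apply/asboolP; exists k0.
case: (ex_minnP exP) => tau /asboolP[k1 lek1 e1] tmin.
have st k : (k1 <= k)%N -> hilbert J k = tau.
  elim: k => [|k ih]; first by rewrite leqn0 => /eqP e; rewrite -e1 e.
  rewrite leq_eqVlt ltnS => /orP[/eqP <- //|le].
  apply/eqP; rewrite eqn_leq -{1}(ih le) le1 ?(leq_trans lek1) //=.
  by apply: tmin; apply/asboolP; exists k.+1 => //; lia.
exists k1, tau => k le; split; first exact: st.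
have step m a : (k1 <= m)%N -> homogs m a -> J (l * a) -> J a.
  move=> lem ha; apply: (hilbert_eq_sub hJ hC (sub_colon hJ l) _ ha) => //.
  by rewrite -E ?st //; lia.
move=> a ha [M]; elim: M a k le ha => [|M ih] a k le ha; first by rewrite mul1r.
rewrite exprSr -mulrA => /(ih _ k.+1) h; apply: (step k) => //.
apply: h; first by lia.
by rewrite -add1n; apply: homogsM.
Qed.

(** Given linear forms xs and forms fs of degree e, one more in number, generic
    combinations of the fs replace the xs one by one. *)
Lemma generic_reduction e c xs fs : (0 < e)%N -> pos_homogs c ->
    {in xs, forall x, x \is 1.-homog} -> {in fs, forall f, f \is e.-homog} ->
    size fs = (size xs).+1 -> primary (gen_ideal (xs ++ c)) -> primary (gen_ideal (fs ++ c)) ->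
  exists gs g, [/\ size gs = size xs, {in g :: gs, forall f, f \is e.-homog},
    gen_ideal (g :: gs) = gen_ideal fs & primary (gen_ideal (gs ++ c))].
Proof.
move=> e0; elim: xs c fs => [|x xs ih] c [|f fs] //= hc hx hf' [sz] mx mf.
  case: fs hf' sz mf => // hf' _ mf; exists [::], f; split => //.
have h1 : pos_homogs (xs ++ c).
  move=> u; rewrite mem_cat => /orP[hu|/hc//]; exists 1%N => //.
  by apply: hx; rewrite inE hu orbT.
have hI := gen_ideal_ideal (xs ++ c); have gI := pos_homogs_graded h1.
have x1 : x \is 1.-homog by apply: hx; rewrite mem_head.
have [D hD] := hilbert_bounded hI gI x1 (ltn0Sn 0) mx.
have f1 : f \is e.-homog by apply: hf'; rewrite mem_head.
have fs1 : {in fs, forall f, f \is e.-homog}.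
  by move=> u hu; apply: hf'; rewrite inE hu orbT.
have [g' [g1 g2 g3]] := generic_comb hI hD f1 fs1.
have hA := adjoin_ideal hI g'.
have e1 : gen_ideal (f :: fs) = gen_ideal (g' :: fs).
  apply/seteqP; split; (apply: gen_ideal_sub; first exact: gen_ideal_ideal) => u.
    rewrite inE => /orP[/eqP->|hu]; last by apply: mem_gen_ideal; rewrite inE hu orbT.
    exists 1; rewrite mul1r -opprB; apply: idealN => //; exact: gen_ideal_ideal.
  rewrite inE => /orP[/eqP->|hu]; last by apply: mem_gen_ideal; rewrite inE hu orbT.
  by exists 1; rewrite mul1r.
have m1 : primary (adjoin (gen_ideal (xs ++ c)) g').
  apply: primary_rad mf => //; rewrite -[adjoin (gen_ideal (fs ++ c)) f]/(gen_ideal (f :: fs ++ c)).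
  apply: gen_ideal_sub; first exact: rad_ideal.
  move=> u; rewrite -cat_cons mem_cat => /orP[/g3 //|hu].
  by apply/sub_rad/sub_adjoin/mem_gen_ideal; rewrite mem_cat hu orbT.
have [||||||gs [g [s1 s2 s3 s4]]] := ih (g' :: c) fs.
- move=> u; rewrite inE => /orP[/eqP->|/hc //]; by exists e.
- by move=> u hu; apply: hx; rewrite inE hu orbT.
- by [].
- by [].
- rewrite (_ : gen_ideal _ = adjoin (gen_ideal (xs ++ c)) g') //.
  rewrite -[adjoin _ _]/(gen_ideal (g' :: xs ++ c)); apply: gen_ideal_eq => u.
  by rewrite !(mem_cat, inE) orbCA.
- apply: primary_mono mf.
  rewrite -[adjoin (gen_ideal (fs ++ c)) f]/(gen_ideal (f :: fs ++ c)).
  apply: gen_ideal_sub; first exact: gen_ideal_ideal.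
  move=> u; rewrite -cat_cons mem_cat => /orP[hu|hu]; last first.
    by apply: mem_gen_ideal; rewrite mem_cat inE hu !orbT.
  have : gen_ideal (f :: fs) u by apply: mem_gen_ideal.
  rewrite e1; apply: gen_ideal_mono => v.
  by rewrite !(mem_cat, inE) => /orP[->|->]; rewrite ?orbT.
exists (g' :: gs), g; split.
- by rewrite /= s1.
- move=> u; rewrite !inE => /or3P[/eqP-> |/eqP->//|hu].
    by apply: s2; rewrite mem_head.
  by apply: s2; rewrite inE hu orbT.
- rewrite -[RHS]/(gen_ideal (f :: fs)) e1 -[RHS]/(adjoin (gen_ideal fs) g') -s3.
  rewrite -[LHS]/(gen_ideal (g :: g' :: gs)) -[RHS]/(gen_ideal (g' :: g :: gs)).
  apply: gen_ideal_eq => u.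
  by rewrite !inE orbCA.
- apply: primary_mono s4; apply: gen_ideal_mono => u.
  by rewrite /= !(mem_cat, inE) orbCA.
Qed.

(** Start from l and all variables but one that occurs in l. *)
Lemma reduce_generators e l fs : (0 < e)%N -> l \is 1.-homog -> l != 0 ->
    size fs = n -> {in fs, forall f, f \is e.-homog} -> primary (adjoin (gen_ideal fs) l) ->
  exists gs g, [/\ size gs = n.-1, {in g :: gs, forall f, f \is e.-homog},
    gen_ideal (g :: gs) = gen_ideal fs & primary (gen_ideal (l :: gs))].
Proof.
move=> e0 hl l0 sz hfs hm.
have [i hi] : exists i, l@_(U_(i)) != 0.
  apply: contrapT => /forallNP h; move/eqP: l0; apply.
  rewrite (linear_formE hl) big1 // => i _.
  by move/negP/negPn: (h i) => /eqP ->; rewrite scale0r.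
pose xs : seq S := [seq 'X_j | j <- rem i (enum 'I_n)].
have sxs : size fs = (size xs).+1.
  rewrite sz size_map size_rem ?mem_enum // size_enum_ord prednK //.
  exact: leq_ltn_trans (ltn_ord i).
have hx j : j != i -> 'X_j \in xs.
  move=> ji; apply: map_f; rewrite mem_rem_uniq ?enum_uniq // inE ji.
  exact: mem_enum.
have hI := gen_ideal_ideal (xs ++ [:: l]).
have mxs : primary (gen_ideal (xs ++ [:: l])).
  have hj j : j != i -> gen_ideal (xs ++ [:: l]) 'X_j.
    by move=> /hx h; apply: mem_gen_ideal; rewrite mem_cat h.
  move=> j; exists 1%N; rewrite expr1.
  have [->|/hj //] := eqVneq j i.
  have -> : 'X_i = (l@_(U_(i)))^-1 *: (l - \sum_(j < n | j != i) l@_(U_(j)) *: 'X_j) :> S.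
    rewrite {2}(linear_formE hl) (bigD1 i) //= addrK scalerA mulVf // scale1r //.
  apply: idealZ => //; apply: idealB => //.
    by apply: mem_gen_ideal; rewrite mem_cat mem_head orbT.
  by apply: ideal_sum => // k /hj; apply: idealZ.
have [|||gs [g [s1 s2 s3 s4]]] := generic_reduction e0 _ _ hfs sxs mxs.
- by move=> u; rewrite inE => /eqP ->; exists 1%N.
- by move=> u /mapP[j _ ->]; apply: homogs_var.
- apply: primary_mono hm; rewrite -[adjoin _ _]/(gen_ideal (l :: fs)); apply: gen_ideal_mono => u.
  by rewrite !(mem_cat, inE) orbC.
exists gs, g; split => //; first by rewrite s1 -[in RHS]sz sxs.
by apply: primary_mono s4; apply: gen_ideal_mono => u; rewrite !(mem_cat, inE) orbC.
Qed.

Section Core.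
Variables (e : nat) (gs : seq S) (g l : S).
Hypotheses (n0 : (0 < n)%N) (e0 : (0 < e)%N) (hl : l \is 1.-homog).
Hypotheses (hgs : {in g :: gs, forall f, f \is e.-homog}) (sgs : size gs = n.-1).
Hypothesis hm : primary (gen_ideal (l :: gs)).

Let J := gen_ideal (g :: gs).
Let hJ : ideal J. Proof. exact: gen_ideal_ideal. Qed.
Let gJ : graded J.
Proof. by apply: pos_homogs_graded => u /hgs hu; exists e. Qed.
Let mJ : primary (adjoin J l).
Proof.
apply: primary_mono hm; rewrite -[adjoin J l]/(gen_ideal (l :: g :: gs)).
by apply: gen_ideal_mono => u; rewrite !inE => /orP[->|->]; rewrite ?orbT.
Qed.

Let t j : seq (S * nat) := (l ^+ j, j) :: [seq (f, e) | f <- gs].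

Let ht j : (0 < j)%N -> homog_gens (t j).
Proof.
move=> j0; rewrite /homog_gens /= j0.
have -> : l ^+ j \is j.-homog by have := dhomogMn j hl; rewrite mul1n.
apply/allP => x /mapP[f hf' ->] /=; rewrite e0 hgs // inE hf' orbT //.
Qed.

Let ut j : unzip1 (t j) = l ^+ j :: gs.
Proof. by rewrite /t /= /unzip1 -map_comp map_id. Qed.

Let hCI j : (0 < j)%N -> CI (t j).
Proof.
move=> j0; apply: primary_CI; rewrite ?ut; last 1 first.
- apply: primary_rad hm; first exact: gen_ideal_ideal.
  apply: gen_ideal_sub; first by apply: rad_ideal; apply: gen_ideal_ideal.
  move=> u; rewrite inE => /orP[/eqP->|hu].
    by exists j; apply: mem_gen_ideal; rewrite mem_head.
  by apply: sub_rad; apply: mem_gen_ideal; rewrite inE hu orbT.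
- by rewrite /= size_map sgs prednK.
- exact: ht.
Qed.

Let hilbt j : ci_series (t j) = geom j * geom e ^+ n.-1.
Proof.
rewrite /ci_series big_cons; congr (_ * _).
by rewrite big_map /= big_const_seq count_predT sgs iter_mulr_1.
Qed.

Let rhot j : ci_socle (t j) = (j.-1 + n.-1 * e.-1)%N.
Proof.
by rewrite /ci_socle big_cons big_map /= big_const_seq count_predT sgs iter_addn_0 mulnC.
Qed.

Let N0 := (n * e.-1)%N.

(** Duality is applied to the Gorenstein quotient by gs and l ^ j. For large j the
    colon ideal of l ^ j in J agrees with [sat J l] in the relevant degree, and
    the ideal generated by gs and l ^ j cannot be told from that of gs. *)
Lemma hilbert_symmetry : exists k1 tau, [/\ forall k, (k1 <= k)%N -> hilbert J k = tau,
  forall k, (N0 <= k)%N -> hilbert (sat J l) k = tau &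
  forall k, (hilbert J k)%:Z = (geom e ^+ n)`_k + tau%:Z -
    (if (k <= N0)%N then (hilbert (sat J l) (N0 - k))%:Z else 0)].
Proof.
have [k1 [tau hst]] := hilbert_stable hJ gJ hl mJ.
have colon_sat j i : (k1 <= i + j)%N -> hilbert (colon J (l ^+ j)) i = hilbert (sat J l) i.
  move=> le; apply: hilbert_eq; [exact: colon_ideal | exact: sat_ideal |].
  move=> a ha; split=> [h|[M hM]]; first by exists j.
  have hja : homogs (j + i) (l ^+ j * a).
    by apply: homogsM => //; have := dhomogMn j hl; rewrite mul1n.
  have [_ h] := hst (j + i)%N ltac:(lia).
  by apply: (h _ hja); exists M; rewrite mulrCA; apply: idealM.
have er j : (0 < j)%N -> (j + N0 = ci_socle (t j) + e)%N.
  move=> j0; have eN : N0 = (n.-1 * e.-1 + e.-1)%N.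
    by rewrite /N0 -[in LHS](prednK n0) mulSn addnC.
  rewrite rhot eN; move: (n.-1 * e.-1)%N => w; lia.
have top j i : (0 < j)%N -> (ci_socle (t j) < i)%N -> hilbert (adjoin J (l ^+ j)) i = 0%N.
  move=> j0 le; have hH := ht j0; have [_ hH2 _] := hCI j0.
  have hI := gen_ideal_ideal (unzip1 (t j)).
  apply/eqP; rewrite -leqn0; apply: (@leq_trans (hilbert (gen_ideal (unzip1 (t j))) i)).
    apply: hilbert_mono => //; first exact: adjoin_ideal.
    move=> a _; rewrite ut -[adjoin J _]/(gen_ideal (l ^+ j :: g :: gs)).
    by apply: gen_ideal_mono => u; rewrite !inE => /orP[->|->]; rewrite ?orbT.
  rewrite leqn0 -eqz_nat hH2 nth_default //.
  by have [_ ->] := ci_series_monic hH.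
exists k1, tau; split => [k /hst[]//|k le|k].
  pose j := (k1 + 1)%N; have j0 : (0 < j)%N by rewrite /j addn1.
  have hlj : l ^+ j \is j.-homog by have := dhomogMn j hl; rewrite mul1n.
  have := hilbert_exact k hJ gJ hlj; rewrite colon_sat; last by rewrite /j; lia.
  rewrite top //; last by have := er _ j0; lia.
  by have [-> _] := hst (k + j)%N ltac:(rewrite /j; lia).
pose j := (k + N0 + k1 + 1 + e)%N.
have j0 : (0 < j)%N by rewrite /j; lia.
have ltkj : (k < j)%N by rewrite /j; lia.
pose I := gen_ideal (l ^+ j :: gs).
have hI : ideal I by apply: gen_ideal_ideal.
have hT := hCI j0; have hH := ht j0.
have [_ hH2 _] := hT; rewrite ut hilbt -/I in hH2.
have gI : graded I by rewrite /I -ut; apply/pos_homogs_graded/homog_gens_pos.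
have hg : g \is e.-homog by apply: hgs; rewrite mem_head.
have hlj : l ^+ j \is j.-homog by have := dhomogMn j hl; rewrite mul1n.
have eA : adjoin I g = adjoin J (l ^+ j).
  rewrite -[LHS]/(gen_ideal (g :: l ^+ j :: gs)) -[RHS]/(gen_ideal (l ^+ j :: g :: gs)).
  by apply: gen_ideal_eq => u; rewrite !inE orbCA.
have en : geom e ^+ n = geom e ^+ n.-1.+1 by rewrite prednK.
have hAj i : (i < j)%N -> hilbert (adjoin I g) i = hilbert J i.
  by move=> lt; rewrite eA -(hilbert_exact_lt hJ gJ hlj lt).
have step : (hilbert J k)%:Z = (geom e ^+ n)`_k + (hilbert (adjoin I g) (j + N0 - k))%:Z.
  have ej := er _ j0; rewrite en -(@geom_coef_cut e j n.-1 k ltkj) -!hH2 -hAj //.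
  case: leqP => [le|lt]; last first.
    by rewrite subr0 -(hilbert_exact_lt hI gI hg lt) eA top ?addr0 //; lia.
  have lek : (k - e <= ci_socle (t j))%N by rewrite rhot /j; lia.
  have := gorenstein_duality hH hT hg lek; rewrite ut -/I.
  have -> : (ci_socle (t j) - (k - e) = j + N0 - k)%N by lia.
  have := hilbert_exact (k - e) hI gI hg; rewrite subnK //; lia.
rewrite step -addrA; congr (_ + _).
case: leqP => [le|lt]; last first.
  rewrite subr0 hAj; last by rewrite /j; lia.
  by have [->] := hst (j + N0 - k)%N ltac:(rewrite /j; lia).
have e2 : (j + N0 - k = (N0 - k) + j)%N by lia.
have := hilbert_exact (N0 - k) hJ gJ hlj; rewrite -e2 eA.
have [-> _] := hst (j + N0 - k)%N ltac:(rewrite /j; lia).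
rewrite colon_sat; last by rewrite /j; lia.
lia.
Qed.

End Core.
End Curve.

(** * Zeros of homogeneous ideals *)

Section Zeros.
Variables (K : numClosedFieldType) (n : nat).
Notation S := {mpoly K[n]}.
Implicit Types (I J : set S) (a b p q l : S) (v w : 'I_n -> K).

Definition zero_of I v : Prop := forall p, I p -> p.@[v] = 0.

Lemma meval_homog k p (c : K) v w : homogs k p -> (forall i, w i = c * v i) ->
  p.@[w] = c ^+ k * p.@[v].
Proof.
move=> hp hw; rewrite !mevalE mulr_sumr; apply: eq_big_seq => m hm.
have -> : k = (\sum_i m i)%N by rewrite -mdegE -(dhomog_mf hp hm).
rewrite mulrCA; congr (_ * _); rewrite -prodrXr -big_split.
by apply: eq_bigr => i _; rewrite hw exprMn.
Qed.

(** If q is not nilpotent modulo I and I contains a product of factors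
    'X_i - r, then q stays non-nilpotent after adding one of the factors. *)
Lemma adjoin_root I q i (rs : seq K) : ideal I -> ~ rad I q ->
    I (\prod_(r <- rs) ('X_i - r%:MP)) ->
  exists r : K, ~ rad (adjoin I ('X_i - r%:MP)) q.
Proof.
elim: rs I => [|r rs ih] I hI hq.
  by rewrite big_nil => h1; case: hq; exists 0%N.
rewrite big_cons => hp.
have [[M hM]|h] := pselect (rad (adjoin I ('X_i - r%:MP)) q); last by exists r.
pose P := \prod_(r <- rs) ('X_i - r%:MP : S).
have hA := adjoin_ideal hI P.
have [|||r' hr'] := ih (adjoin I P) => //.
- move=> [N [c hc]]; apply: hq; case: hM => c' hc'; exists (M + N)%N.
  rewrite exprD -(subrK (c' * ('X_i - r%:MP)) (q ^+ M)) mulrDl.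
  apply: idealD => //; first exact: idealMr.
  rewrite -(subrK (c * P) (q ^+ N)) mulrDr; apply: idealD => //.
    exact: idealM.
  have -> : c' * ('X_i - r%:MP) * (c * P) = c' * c * (('X_i - r%:MP) * P) by ring.
  exact: idealM.
- exact: adjoin_gen.
exists r' => h; apply: hr'; apply: rad_mono h => a [c hc]; exists c.
exact: sub_adjoin.
Qed.

(** Modulo I every polynomial is congruent to its value at v. *)
Lemma point_congr I v p : ideal I -> (forall i, I ('X_i - (v i)%:MP)) ->
  I (p - (p.@[v])%:MP).
Proof.
move=> hI hv.
have hM a b : I (a - (a.@[v])%:MP) -> I (b - (b.@[v])%:MP) ->
    I (a * b - ((a * b).@[v])%:MP).
  move=> ha hb; rewrite mevalM mpolyCM.
  have -> : a * b - (a.@[v])%:MP * (b.@[v])%:MP =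
    (a - (a.@[v])%:MP) * b + (a.@[v])%:MP * (b - (b.@[v])%:MP) by ring.
  by apply: idealD => //; [apply: idealMr | apply: idealM].
have h1 : I (1 - (1.@[v])%:MP) by rewrite meval1 mpolyC1 subrr; apply: ideal0.
elim/mpolyind: p => [|c m p _ _ ih]; first by rewrite meval0 mpolyC0 subrr; apply: ideal0.
rewrite mevalD mpolyCD opprD addrACA; apply: idealD => //.
rewrite mevalZ mpolyCM mul_mpolyC -scalerBr; apply: idealZ => //.
rewrite mpolyXE_id; apply: (big_ind (fun a => I (a - (a.@[v])%:MP))) => // i _.
elim: (m i) => [|k ihk]; first by rewrite expr0.
by rewrite exprS; apply: hM => //; rewrite mevalXU; apply: hv.
Qed.

(** For ideals of finite codimension: adding linear factors 'X_i - r for all i while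
    q stays non-nilpotent leads to the ideal of a zero of I where q does not
    vanish. *)
Theorem nullstellensatz I q : ideal I ->
    (forall i : 'I_n, exists rs : seq K, I (\prod_(r <- rs) ('X_i - r%:MP))) ->
    (forall v, zero_of I v -> q.@[v] = 0) -> rad I q.
Proof.
move=> hI hfin hq; apply: contrapT => nq.
have [I' [hI' sI' nI' hv]] : exists I', [/\ ideal I', I `<=` I', ~ rad I' q &
    forall i, i \in enum 'I_n -> exists c : K, I' ('X_i - c%:MP)].
  elim: (enum 'I_n) => [|i r [I' [h1 h2 h3 h4]]]; first by exists I; split.
  have [rs /h2 hrs] := hfin i.
  have [c hc] := adjoin_root h1 h3 hrs.
  exists (adjoin I' ('X_i - c%:MP)); split => //; first exact: adjoin_ideal.
    by move=> a /h2; apply: sub_adjoin.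
  move=> j; rewrite inE => /orP[/eqP-> |/h4 [d hd]].
    by exists c; apply: adjoin_gen.
  by exists d; apply: sub_adjoin.
have [v hv'] := boolp.choice (fun i => hv i (mem_enum _ i)).
have hc p : I' p -> p.@[v] = 0.
  move=> hp; apply: contrapT => /eqP pv; apply: nI'; exists 0%N.
  have -> : q ^+ 0 = (p.@[v]^-1)%:MP * (p.@[v])%:MP.
    by rewrite -mpolyCM mulVf // mpolyC1.
  apply: idealM => //; apply: (ideal_transl hI' (point_congr p hI' hv') hp).
apply: nI'; exists 1%N; rewrite expr1.
have := point_congr q hI' hv'; rewrite hq ?mpolyC0 ?subr0 //.
by move=> p /sI'; apply: hc.
Qed.

(** If a - c (l - 1) lies in J, comparing components shows that modulo J those of c
    vanish below degree k and are - l ^ (m - k) a in degree m >= k; as c has only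
    finitely many components, some l ^ N a lies in J. *)
Lemma dehomogenize J l k a : ideal J -> graded J -> l \is 1.-homog -> homogs k a ->
  adjoin J (l - 1) a -> sat J l a.
Proof.
move=> hJ gJ hl ha [c hc].
have E m : J (pihomog mdeg m c + (if (m < k)%N then 0 else l ^+ (m - k) * a)).
  have H m' := gJ m' _ hc.
  elim: m => [|m ih].
    have := H 0%N; rewrite mulrBr mulr1 !raddfB /= (pihomogM _ _ hl) /= oppr0 add0r opprK.
    rewrite (pihomog_homog _ ha) addrC.
    by case: (posnP k) => [->|k0]; rewrite ?subnn ?mul1r // eq_sym gtn_eqF.
  have := H m.+1; rewrite mulrBr mulr1 !raddfB /= (pihomogM _ _ hl) /= subn1 /=.
  rewrite (pihomog_homog _ ha) => h.
  have := idealD hJ h (idealM hJ l ih).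
  congr J; case: (ltngtP m.+1 k) => h'.
  - ring.
  - rewrite subSn // exprS; ring.
  - by rewrite -h' subnn expr0; ring.
have [N hN] : exists N, pihomog mdeg (k + N) c = 0.
  exists (mmeasure mdeg c); rewrite /pihomog big1_seq // => m /andP[/eqP e hm].
  by have := mmeasure_mnm_lt mdeg hm; rewrite e; lia.
by exists N; have := E (k + N)%N; rewrite hN add0r ltnNge leq_addr addKn.
Qed.

(** Modulo J + (l - 1) the quotient is finite-dimensional, so each variable is
    annihilated by a polynomial, which splits. *)
Lemma homog_nullstellensatz J l d q : ideal J -> graded J -> l \is 1.-homog ->
    primary (adjoin J l) -> homogs d q -> (forall v, zero_of J v -> q.@[v] = 0) ->
  exists M, sat J l (q ^+ M).
Proof.
move=> hJ gJ hl hm hq hz; have [D hD] := hilbert_bounded hJ gJ hl (ltn0Sn 0) hm.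
have hA := adjoin_ideal hJ (l - 1).
have [|v hv|M hM] := nullstellensatz (q := q) hA.
- move=> i; pose x j := 'X_i ^+ j * l ^+ (D - j) : S.
  have hx (j : 'I_D.+1) : homogs D (x j).
    suff : homogs (j + (D - j)) (x j) by rewrite subnKC // -ltnS.
    apply: homogsM; first by have := dhomogMn j (homogs_var K i); rewrite mul1n.
    by have := dhomogMn (D - j) hl; rewrite mul1n.
  have [c [[j0 cj] hc]] := spanq_dep (ideal_subspace hJ)
    (dimq_span (hilbertP D hJ)) (hD _ : (_ < D.+1)%N) hx.
  pose P := \poly_(j < D.+1) (if insub j is Some k then c k else 0).
  have cE (j : 'I_D.+1) : P`_j = c j by rewrite coef_poly ltn_ord valK.
  have P0 : P != 0 by apply: contra_neq cj => P0; rewrite -cE P0 coef0.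
  have [rs hrs] := closed_field_poly_normal P.
  have lc : lead_coef P != 0 by rewrite lead_coef_eq0.
  exists rs.
  pose ev (p : {poly K}) : S := (map_poly (@mpolyC n K) p).['X_i].
  have -> : \prod_(r <- rs) ('X_i - r%:MP) = ev (\prod_(r <- rs) ('X - r%:P)).
    rewrite /ev rmorph_prod horner_prod; apply: eq_bigr => r _ /=.
    by rewrite rmorphB /= map_polyX map_polyC hornerXsubC.
  suff : adjoin J (l - 1) (ev P).
    rewrite hrs /ev map_polyZ hornerZ => h.
    have := idealM hA ((lead_coef P)^-1)%:MP h.
    by rewrite mulrA -mpolyCM mulVf // mpolyC1 mul1r.
  apply: (ideal_transl hA _ (sub_adjoin _ hc)).
  have -> : ev P = \sum_j c j *: ('X_i ^+ j).
    rewrite /ev (horner_coef_wide (n := D.+1)); last first.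
      exact: leq_trans (size_poly _ _) (size_poly _ _).
    by apply: eq_bigr => j _; rewrite coef_map /= cE mul_mpolyC.
  rewrite -sumrB; apply: ideal_sum => // j _; rewrite -scalerBr; apply: idealZ => //.
  have -> : x j - 'X_i ^+ j = 'X_i ^+ j * (l ^+ (D - j) - 1) by rewrite /x; ring.
  apply: idealM => //; have := subrXX (l : S) 1 (D - j); rewrite expr1n => ->.
  by apply: idealMr => //; apply: adjoin_gen.
- by apply: hz => p hp; apply: hv; apply: sub_adjoin.
exists M; apply: (dehomogenize (k := (d * M)%N)) hM => //.
exact: dhomogMn.
Qed.

End Zeros.

(** * Local multiplicities *)

Lemma stable_nondecreasing (u : nat -> nat) D :
  (forall k, (u k <= u k.+1)%N) -> (forall k, (u k <= D)%N) ->
  exists k0 t, forall k, (k0 <= k)%N -> u k = t.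
Proof.
move=> hu hD; pose P m := `[< exists k, u k = m >].
have exP : exists m, P m by exists (u 0%N); apply/asboolP; exists 0%N.
have bP m : P m -> (m <= D)%N by move/asboolP=> [k <-].
case: (ex_maxnP exP bP) => t /asboolP[k0 e0] tmax.
exists k0, t => k le; apply/eqP; rewrite eqn_leq; apply/andP; split.
  by apply: tmax; apply/asboolP; exists k.
rewrite -(subnK le); elim: (k - k0)%N => [|i ih]; first by rewrite e0.
exact: leq_trans ih (hu _).
Qed.

Section Local.
Variables (K : numClosedFieldType) (n : nat).
Notation S := {mpoly K[n]}.
Implicit Types (I J : set S) (a b p q l : S) (v w z : 'I_n -> K).

(** The contraction to S of the localisation of J at the point of projective
    space with homogeneous coordinates v. *)
Definition loc J v : set S :=
  [set a | exists k b, [/\ homogs k b, b.@[v] != 0 & J (b * a)]].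

Section Loc.
Variable J : set S.
Hypotheses (hJ : ideal J) (gJ : graded J).

Lemma loc_ideal v : ideal (loc J v).
Proof.
split.
- exists 0%N, 1; split; [exact: dhomog1 | by rewrite meval1 oner_neq0 |].
  by rewrite mulr0; apply: ideal0.
- move=> a a' [k [b [h1 h2 h3]]] [k' [b' [h1' h2' h3']]].
  exists (k + k')%N, (b * b'); split; first exact: homogsM.
    by rewrite mevalM mulf_neq0.
  have -> : b * b' * (a + a') = b' * (b * a) + b * (b' * a') by ring.
  by apply: idealD => //; apply: idealM.
- move=> c a [k [b [h1 h2 h3]]]; exists k, b; split => //.
  by rewrite mulrCA; apply: idealM.
Qed.

Lemma loc_graded v : graded (loc J v).
Proof.
move=> m a [k [b [h1 h2 h3]]]; exists k, b; split => //.
exact: (colon_graded gJ h1) _ _ h3.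
Qed.

Lemma sub_loc v : J `<=` loc J v.
Proof.
move=> a ha; exists 0%N, 1; split; [exact: dhomog1 | by rewrite meval1 oner_neq0 |].
by rewrite mul1r.
Qed.

Lemma loc_nonzerodiv v k b : homogs k b -> b.@[v] != 0 -> nonzerodiv (loc J v) b.
Proof.
move=> hb bv a [m [c [h1 h2 h3]]]; exists (m + k)%N, (c * b); split.
- exact: homogsM.
- by rewrite mevalM mulf_neq0.
- by rewrite -mulrA.
Qed.

Lemma hilbert_colon_nonzerodiv I b k : ideal I -> nonzerodiv I b ->
  hilbert (colon I b) k = hilbert I k.
Proof.
move=> hI nb; apply: hilbert_eq => //; first exact: colon_ideal.
by move=> a _; split; [apply: nb | apply: sub_colon].
Qed.

(** The multiplication by b is injective modulo [loc J v], hence onto between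
    degrees where the dimensions agree. *)
Lemma loc_onto v d b k t : homogs d b -> b.@[v] != 0 ->
  hilbert (loc J v) k = t -> hilbert (loc J v) (k + d) = t ->
  forall a, homogs (k + d) a -> exists2 s, homogs k s & loc J v (a - b * s).
Proof.
move=> hb bv e1 e2 a ha; have hL := loc_ideal v.
have := hilbert_exact k hL (@loc_graded v) hb.
rewrite (hilbert_colon_nonzerodiv _ hL (loc_nonzerodiv hb bv)) e1 e2 => e.
have /(hilbert_eq0 _ (adjoin_ideal hL b))/(_ _ ha)[s hs] : hilbert (adjoin (loc J v) b) (k + d) = 0%N.
  lia.
exists (pihomog mdeg k s); first exact: pihomogP.
have := @loc_graded v (k + d)%N _ hs; rewrite raddfB /= (pihomogM _ _ hb) leq_addl addnK.
by rewrite (pihomog_dE ha) mulrC.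
Qed.

Variable l : S.
Hypotheses (hl : l \is 1.-homog) (hm : primary (adjoin J l)).

Lemma loc_stable v : l.@[v] != 0 ->
  exists k0 t, forall k, (k0 <= k)%N -> hilbert (loc J v) k = t.
Proof.
move=> lv; have hL := loc_ideal v.
have [D hD] := hilbert_bounded hJ gJ hl (ltn0Sn 0) hm.
apply: (@stable_nondecreasing _ D) => k.
  rewrite -addn1 (hilbert_exact _ hL (@loc_graded v) hl) (hilbert_colon_nonzerodiv _ hL) ?leq_addl //.
  exact: loc_nonzerodiv hl lv.
by apply: leq_trans (hD k); apply: hilbert_mono => // a _; apply: sub_loc.
Qed.

Definition prop_to v w := exists c : K, forall i, v i = c * w i.

Lemma separating_form v w : (exists i, w i != 0) -> ~ prop_to v w ->
  exists m, [/\ m \is 1.-homog, m.@[w] = 0 & m.@[v] != 0].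
Proof.
move=> [i wi] h; apply: contrapT => h'; apply: h; exists (v i / w i) => j.
apply: contrapT => hj; apply: h'.
exists (w i *: 'X_j - w j *: 'X_i); split.
- by apply: rpredB; apply: rpredZ; apply: homogs_var.
- by rewrite mevalB !mevalZ !mevalXU mulrC subrr.
rewrite mevalB !mevalZ !mevalXU subr_eq0; apply/eqP => e; apply: hj.
by apply: (mulfI wi); rewrite e; field.
Qed.

(** Representatives of the points of the projective zero set of J. *)
Variable zs : seq ('I_n -> K).
Hypothesis zsl : forall z, List.In z zs -> l.@[z] != 0.
Hypothesis zsC : forall v, zero_of J v -> (exists i, v i != 0) ->
  exists2 z, List.In z zs & prop_to v z.

Let z_neq0 z : List.In z zs -> exists i, z i != 0.
Proof.
move=> /zsl lz; apply: contrapT => /forallNP h; move/eqP: lz; apply.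
rewrite (meval_homog (c := 0) (v := z) hl) ?expr1 ?mul0r // => i.
by rewrite mul0r; apply: contrapT => /eqP/(h i).
Qed.

Let homog_zero k p v z : homogs k p -> (0 < k)%N -> prop_to v z -> p.@[z] = 0 -> p.@[v] = 0.
Proof.
by move=> hp k0 [c hc] pz; rewrite (meval_homog hp hc) pz mulr0.
Qed.

(** A linear form vanishing at w has a power in the localisation of J at w: times
    forms that vanish at the other points, it vanishes on all zeros of J. *)
Lemma loc_power w m : (forall z, List.In z zs -> z <> w -> ~ prop_to w z) ->
  List.In w zs -> m \is 1.-homog -> m.@[w] = 0 -> exists N, loc J w (m ^+ N).
Proof.
move=> hw wzs hm1 mw.
have [r [d [hr rw rz]]] : exists r d, [/\ homogs d r, r.@[w] != 0 &
    forall z, List.In z zs -> z <> w -> r.@[z] = 0].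
  elim: (zs) hw (z_neq0) => [_ _|z s ih hw' hz].
    by exists 1, 0%N; split; [exact: dhomog1 | rewrite meval1 oner_neq0 | ].
  have [||r [d [h1 h2 h3]]] := ih.
  - by move=> y hy; apply: hw'; right.
  - by move=> y hy; apply: hz; right.
  have [e|ne] := pselect (z = w).
    by exists r, d; split => // y [<- //|]; apply: h3.
  have [u [u1 u2 u3]] := separating_form (hz z (or_introl erefl))
    (hw' z (or_introl erefl) ne).
  exists (u * r), (1 + d)%N; split; first exact: homogsM.
    by rewrite mevalM mulf_neq0.
  by move=> y [<- _|hy ny]; rewrite mevalM ?u2 ?mul0r // h3 ?mulr0.
have hmr : homogs (1 + d) (m * r) by apply: homogsM.
have [v hv|M [N hN]] := homog_nullstellensatz hJ gJ hl hm hmr.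
  have [v0|/forallNP h0] := pselect (exists i, v i != 0); last first.
    rewrite (meval_homog (c := 0) (v := v) hmr) ?expr1 ?exprS ?mul0r // => i.
    by rewrite mul0r; apply: contrapT => /eqP/(h0 i).
  have [z zin hz] := zsC hv v0.
  apply: (homog_zero hmr) hz _ => //; rewrite mevalM.
  by have [->|ne] := pselect (z = w); rewrite ?mw ?mul0r // rz ?mulr0.
exists M, (N + d * M)%N, (l ^+ N * r ^+ M); split.
- apply: homogsM; last exact: dhomogMn.
  by have := dhomogMn N hl; rewrite mul1n.
- by rewrite mevalM !rmorphXn /= mulf_neq0 // expf_neq0 // zsl.
- by rewrite -mulrA -exprMn [r * m]mulrC.
Qed.

(** The elements b with b a in J form an ideal without projective zeros as soon as
    a lies in all localisations. *)
Lemma loc_sat k a : homogs k a ->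
  (forall z, List.In z zs -> loc J z a) <-> sat J l a.
Proof.
move=> ha; split; last first.
  move=> [M hM] z zin; exists M, (l ^+ M); split => //.
    by have := dhomogMn M hl; rewrite mul1n.
  by rewrite rmorphXn /= expf_neq0 // zsl.
move=> h; pose I := colon J a.
have hI : ideal I by apply: colon_ideal.
have gI : graded I by apply: colon_graded ha.
have sJI : J `<=` I by apply: sub_colon.
have mI : primary (adjoin I l).
  by apply: primary_mono hm => x [c hc]; exists c; apply: sJI.
have [v hv|M [N hN]] := homog_nullstellensatz hI gI hl mI hl; last first.
  by exists (N + M)%N; move: hN; rewrite /I /colon /= mulrC exprD.
have [v0|/forallNP h0] := pselect (exists i, v i != 0); last first.
  rewrite (meval_homog (c := 0) (v := v) hl) ?expr1 ?mul0r // => i.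
  by rewrite mul0r; apply: contrapT => /eqP/(h0 i).
have hvJ : zero_of J v by move=> p /sJI/hv.
have [z zin [c hc]] := zsC hvJ v0.
have [d [b [hb bz hba]]] := h z zin.
have /hv : I b by rewrite /I /colon /= mulrC.
rewrite (meval_homog hb hc) => /eqP; rewrite mulf_eq0 (negbTE bz) orbF expf_eq0.
move=> /andP[_ /eqP c0]; case: v0 => i; by rewrite hc c0 mul0r eqxx.
Qed.

Let bigI (s : seq ('I_n -> K)) : set S := [set a | forall z, List.In z s -> loc J z a].

Let bigI_ideal s : ideal (bigI s).
Proof.
split; rewrite /bigI /=.
- by move=> z _; apply: ideal0; apply: loc_ideal.
- by move=> a b ha hb z hz; apply: idealD; [exact: loc_ideal | exact: ha | exact: hb].
- by move=> c a ha z hz; apply: idealM; [exact: loc_ideal | exact: ha].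
Qed.

(** A form q in the localisations at the points of s that does not vanish at v
    makes the localisation at v independent of those in s. *)
Lemma chinese (s : seq ('I_n -> K)) (t : ('I_n -> K) -> nat) :
    (forall z w, List.In z zs -> List.In w zs -> z <> w -> ~ prop_to w z) ->
    (forall z, List.In z zs -> exists k0, forall k, (k0 <= k)%N -> hilbert (loc J z) k = t z) ->
    (forall z, List.In z s -> List.In z zs) -> List.NoDup s ->
  exists k2, forall k, (k2 <= k)%N -> hilbert (bigI s) k = (\sum_(z <- s) t z)%N.
Proof.
move=> hsep ht; elim: s => [|v s ih] hs.
  move=> _; exists 0%N => k _; rewrite big_nil; apply/hilbert_eq0 => //.
  by move=> a _ z [].
move=> /List.NoDup_cons_iff [vs ds]; have [|k2 hk2] := ih _ ds.
  by move=> z hz; apply: hs; right.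
have vz : List.In v zs by apply: hs; left.
have [k0 hk0] := ht v vz.
have [q [d [hq qv qs]]] : exists q d, [/\ homogs d q, q.@[v] != 0 & bigI s q].
  have hs' z : List.In z s -> List.In z zs by move=> hz; apply: hs; right.
  elim: (s) vs hs' => [_ _|w r ih' vr hr].
    by exists 1, 0%N; split; [exact: dhomog1 | rewrite meval1 oner_neq0 | move=> z []].
  have [||q [d [h1 h2 h3]]] := ih'.
  - by move=> h; apply: vr; right.
  - by move=> z hz; apply: hr; right.
  have wz : List.In w zs by apply: hr; left.
  have nvw : w <> v by move=> e; apply: vr; left.
  have [m [m1 m2 m3]] := separating_form (z_neq0 wz) (hsep _ _ wz vz nvw).
  have [N hN] := loc_power (fun z hz ne => hsep _ _ hz wz ne) wz m1 m2.
  exists (m ^+ N * q), (N + d)%N; split.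
  - by apply: homogsM => //; have := dhomogMn N m1; rewrite mul1n.
  - by rewrite mevalM rmorphXn /= mulf_neq0 // expf_neq0.
  - move=> z [<-|hz]; first by apply: idealMr => //; apply: loc_ideal.
    by apply: idealM; [exact: loc_ideal | exact: h3].
exists (k0 + k2 + d)%N => k le; rewrite big_cons.
have hW := bigI_ideal s; have hV := bigI_ideal (v :: s); have hL := loc_ideal v.
have sS i := @homogs_subspace K n i.
rewrite addnC -(hk2 k) ?(leq_trans _ le) //; last by lia.
apply: hilbert_dimq => //.
apply: (dimq_add (W0 := bigI s)) => //; try exact: ideal_subspace.
- by move=> a ha z hz; apply: ha; right.
- exact: hilbertP.
have ek : k = (k - d + d)%N by lia.
apply: (dimq_transport (phi := fun a => q * a) _ (sS (k - d)%N)
  (ideal_subspace hV) (W := loc J v)).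
- by move=> x a b; rewrite mulrDr scalerAr.
- move=> a ha; split; first by rewrite [X in homogs X]ek addnC; apply: homogsM.
  by move=> z hz; apply: idealMr; [exact: loc_ideal | exact: qs].
- move=> a ha; split=> [h|h z [<-|hz]].
  + by apply: (loc_nonzerodiv hq qv); apply: h; left.
  + by apply: idealM.
  + by apply: idealMr; [exact: loc_ideal | exact: qs].
- move=> a [ha has]; rewrite ek in ha.
  have [||x hx hax] := loc_onto (k := (k - d)%N) (t := t v) hq qv _ _ ha.
  + by apply: hk0; lia.
  + by apply: hk0; lia.
  exists x => // z [<- //|hz]; apply: idealB; [exact: loc_ideal | exact: has |].
  by apply: idealMr; [exact: loc_ideal | exact: qs].
- by rewrite -(hk0 (k - d)%N); [exact: hilbertP | lia].
Qed.

Theorem sum_of_multiplicities (t : ('I_n -> K) -> nat) :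
    List.NoDup zs ->
    (forall z w, List.In z zs -> List.In w zs -> z <> w -> ~ prop_to w z) ->
    (forall z, List.In z zs -> exists k0, forall k, (k0 <= k)%N -> hilbert (loc J z) k = t z) ->
  exists k2, forall k, (k2 <= k)%N -> hilbert J k = (\sum_(z <- zs) t z)%N.
Proof.
move=> dup hsep ht.
have [k2 hk2] := chinese hsep ht (fun z hz => hz) dup.
have [k1 [tau hk1]] := hilbert_stable hJ gJ hl hm.
exists (k1 + k2)%N => k le; rewrite -(hk2 k); last by lia.
apply: hilbert_eq => //.
move=> a ha; split => [h z _|h]; first exact: sub_loc.
have [_ hst] := hk1 k ltac:(lia).
by apply: (hst _ ha); apply/(loc_sat ha).
Qed.

End Loc.
End Local.

(** * Tjurina numbers of the hypersurface *)

Lemma euler_homog (K : fieldType) n d (f : {mpoly K[n]}) : f \is d.-homog ->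
  \sum_(i < n) 'X_i * f^`M(i) = d%:R *: f.
Proof.
move=> hf'; have e : f = \sum_(m <- msupp f) f@_m *: 'X_[m] by exact: mpolyE.
have H i : 'X_i * f^`M(i) = \sum_(m <- msupp f) (m i)%:R *: (f@_m *: 'X_[m]).
  rewrite {1}e raddf_sum /= mulr_sumr; apply: eq_bigr => m _.
  rewrite mderivZ mderivX -!scalerAr scalerA mulrC -scalerA.
  have [->|mi] := posnP (m i); first by rewrite !scale0r.
  congr (_ *: (_ *: _)); rewrite -mpolyXD addmC submK //.
  by rewrite lep1mP -lt0n.
under eq_bigr do rewrite H.
rewrite exchange_big /= [in RHS]e scaler_sumr; apply: eq_big_seq => m hm.
rewrite -scaler_suml -natr_sum; congr (_%:R *: _).
by rewrite -mdegE -(dhomog_mf hf' hm).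
Qed.

Section Fractions.
Variables (K : fieldType) (m : nat).
Notation R := {mpoly K[m]}.
Implicit Types (a b c : R) (p : 'rV[K]_m) (x y q : ratfun K m).

(** [tofrac] with values in [ratfun], so that the operations below are those of
    the field and vector space structures of this type. *)
Definition frac_of (a : R) : ratfun K m := tofrac a.

Lemma frac_ofD a b : frac_of (a + b) = frac_of a + frac_of b. Proof. exact: tofracD. Qed.
Lemma frac_ofB a b : frac_of (a - b) = frac_of a - frac_of b. Proof. exact: tofracB. Qed.
Lemma frac_ofM a b : frac_of (a * b) = frac_of a * frac_of b. Proof. exact: tofracM. Qed.
Lemma frac_of0 : frac_of 0 = 0. Proof. exact: tofrac0. Qed.
Lemma frac_of1 : frac_of 1 = 1. Proof. exact: tofrac1. Qed.
Lemma frac_of_inj : injective frac_of.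
Proof. by move=> a b /eqP; rewrite tofrac_eq => /eqP. Qed.
Lemma frac_of_neq0 a : a != 0 -> frac_of a != 0.
Proof. by apply: contra_neq => e; apply: frac_of_inj; rewrite e frac_of0. Qed.
Lemma frac_ofZ (t : K) a : frac_of (t *: a) = t *: frac_of a.
Proof. by rewrite -mul_mpolyC frac_ofM. Qed.

Lemma eval_neq0 b p : b.@[p 0] != 0 -> b != 0.
Proof. by apply: contra_neq => ->; rewrite meval0. Qed.

Lemma local_ringM p x y : local_ring p x -> local_ring p y -> local_ring p (x * y).
Proof.
move=> [a [b [hb ->]]] [a' [b' [hb' ->]]]; exists (a * a'), (b * b').
split; first by rewrite mevalM mulf_neq0.
by rewrite -![tofrac _]/(frac_of _) !frac_ofM invfM mulrACA.
Qed.

Lemma local_ring_poly p a : local_ring p (frac_of a).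
Proof.
exists a, 1; split; first by rewrite meval1 oner_neq0.
by rewrite -![tofrac _]/(frac_of _) frac_of1 divr1.
Qed.

Lemma local_ringV p b : b.@[p 0] != 0 -> local_ring p (frac_of b)^-1.
Proof.
by move=> hb; exists 1, b; split => //; rewrite -![tofrac _]/(frac_of _) frac_of1 mul1r.
Qed.

Variables (h : R) (p : 'rV[K]_m).
Let T := tjurina_ideal h p.

Lemma tjurinaD x y : T x -> T y -> T (x + y).
Proof.
move=> [s [hs ->]] [s' [hs' ->]]; exists (s ++ s'); split; last by rewrite big_cat.
by move=> u; rewrite mem_cat => /orP[/hs|/hs'].
Qed.

Lemma tjurinaM (c x : ratfun K m) : local_ring p c -> T x -> T (c * x).
Proof.
move=> hc [s [hs ->]]; exists [seq (c * u.1, u.2) | u <- s]; split.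
  by move=> u /mapP[w /hs [h1 h2] ->]; split => //=; apply: local_ringM.
by rewrite big_map mulr_sumr; apply: eq_bigr => u _; rewrite mulrA.
Qed.

Lemma tjurina_subspace : subspace T.
Proof.
split; first by exists [::]; split => //; rewrite big_nil.
move=> a x y hx hy; apply: tjurinaD => //.
by apply: tjurinaM => //; apply: local_ring_poly.
Qed.

Definition tjurina_gens := h :: [seq h^`M(j) | j <- enum 'I_m].

Lemma tjurina_of_poly a : gen_ideal tjurina_gens a -> T (frac_of a).
Proof.
have hI : ideal [set a | T (frac_of a)].
  split => /=.
  - by rewrite frac_of0; case: tjurina_subspace.
  - by move=> x y hx hy; rewrite frac_ofD; apply: tjurinaD.
  - by move=> c x hx; rewrite frac_ofM; apply: tjurinaM => //; apply: local_ring_poly.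
apply: (gen_ideal_sub hI) => u hu; exists [:: (1, frac_of u)]; split; last first.
  by rewrite big_seq1 mul1r.
move=> x; rewrite inE => /eqP ->; split; first by rewrite -frac_of1; apply: local_ring_poly.
move: hu; rewrite inE => /orP[/eqP->|/mapP[j _ ->]]; [by left | by right; exists j].
Qed.

(** The ideal of the local ring consists of the fractions with numerator in the
    polynomial ideal. *)
Lemma tjurina_frac q : T q <->
  exists a b, [/\ b.@[p 0] != 0, gen_ideal tjurina_gens a & q = frac_of a / frac_of b].
Proof.
split; last first.
  move=> [a [b [hb ha ->]]]; rewrite mulrC; apply: tjurinaM; first exact: local_ringV.
  exact: tjurina_of_poly.
have hI := gen_ideal_ideal tjurina_gens.
move=> [s [hs ->]]; elim: s hs => [_|[x y] s ih hs].
  rewrite big_nil; exists 0, 1; split; first by rewrite meval1 oner_neq0.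
    exact: ideal0.
  by rewrite frac_of0 mul0r.
have [|a [b [hb ha e]]] := ih.
  by move=> u hu; apply: hs; rewrite inE hu orbT.
have [/= [c [d [hd ex]]] hy] := hs _ (mem_head _ _); rewrite big_cons e /= ex.
have [g hg ->] : exists2 g, gen_ideal tjurina_gens g & y = frac_of g.
  have [->|[j ->]] := hy; first by exists h => //; apply: mem_gen_ideal; rewrite mem_head.
  exists (h^`M(j)) => //; apply: mem_gen_ideal; rewrite inE; apply/orP; right.
  by apply/mapP; exists j => //; rewrite mem_enum.
exists (c * g * b + a * d), (d * b); split.
- by rewrite mevalM mulf_neq0.
- by apply: idealD; [|apply: idealMr; [|apply: idealM]|apply: idealMr].
rewrite -![tofrac _]/(frac_of _) frac_ofD !frac_ofM.
by rewrite mulrAC addf_div ?frac_of_neq0 //; [apply: eval_neq0 hd | apply: eval_neq0 hb].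
Qed.

End Fractions.

Section Chart.
Variables (K : numClosedFieldType) (n : nat) (i : 'I_n).
Notation S := {mpoly K[n]}.
Notation S' := {mpoly K[n.-1]}.
Implicit Types (I J : set S) (a b p q : S) (P : S').

Definition dehom (p : S) : S' :=
  p \mPo [tuple if unlift i j is Some l then 'X_l else 1 | j < n].

Lemma dehomD a b : dehom (a + b) = dehom a + dehom b. Proof. exact: comp_mpolyD. Qed.
Lemma dehomB a b : dehom (a - b) = dehom a - dehom b. Proof. exact: comp_mpolyB. Qed.
Lemma dehomM a b : dehom (a * b) = dehom a * dehom b. Proof. exact: rmorphM. Qed.
Lemma dehomZ c a : dehom (c *: a) = c *: dehom a. Proof. exact: comp_mpolyZ. Qed.
Lemma dehom0 : dehom 0 = 0. Proof. exact: comp_mpoly0. Qed.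
Lemma dehomXn a k : dehom (a ^+ k) = dehom a ^+ k. Proof. exact: rmorphXn. Qed.
Lemma dehom_sum (T : Type) (r : seq T) (Q : pred T) (F : T -> S) :
  dehom (\sum_(j <- r | Q j) F j) = \sum_(j <- r | Q j) dehom (F j).
Proof. exact: raddf_sum. Qed.

Lemma dehom_var j : dehom 'X_j = if unlift i j is Some l then 'X_l else 1.
Proof. by rewrite /dehom comp_mpolyXU -tnth_nth tnth_mktuple. Qed.

Lemma dehom_lift l : dehom 'X_(lift i l) = 'X_l.
Proof. by rewrite dehom_var liftK. Qed.

Lemma dehom_i : dehom 'X_i = 1.
Proof. by rewrite dehom_var unlift_none. Qed.

Definition dehom_mnm (m : 'X_{1..n}) : 'X_{1..n.-1} := [multinom m (lift i l) | l < n.-1].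

Lemma dehom_mon m : dehom 'X_[m] = 'X_[dehom_mnm m].
Proof.
rewrite mpolyXE_id [RHS]mpolyXE_id.
rewrite /dehom rmorph_prod /= (bigD1_ord i) //= rmorphXn /= -/(dehom _) dehom_i expr1n mul1r.
by apply: eq_bigr => l _; rewrite rmorphXn /= -/(dehom _) dehom_lift mnmE.
Qed.

(** Among monomials of one degree, the exponent of 'X_i is determined by the
    others. *)
Lemma dehom_mnm_inj k m m' : mdeg m = k -> mdeg m' = k -> dehom_mnm m = dehom_mnm m' -> m = m'.
Proof.
move=> h h' e.
have el l : m (lift i l) = m' (lift i l).
  by have /(congr1 (fun t : 'X_{1..n.-1} => t l)) := e; rewrite !mnmE.
have ei : m i = m' i.
  have := h; rewrite -h' !mdegE !(bigD1_ord (x := 0%N) (op := addn) i) //=.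
  by under eq_bigr do rewrite el; move/addIn.
by apply/mnmP => j; case: (unliftP i j) => [l ->|->].
Qed.

Lemma dehom_inj k a : homogs k a -> dehom a = 0 -> a = 0.
Proof.
move=> ha e; apply: contrapT => /eqP a0.
have hm := mlead_supp a0; set m0 := mlead a in hm.
have /(congr1 (fun P : S' => P@_(dehom_mnm m0))) := e.
rewrite [a in dehom a]mpolyE dehom_sum raddf_sum /= (bigD1_seq m0) ?msupp_uniq //=.
rewrite mcoeff0 dehomZ dehom_mon mcoeffZ mcoeffX eqxx mulr1 big1_seq ?addr0.
  by move/eqP; rewrite mcoeff_eq0 hm.
move=> m /andP[mm hm']; rewrite dehomZ dehom_mon mcoeffZ mcoeffX.
case: eqP => [e'|]; last by rewrite mulr0.
case/eqP: mm; apply: (@dehom_mnm_inj k) => //.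
  exact: (dhomog_mf ha hm').
exact: (dhomog_mf ha hm).
Qed.

Lemma dehom_homogenize P :
  exists D0, forall D, (D0 <= D)%N -> exists2 H, homogs D H & dehom H = P.
Proof.
elim/mpolyind: P => [|c m P _ _ [D0 h0]].
  by exists 0%N => D _; exists 0; [exact: dhomog0 | exact: dehom0].
pose m' : 'X_{1..n} := [multinom (if unlift i j is Some l then m l else 0%N) | j < n].
have em : dehom_mnm m' = m by apply/mnmP => l; rewrite !mnmE liftK.
exists (D0 + mdeg m')%N => D le; have [|H hH eH] := h0 D; first by lia.
exists (c *: ('X_[m'] * 'X_i ^+ (D - mdeg m')) + H).
  apply: dhomogD => //; apply: dhomogZ.
  have -> : D = (mdeg m' + (D - mdeg m'))%N by lia.
  rewrite addKn; apply: dhomogM; first by rewrite dhomogX.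
  by have := dhomogMn (D - mdeg m') (homogs_var K i); rewrite mul1n.
by rewrite dehomD dehomZ dehomM dehomXn dehom_i expr1n mulr1 dehom_mon em eH.
Qed.

Lemma dehom_deriv l p : (dehom p)^`M(l) = dehom (p^`M(lift i l)).
Proof.
elim/mpolyind: p => [|c m p _ _ ih]; first by rewrite dehom0 !mderiv0 dehom0.
rewrite !(dehomD, mderivD, dehomZ, mderivZ) ih; congr (_ + _); congr (_ *: _).
rewrite dehom_mon !mderivX dehomZ dehom_mon mnmE; congr (_ *: 'X_[_]).
apply/mnmP => j; rewrite !mnmE; congr (_ - _)%N.
by rewrite (inj_eq lift_inj).
Qed.

Lemma dehom_eval k p (v : 'rV[K]_n) : v 0 i != 0 -> homogs k p ->
  (dehom p).@[chart_pt v i 0] = (v 0 i)^-1 ^+ k * p.@[v 0].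
Proof.
move=> vi hp; rewrite /dehom comp_mpoly_meval; apply: (meval_homog hp) => j.
rewrite tnth_mktuple; case: unliftP => [l ->|->].
  by rewrite mevalXU mxE mulrC.
by rewrite meval1 mulVf.
Qed.

Variables (d : nat) (f : S).
Hypotheses (d0 : (0 < d)%N) (hd : f \is d.-homog).

Definition partials : seq S := [seq f^`M(j) | j <- enum 'I_n].

Lemma partials_homog : {in partials, forall g, g \is d.-1.-homog}.
Proof.
move=> g /mapP[j _ ->]; apply/dhomogP => m; rewrite mcoeff_msupp mcoeff_mderiv.
move=> hm; have : (m + U_(j))%MM \in msupp f.
  by rewrite mcoeff_msupp; apply: contra_neq hm => ->; rewrite mul0rn.
move/(dhomog_mf hd) => e; have {e} : mdeg (m + U_(j))%MM = d by [].
by rewrite mdegD mdeg1 => <-; rewrite addn1.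
Qed.

Let J := gen_ideal partials.
Let hJ : ideal J. Proof. exact: gen_ideal_ideal. Qed.

Lemma mem_partial j : gen_ideal partials (f^`M(j)).
Proof. by apply: mem_gen_ideal; apply/mapP; exists j => //; rewrite mem_enum. Qed.

Lemma f_in_partials : gen_ideal partials f.
Proof.
have -> : f = d%:R^-1 *: (d%:R *: f).
  by rewrite scalerA mulVf ?scale1r // pnatr_eq0 -lt0n.
apply: idealZ => //; rewrite -(euler_homog hd); apply: ideal_sum => // j _.
by apply: idealM => //; apply: mem_partial.
Qed.

Let h := chart_eq f i.
Let tj_ideal := gen_ideal (tjurina_gens h).
Let htj_ideal : ideal tj_ideal. Proof. exact: gen_ideal_ideal. Qed.

Let tj_ideal_partial l : tj_ideal (dehom (f^`M(lift i l))).
Proof.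
rewrite -dehom_deriv; apply: mem_gen_ideal; rewrite inE; apply/orP; right.
by apply/mapP; exists l => //; rewrite mem_enum.
Qed.

(** By Euler's relation the missing partial derivative lies in the Tjurina ideal. *)
Lemma dehom_partials a : J a -> tj_ideal (dehom a).
Proof.
have hI : ideal [set a | tj_ideal (dehom a)].
  split => /=; first by rewrite dehom0; apply: ideal0.
    by move=> x y; rewrite dehomD; apply: idealD.
  by move=> c x; rewrite dehomM; apply: idealM.
apply: (gen_ideal_sub hI) => u /mapP[j _ ->] /=.
case: (unliftP i j) => [l ->|->]; first exact: tj_ideal_partial.
have := congr1 dehom (euler_homog hd).
rewrite dehom_sum (bigD1_ord i) //= dehomM dehom_i mul1r dehomZ => /eqP.
rewrite -subr_eq0 -addrA addr_eq0 => /eqP ->; apply: idealN => //.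
apply: idealB => //; first by apply: ideal_sum => // l _; rewrite dehomM; apply: idealM.
by apply: idealZ => //; apply: mem_gen_ideal; rewrite mem_head.
Qed.

(** After multiplication by a high power of 'X_i, an element of the Tjurina ideal
    comes from a form in the ideal of the partial derivatives of f, to which f
    itself belongs. *)
Lemma homogenize_partials P : tj_ideal P ->
  exists D0, forall D, (D0 <= D)%N -> exists H, [/\ homogs D H, J H & dehom H = P].
Proof.
pose I := [set P : S' | exists D0, forall D, (D0 <= D)%N ->
  exists H, [/\ homogs D H, J H & dehom H = P]].
have hI : ideal I.
  split.
  - by exists 0%N => D _; exists 0; split; [exact: dhomog0 | exact: ideal0 | exact: dehom0].
  - move=> x y [D0 hx] [D1 hy]; exists (D0 + D1)%N => D le.
    have [|H [h1 h2 <-]] := hx D; first by lia.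
    have [|H' [h1' h2' <-]] := hy D; first by lia.
    by exists (H + H'); split; [exact: dhomogD | exact: idealD | exact: dehomD].
  - move=> c x [D0 hx]; have [D1 hc] := dehom_homogenize c; exists (D0 + D1)%N => D le.
    have [H [h1 h2 <-]] := hx D0 (leqnn _).
    have [|C h1' <-] := hc (D - D0)%N; first by lia.
    exists (C * H); split; [|exact: idealM | exact: dehomM].
    by have -> : D = (D - D0 + D0)%N by [lia]; apply: homogsM.
have up k p : homogs k p -> J p -> I (dehom p).
  move=> hp hJp; exists k => D le; exists ('X_i ^+ (D - k) * p); split.
  - suff : homogs (D - k + k) ('X_i ^+ (D - k) * p) by rewrite subnK.
    by apply: homogsM => //; have := dhomogMn (D - k) (homogs_var K i); rewrite mul1n.
  - exact: idealM.
  - by rewrite dehomM dehomXn dehom_i expr1n mul1r.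
apply: (gen_ideal_sub hI) => u; rewrite inE => /orP[/eqP->|/mapP[l _ ->]].
  by apply: (up d f hd); apply: f_in_partials.
rewrite -[h]/(dehom f) dehom_deriv; apply: (up d.-1); last exact: mem_partial.
by apply: partials_homog; apply/mapP; exists (lift i l) => //; rewrite mem_enum.
Qed.

Variable v : 'rV[K]_n.
Hypothesis vi : v 0 i != 0.
Let L := loc J (v 0).
Let p := chart_pt v i.
Let T := tjurina_ideal h p.

Lemma tjurina_loc k a : homogs k a -> T (frac_of (dehom a)) <-> L a.
Proof.
move=> ha; split.
  move/tjurina_frac => [al [be [hb hal e]]].
  have e' : dehom a * be = al.
    apply: frac_of_inj; rewrite frac_ofM e divfK //; apply: frac_of_neq0; exact: eval_neq0 hb.
  have [D0 h0] := homogenize_partials hal; have [D1 h1] := dehom_homogenize be.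
  have [|H [H1 H2 H3]] := h0 (D0 + D1 + k)%N; first by lia.
  have [|B B1 B2] := h1 (D0 + D1)%N; first by lia.
  exists (D0 + D1)%N, B; split => //.
    by move: hb; rewrite -B2 (dehom_eval vi B1) mulf_eq0 negb_or => /andP[].
  suff -> : B * a = H by [].
  apply/eqP; rewrite -subr_eq0; apply/eqP; apply: (@dehom_inj (D0 + D1 + k)).
    by apply: rpredB => //; apply: homogsM.
  by rewrite dehomB dehomM B2 H3 -e' mulrC subrr.
move=> [m [b [hb bv hba]]]; apply/tjurina_frac; exists (dehom (b * a)), (dehom b).
have hb' : (dehom b).@[p 0] != 0.
  by rewrite (dehom_eval vi hb) mulf_neq0 // expf_neq0 // invr_neq0.
split => //; first exact: dehom_partials.
rewrite dehomM frac_ofM mulrAC mulfV ?mul1r //; apply: frac_of_neq0; exact: eval_neq0 hb'.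
Qed.

(** The Tjurina number in a chart is the stable value of the Hilbert function of
    the localised homogeneous ideal; in particular it is independent of the
    chart. *)
Theorem tjurina_stable k0 t : (forall k, (k0 <= k)%N -> hilbert L k = t) ->
  tjurina h p = t.
Proof.
move=> ht; apply: dim_quotE; first exact: tjurina_subspace.
have gJ : graded J.
  by apply: gen_ideal_graded => u /partials_homog hu; exists d.-1.
have hL : ideal L by apply: loc_ideal.
rewrite -(ht k0) //.
apply: (dimq_transport (phi := fun a => frac_of (dehom a)) _ (@homogs_subspace K n k0) _ _ _ _
  (hilbertP k0 hL)).
- by move=> c a b; rewrite dehomD dehomZ frac_ofD frac_ofZ.
- exact: tjurina_subspace.
- by move=> a _; apply: local_ring_poly.
- by move=> a ha; apply: tjurina_loc ha.
move=> q [al [be [hb ->]]].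
have [D0 h0] := dehom_homogenize al; have [D1 h1] := dehom_homogenize be.
have [|A A1 A2] := h0 (k0 + (D0 + D1))%N; first by lia.
have [|B B1 B2] := h1 (D0 + D1)%N; first by lia.
have Bv : B.@[v 0] != 0.
  by move: hb; rewrite -B2 (dehom_eval vi B1) mulf_eq0 negb_or => /andP[].
have [||s s1 s2] := loc_onto hJ gJ (k := k0) (t := t) B1 Bv _ _ A1.
- exact: ht.
- by apply: ht; rewrite leq_addr.
exists s => //; have hs : homogs (k0 + (D0 + D1)) (A - B * s).
  by apply: rpredB => //; rewrite addnC; apply: homogsM.
move/(tjurina_loc hs): s2; rewrite dehomB dehomM frac_ofB frac_ofM A2 B2 => hT.
have fb : frac_of be != 0 by apply: frac_of_neq0; exact: eval_neq0 hb.
have -> : tofrac al / tofrac be - frac_of (dehom s) = (frac_of be)^-1 * (frac_of al - frac_of be * frac_of (dehom s)).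
  by rewrite -![tofrac _]/(frac_of _) mulrBr mulKf // mulrC.
by apply: tjurinaM => //; apply: local_ringV.
Qed.

End Chart.

(** * Finiteness of the projective singular locus *)

(** Choose repeatedly a position where the remaining values are minimal. *)
Lemma nondecreasing_subseq (u : nat -> nat) :
  exists2 phi : nat -> nat, (forall s, (phi s < phi s.+1)%N)
    & forall s s', (s <= s')%N -> (u (phi s) <= u (phi s'))%N.
Proof.
have H N : exists k, (N <= k)%N /\ forall j, (N <= j)%N -> (u k <= u j)%N.
  pose P m := `[< exists2 k, (N <= k)%N & u k = m >].
  have exP : exists m, P m by exists (u N); apply/asboolP; exists N.
  case: (ex_minnP exP) => m /asboolP[k le e] hmin; exists k; split => // j lj.
  by rewrite e; apply: hmin; apply/asboolP; exists j.
have [m hm] := boolp.choice H.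
pose phi s := iter s (fun k => m k.+1) (m 0%N).
have inc s : (phi s < phi s.+1)%N by have [] := hm (phi s).+1.
have step s j : (phi s <= j)%N -> (u (phi s) <= u j)%N.
  case: s => [|s] le; first by have [_] := hm 0%N; apply.
  have [_] := hm (phi s).+1; apply; exact: leq_trans (inc s) le.
exists phi => // s s' le; apply: step.
rewrite -(subnK le); elim: (s' - s)%N => [//|i ih].
by rewrite addSn; apply: leq_trans ih (ltnW (inc _)).
Qed.

(** Successive subsequences make all exponents nondecreasing. *)
Lemma dickson n (g : nat -> 'X_{1..n}) : exists i j, (i < j)%N /\ (g i <= g j)%MM.
Proof.
suff [phi inc h] : exists2 phi : nat -> nat, (forall s, (phi s < phi s.+1)%N) &
    forall i, i \in enum 'I_n -> forall s s', (s <= s')%N -> (g (phi s) i <= g (phi s') i)%N.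
  exists (phi 0%N), (phi 1%N); split => //; apply/mnm_lepP => i.
  by apply: h; rewrite ?mem_enum.
elim: (enum 'I_n) => [|i r [phi inc h]]; first by exists id => [s|i] //; rewrite in_nil.
have [psi psi_inc psi_h] := nondecreasing_subseq (fun s => g (phi s) i).
have mono (th : nat -> nat) : (forall s, (th s < th s.+1)%N) ->
    forall s s', (s < s')%N -> (th s < th s')%N.
  move=> ht s s' lt; rewrite -(subnK lt); elim: (s' - s.+1)%N => [|k ih].
    by rewrite add0n.
  by rewrite addSn; apply: ltn_trans ih (ht _).
exists (phi \o psi) => [s|j]; first exact: (mono phi inc _ _ (psi_inc s)).
rewrite inE => /orP[/eqP-> |hj] s s' le; first exact: psi_h.
apply: h => //; rewrite leq_eqVlt in le; case/orP: le => [/eqP-> //|lt].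
exact: (ltnW (mono psi psi_inc _ _ lt)).
Qed.

Section Noether.
Variables (K : fieldType) (n : nat).
Notation S := {mpoly K[n]}.

(** Hilbert's basis theorem. The members of I k.+1 outside I k with the smallest
    leading monomials would have pairwise non-dividing leading monomials. *)
Lemma ideal_acc (I : nat -> set S) : (forall k, ideal (I k)) ->
  (forall k, I k `<=` I k.+1) -> exists k, I k.+1 `<=` I k.
Proof.
move=> hI sI; apply: contrapT => /forallNP hne.
pose P k a := [/\ I k.+1 a, ~ I k a &
  forall b, I k.+1 b -> ~ I k b -> ~ (mlead b < mlead a)%O].
have exP k : exists a, P k a.
  have [a ha na] : exists2 a, I k.+1 a & ~ I k a.
    by apply: contrapT => h; apply: (hne k) => a ha; apply: contrapT => na; apply: h; exists a.
  move: {2}(mlead a) (erefl (mlead a)) => m em.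
  elim/(well_founded_ind (@ltom_wf n)): m a em ha na => m ih a em ha na.
  have [[b [h1 h2 h3]]|h] := pselect (exists b, [/\ I k.+1 b, ~ I k b & (mlead b < mlead a)%O]).
    by apply: (ih (mlead b)) h1 h2 => //; rewrite -em.
  by exists a; split => // b h1 h2 h3; apply: h; exists b.
have [a ha] := boolp.choice exP.
have [i [j [ltij le]]] := dickson (fun k => mlead (a k)).
have sub : forall s s', (s <= s')%N -> I s `<=` I s'.
  move=> s s' lst; rewrite -(subnK lst); elim: (s' - s)%N => [//|k ih] x hx.
  by rewrite addSn; apply/sI/ih.
have [ai1 ai2 _] := ha i; have [aj1 aj2 amin] := ha j.
have ai0 : a i != 0 by apply/eqP => e; apply: ai2; rewrite e; apply: ideal0.
have aj0 : a j != 0 by apply/eqP => e; apply: aj2; rewrite e; apply: ideal0.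
have hij : I j (a i) by apply: sub ai1.
pose c := mleadc (a j) / mleadc (a i).
pose q := c *: ('X_[mlead (a j) - mlead (a i)] * a i).
have ci0 : mleadc (a i) != 0 by rewrite mleadc_eq0.
have cj0 : mleadc (a j) != 0 by rewrite mleadc_eq0.
have c0 : c != 0 by rewrite mulf_neq0 ?invr_neq0.
have X0 m : 'X_[m] != 0 :> S.
  by rewrite -msupp_eq0 msuppX.
have eq_lead : mlead q = mlead (a j).
  by rewrite /q mleadZ // mleadM // mleadXm submK.
have hq : I j q by apply: idealZ => //; apply: idealM.
have nb : ~ I j (a j - q).
  by move=> h; apply: aj2; rewrite -(subrK q (a j)); apply: idealD.
have hb : I j.+1 (a j - q) by apply: idealB => //; apply: sI.
have b0 : a j - q != 0 by apply/eqP => e; apply: nb; rewrite e; apply: ideal0.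
apply: (amin _ hb nb); rewrite lt_neqAle; apply/andP; split.
  apply/eqP => e; move: b0; rewrite -mleadc_eq0 e mcoeffB /q mcoeffZ.
  have -> : ('X_[mlead (a j) - mlead (a i)] * a i)@_(mlead (a j)) = mleadc (a i).
    by rewrite -[X in _@_X](submK le) mulrC mcoeffMX.
  by rewrite /c divfK // subrr eqxx.
by apply: le_trans (mleadB_le _ _) _; rewrite eq_lead joinxx.
Qed.

Definition vanishing (X : set 'rV[K]_n) : set S := [set p | forall v, X v -> p.@[v 0] = 0].

Lemma vanishing_ideal X : ideal (vanishing X).
Proof.
split=> [v _|a b ha hb v hv|c a ha v hv]; first exact: meval0.
  by rewrite mevalD ha // hb // addr0.
by rewrite mevalM ha // mulr0.
Qed.

Definition finite_union (Ws : seq (set 'rV[K]_n)) (X : set 'rV[K]_n) :=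
  (forall W, List.In W Ws -> zariski_irreducible W) /\
  forall x, X x -> exists2 W, List.In W Ws & W `<=` X /\ W x.

(** Noetherian induction: a closed set without such a decomposition would contain
    an infinite strictly decreasing chain of closed sets. *)
Lemma irreducible_components X : zariski_closed X -> exists Ws, finite_union Ws X.
Proof.
move=> hX; apply: contrapT => nX.
pose bad Y := zariski_closed Y /\ ~ exists Ws, finite_union Ws Y.
have step Y : exists Y', bad Y -> [/\ bad Y', Y' `<=` Y & Y' <> Y].
  have [[cY nY]|h] := pselect (bad Y); last by exists Y => /h.
  have [Y0|Y0] := pselect (Y !=set0); last first.
    case: nY; exists [::]; split => [W []|x hx]; case: Y0; by exists x.
  have : ~ zariski_irreducible Y.
    move=> irr; apply: nY; exists [:: Y]; split => [W [<- //|[]]|x hx].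
    by exists Y; [left | split].
  move=> nirr.
  have [A [B [cA cB e nA nB]]] : exists A B,
      [/\ zariski_closed A, zariski_closed B, Y = A `|` B, Y <> A & Y <> B].
    apply: contrapT => h; apply: nirr; split => // A B cA cB e.
    have [eA|nA] := pselect (Y = A); [by left | right].
    by apply: contrapT => nB; apply: h; exists A, B.
  have sA : A `<=` Y by rewrite e => x; left.
  have sB : B `<=` Y by rewrite e => x; right.
  have [[WA [A1 A2]]|hA] := pselect (exists Ws, finite_union Ws A); last first.
    by exists A => _; split => // eA; apply: nA.
  have [[WB [B1 B2]]|hB] := pselect (exists Ws, finite_union Ws B); last first.
    by exists B => _; split => // eB; apply: nB.
  case: nY; exists (WA ++ WB); split.
    by move=> W /List.in_app_iff [/A1|/B1].
  move=> x; rewrite {1}e => -[/A2|/B2] [W hW [sW Wx]]; exists W.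
  - by apply/List.in_app_iff; left.
  - by split => //; apply: subset_trans sA.
  - by apply/List.in_app_iff; right.
  - by split => //; apply: subset_trans sB.
have [nxt hnxt] := boolp.choice step.
pose Y k := iter k nxt X.
have hY k : bad (Y k) by elim: k => [//|k /hnxt []].
have [k hk] : exists k, vanishing (Y k.+1) `<=` vanishing (Y k).
  apply: (ideal_acc (I := fun k => vanishing (Y k))) => [k|k p hp v hv].
    exact: vanishing_ideal.
  by apply: hp; have [_ sub _] := hnxt _ (hY k); apply: sub.
have [_ sub ne] := hnxt _ (hY k); apply: ne; apply/seteqP; split => // x hx.
have [[Z eZ] _] := hY k.+1; rewrite -[nxt _]/(Y k.+1) eZ => p hp.
by apply: (hk p) => // v; rewrite eZ => /(_ _ hp).
Qed.

End Noether.

Section Lines.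
Variables (K : numFieldType) (n : nat).
Notation S := {mpoly K[n]}.
Implicit Types (v w : 'rV[K]_n).

Definition line v : set 'rV[K]_n := [set w | exists c : K, w = c *: v].

Lemma eval_on_line (p : S) v :
  exists P : {poly K}, forall c, P.[c] = p.@[(c *: v) 0].
Proof.
elim/mpolyind: p => [|c m p _ _ [P hP]].
  by exists 0 => t; rewrite horner0 meval0.
exists (c *: \prod_(i < n) (v 0 i *: 'X) ^+ m i + P) => t.
rewrite mevalD mevalZ mevalX hornerD hornerZ hP; congr (_ * _ + _).
rewrite horner_prod; apply: eq_bigr => i _.
by rewrite horner_exp hornerZ hornerX mxE mulrC.
Qed.

(** Equations of members of Ws that do not contain the line restrict to nonzero
    polynomials in one variable, and their product is nonzero at some point. *)
Lemma line_sub_union (Ws : seq (set 'rV[K]_n)) v :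
    (forall W, List.In W Ws -> zariski_closed W) ->
    (forall w, line v w -> exists2 W, List.In W Ws & W w) ->
  exists2 W, List.In W Ws & line v `<=` W.
Proof.
move=> hW hcov; apply: contrapT => hn.
suff [P P0 hP] : exists2 P : {poly K}, P != 0 &
    forall c W, List.In W Ws -> W (c *: v) -> P.[c] = 0.
  have [c hc] := poly_nonroot P0; have [|W WW Wc] := hcov (c *: v); first by exists c.
  by move/eqP: hc; apply; apply: hP Wc.
have {hn}hn W : List.In W Ws -> ~ line v `<=` W by move=> h1 h2; apply: hn; exists W.
elim: Ws hW hn {hcov} => [_ _|W Ws ih hW hn].
  by exists 1 => //; rewrite oner_neq0.
have [||P P0 hP] := ih.
- by move=> W' h; apply: hW; right.
- by move=> W' h; apply: hn; right.
have [c hc] : exists c, ~ W (c *: v).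
  apply: contrapT => /forallNP h; apply: (hn W); first by left.
  by move=> w [c ->]; apply: contrapT; apply: h.
have [T eT] := hW W (or_introl erefl).
have [p hp pc] : exists2 p, T p & p.@[(c *: v) 0] <> 0.
  apply: contrapT => h; apply: hc; rewrite eT => p hp.
  by apply: contrapT => hpc; apply: h; exists p.
have [Q hQ] := eval_on_line p v.
exists (Q * P); first rewrite mulf_neq0 //.
  by apply: contra_not_neq pc => Q0; rewrite -hQ Q0 horner0.
move=> t W' [<-|hW'] ht; rewrite hornerM.
  by rewrite hQ; move: ht; rewrite eT => ->; rewrite ?mul0r.
by rewrite (hP t W') ?mulr0.
Qed.

Lemma line_irreducible v : zariski_closed (line v) -> zariski_irreducible (line v).
Proof.
move=> cl; split => //; first by exists v; exists 1; rewrite scale1r.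
move=> A B cA cB e.
have [||W] := line_sub_union (Ws := [:: A; B]) (v := v).
- by move=> W [<- //|[<- //|[]]].
- by move=> w; rewrite e => -[hA|hB]; [exists A; [left|] | exists B; [right; left|]].
case=> [<-|[<-|[]]] sub; [left|right]; apply/seteqP; split => // x hx; rewrite e;
  by [left | right].
Qed.

Lemma line_closed v : v != 0 -> zariski_closed (line v).
Proof.
move=> v0; exists [set p : S | exists i j, p = v 0 i *: 'X_j - v 0 j *: 'X_i].
apply/seteqP; split => [w [c ->] p [i [j ->]]|w hw].
  by rewrite mevalB !mevalZ !mevalXU !mxE; ring.
have [i vi] : exists i, v 0 i != 0 by apply/rV0Pn.
exists (w 0 i / v 0 i); apply/rowP => j; rewrite mxE.
have := hw _ (ex_intro _ i (ex_intro _ j erefl)).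
rewrite mevalB !mevalZ !mevalXU => /eqP; rewrite subr_eq0 => /eqP e.
by apply: (mulfI vi); rewrite e; field.
Qed.

Lemma line0 : line 0 = [set 0].
Proof.
by apply/seteqP; split => [w [c ->]|w ->] /=; [rewrite scaler0 | exists 0; rewrite scaler0].
Qed.

Lemma origin_irreducible : zariski_irreducible [set (0 : 'rV[K]_n)].
Proof.
rewrite -line0; apply: line_irreducible; rewrite line0.
exists [set p : S | exists i, p = 'X_i]; apply/seteqP; split => [w -> p [i ->]|w hw].
  by rewrite mevalXU mxE.
apply/rowP => i; rewrite mxE.
by have := hw _ (ex_intro _ i erefl); rewrite mevalXU.
Qed.

(** A closed cone of dimension at most one is a finite union of lines: a line
    properly contained in an irreducible component would give a chain of length
    two. *)
Lemma cone_lines_finite (X : set 'rV[K]_n) : zariski_closed X ->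
    (forall v, X v -> line v `<=` X) -> zariski_dim_le X 1 ->
  finite_set [set z : {vspace 'rV[K]_n} | exists v, [/\ X v, v != 0 & z = <[v]>%VS]].
Proof.
move=> cX cone dimX; have [Ws [irr hWs]] := irreducible_components cX.
pose g (W : set 'rV[K]_n) : {vspace 'rV[K]_n} :=
  xget 0%VS [set z : {vspace 'rV[K]_n} | forall w, W w <-> w \in z].
apply: (@sub_finite_set _ _ [set` map g Ws]); last first.
  by apply/finite_seqP; exists (map g Ws).
move=> z [v [Xv v0 ez]] /=.
pose Ws' := [seq W <- Ws | `[< W `<=` X >]].
have inWs' W : List.In W Ws' -> List.In W Ws /\ W `<=` X.
  by rewrite /Ws' => /List.filter_In [h /asboolP].
have clW W : List.In W Ws' -> zariski_closed W by move=> /inWs' [/irr []].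
have [|W /inWs' [WWs WX] sW] := line_sub_union clW (v := v).
  move=> w /(cone v Xv) /hWs [W hW [h1 h2]]; exists W => //.
  by apply/List.filter_In; split => //; apply/asboolP.
have eW : W = line v.
  apply: contrapT => ne.
  apply: (dimX (fun i => match i with 0 => [set 0] | 1 => line v | _ => W end)).
    move=> [|[|[|i]]] // _; split.
    - exact: origin_irreducible.
    - by move=> x ->; apply: (cone v Xv); exists 0; rewrite scale0r.
    - exact/line_irreducible/line_closed.
    - exact: cone.
    - exact: irr.
    - exact: WX.
  move=> [|[|i]] // _; split.
  - by move=> x ->; exists 0; rewrite scale0r.
  - move=> h; have : line v v by exists 1; rewrite scale1r.
    by move/h => /= e; rewrite e eqxx in v0.
  - exact: sW.
  - by move=> h; apply: ne; apply/seteqP.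
suff -> : z = g W.
  have : forall r, List.In W r -> g W \in map g r.
    elim=> // W' r ih [->|/ih h]; rewrite /= inE ?eqxx // h orbT //.
  exact.
have zP : forall w, W w <-> w \in z.
  move=> w; rewrite eW ez; split => [[c ->]|/vlineP [c ->]]; last by exists c.
  by apply: memvZ; apply: memv_line.
have := xgetPex 0%VS (ex_intro (fun z : {vspace 'rV[K]_n} => forall w, W w <-> w \in z) z zP).
rewrite -/(g W) => gP; apply/vspaceP => w.
by apply/idP/idP => [/zP/gP|/gP/zP].
Qed.

End Lines.

(** * Generic linear forms *)

Section GenericForms.
Variables (K : numClosedFieldType) (n : nat).
Notation S := {mpoly K[n]}.

(** Adding all variables to I gives the ideal of the variables; by the homogeneous
    Nullstellensatz they can be removed again one at a time. *)
Lemma no_zero_primary (I : set S) : ideal I -> graded I ->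
  (forall v, zero_of I v -> forall i, v i = 0) -> primary I.
Proof.
move=> hI gI hz; pose adjs r := foldr (fun i J => adjoin J 'X_i) I r.
have sub r : I `<=` adjs r.
  by elim: r => [//|i r ih] x /ih h; apply: sub_adjoin.
have hA r : ideal (adjs r) by elim: r => [//|i r ih]; apply: adjoin_ideal.
have gA r : graded (adjs r).
  by elim: r => [//|i r ih]; apply: adjoin_graded (homogs_var K i).
have : primary (adjs (enum 'I_n)).
  move=> i; exists 1%N; rewrite expr1; move: (mem_enum 'I_n i) => /=.
  elim: (enum 'I_n) => [//|j r ih]; rewrite inE => /orP[/eqP->|/ih h].
    exact: adjoin_gen.
  exact: sub_adjoin.
elim: (enum 'I_n) => [//|i r ih] hm; apply: ih.
have [v hv|M [N hN]] := homog_nullstellensatz (hA r) (gA r) (homogs_var K i) hm (homogs_var K i).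
  by rewrite mevalXU; apply: hz => p /(sub r)/hv.
have hX : rad (adjs r) 'X_i by exists (N + M)%N; rewrite exprD.
by move=> j; apply: (rad_adjoin (hA r) (fun x h => h) hX); apply: hm.
Qed.

(** Take the coefficients 1, u, ..., u ^ (n - 1) where u is not a root of any of the
    polynomials whose coefficients are the coordinates of the points. *)
Lemma avoiding_form (vs : seq ('I_n -> K)) :
    (forall v, List.In v vs -> exists i, v i != 0) ->
  exists2 l : S, l \is 1.-homog & forall v, List.In v vs -> l.@[v] != 0.
Proof.
move=> hv; pose P (v : 'I_n -> K) : {poly K} := \poly_(i < n) (if insub i is Some j then v j else 0).
have cP v (i : 'I_n) : (P v)`_i = v i by rewrite coef_poly ltn_ord valK.
have [u hu] : exists u, forall v, List.In v vs -> (P v).[u] != 0.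
  have [Q Q0 hQ] : exists2 Q : {poly K}, Q != 0 &
      forall u, Q.[u] != 0 -> forall v, List.In v vs -> (P v).[u] != 0.
    elim: vs hv => [_|v vs ih hv]; first by exists 1; rewrite ?oner_neq0.
    have [|Q Q0 hQ] := ih; first by move=> w hw; apply: hv; right.
    have [i vi] := hv v (or_introl erefl).
    exists (P v * Q).
      by rewrite mulf_neq0 //; apply: contra_neq vi => P0; rewrite -cP P0 coef0.
    move=> u; rewrite hornerM mulf_eq0 negb_or => /andP[h1 h2] w [<- //|].
    exact: hQ.
  by have [u hu] := poly_nonroot Q0; exists u; apply: hQ.
exists (\sum_(i < n) u ^+ i *: 'X_i).
  by apply: rpred_sum => i _; apply: rpredZ; apply: homogs_var.
move=> v /hu; rewrite horner_poly raddf_sum /=.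
congr (_ != 0); apply: eq_bigr => i _.
by rewrite valK mevalZ mevalXU mulrC.
Qed.

End GenericForms.

(** * Differential forms of top degree *)

Section Forms.
Variables (K : numClosedFieldType) (n : nat).
Hypothesis n0 : (0 < n)%N.
Notation S := {mpoly K[n]}.
Notation top := [set: 'I_n]%SET.
Variable f : S.
Let J := gen_ideal (partials f).
Let hJ : ideal J. Proof. exact: gen_ideal_ideal. Qed.

Definition top_form (p : S) : Defs.form K n :=
  [ffun A : {set 'I_n} => if A == top then p else 0].

Lemma top_formE p : top_form p top = p.
Proof. by rewrite ffunE eqxx. Qed.

Lemma top_form_is p : is_form n (top_form p).
Proof.
move=> A hA; rewrite ffunE; case: eqP => // e.
by move: hA; rewrite e cardsT card_ord eqxx.
Qed.

Lemma is_form_top w : is_form n w -> w = top_form (w top).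
Proof.
move=> hw; apply/ffunP => A; rewrite ffunE; case: eqP => [-> //|/eqP ne].
apply: hw; apply: contra ne => /eqP e.
by rewrite eqEcard finset.subsetT cardsT card_ord e leqnn.
Qed.

Lemma mem_partialsP a : J a <-> exists c : 'I_n -> S, a = \sum_i c i * f^`M(i).
Proof.
split; last first.
  by move=> [c ->]; apply: ideal_sum => // i _; apply: idealM => //; apply: mem_partial.
have hI : ideal [set a | exists c : 'I_n -> S, a = \sum_i c i * f^`M(i)].
  split => /=.
  - by exists (fun=> 0); rewrite big1 // => i _; rewrite mul0r.
  - move=> x y [c ->] [c' ->]; exists (fun i => c i + c' i).
    by rewrite -big_split; apply: eq_bigr => i _; rewrite mulrDl.
  - move=> x y [c ->]; exists (fun i => x * c i).
    by rewrite mulr_sumr; apply: eq_bigr => i _; rewrite mulrA.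
apply: (gen_ideal_sub hI) => u /mapP[j _ ->] /=.
exists (fun i => (i == j)%:R); rewrite (bigD1 j) //= eqxx mul1r big1 ?addr0 // => i.
by move/negbTE->; rewrite mul0r.
Qed.

Lemma wedge_df e A : wedge (dform f) e A =
  \sum_(i in A) (-1) ^+ wedge_inv [set i]%SET (A :\ i) * (f^`M(i) * e (A :\ i)).
Proof.
rewrite ffunE.
transitivity (\sum_(I in powerset A) \sum_(i | I == [set i]%SET)
   (-1) ^+ wedge_inv I (A :\: I) * (f^`M(i) * e (A :\: I))).
  by apply: eq_bigr => I _; rewrite ffunE mulr_suml mulr_sumr.
rewrite (exchange_big_dep (fun i => i \in A)) /=; last first.
  by move=> I i; rewrite finset.powersetE => sI /eqP e'; move: sI; rewrite e' finset.sub1set.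
apply: eq_bigr => i iA; rewrite (big_pred1 [set i]%SET) // => I /=.
by rewrite finset.powersetE; case: eqP => [->|]; rewrite ?finset.sub1set ?iA ?andbT ?andbF.
Qed.

(** In top degree the wedge product with df is, up to signs that can be absorbed
    in e, the combination of the partial derivatives with coefficients e. *)
Lemma df_wedgeP w : df_wedge f w <-> is_form n w /\ J (w top).
Proof.
split=> [[e he ->]|[hw]].
  split=> [A hA|]; rewrite wedge_df.
    apply: big1 => i iA; rewrite he ?mulr0 //.
    apply: contra hA => /eqP; rewrite (cardsD1 i A) iA => ->.
    by rewrite add1n prednK.
  by apply: ideal_sum => // i _; apply: idealM => //; apply: idealMr => //; apply: mem_partial.
move/mem_partialsP=> [c hc].
pose e : Defs.form K n := [ffun A : {set 'I_n} => \sum_(i < n | A == top :\ i)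
  (-1) ^+ wedge_inv [set i]%SET (top :\ i) * c i].
have he : is_form n.-1 e.
  move=> A hA; rewrite ffunE big1 // => i /eqP eA; move: hA; rewrite eA.
  have := cardsD1 i top; rewrite finset.in_setT cardsT card_ord add1n => /(congr1 predn) /= <-.
  by rewrite eqxx.
exists e => //; apply/ffunP => A; rewrite wedge_df.
have [eA|/eqP nA] := pselect (A = top); last first.
  have hA : #|A| != n.
    apply: contra nA => /eqP e'; by rewrite eqEcard finset.subsetT cardsT card_ord e' leqnn.
  rewrite hw // big1 // => i iA; rewrite he ?mulr0 //.
  apply: contra hA => /eqP; rewrite (cardsD1 i A) iA => ->.
  by rewrite add1n prednK.
rewrite eA hc; apply: eq_big => [i|i _]; first by rewrite finset.in_setT.
rewrite ffunE (big_pred1 i) => [|j /=].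
  by rewrite (mulrCA (f^`M(i))) signrMK mulrC.
apply/eqP/eqP => [e'|->//].
have : j \notin top :\ i by rewrite e' finset.setD11.
by rewrite !inE andbT negbK => /eqP.
Qed.

Lemma form_mul_top (p : S) w : is_form n w ->
  is_form n (form_mul p w) /\ form_mul p w top = p * w top.
Proof.
by move=> hw; split=> [A hA|]; rewrite ffunE // hw // mulr0.
Qed.

Lemma Omega_topP (k : int) (w : Defs.form K n) : Omega_top k w <->
  is_form n w /\ forall m, m \in msupp (w top) -> (mdeg m + n)%:Z = k.
Proof.
split=> -[hw hd]; split => //; first by move=> m /hd; rewrite cardsT card_ord.
move=> A m hA; have [e|/eqP ne] := pselect (A = top).
  by rewrite e cardsT card_ord; apply: hd; rewrite -e.
move: hA; rewrite (is_form_top hw) ffunE (negbTE ne) msupp0 in_nil //.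
Qed.

Lemma Omega_top_homog (k : nat) (w : Defs.form K n) :
  Omega_top (k + n)%N w <-> is_form n w /\ homogs k (w top).
Proof.
split=> [/Omega_topP|] [hw h].
  split => //; apply/dhomogP => m /h /eqP; rewrite eqz_nat eqn_add2r => /eqP.
  exact.
by apply/Omega_topP; split => // m hm'; rewrite (dhomog_mf h hm').
Qed.

Lemma Omega_top_small (k : int) (w : Defs.form K n) : k < n%:Z -> Omega_top k w -> w = 0.
Proof.
move=> lt /Omega_topP [hw h].
suff w0 : w top = 0.
  by rewrite (is_form_top hw) w0; apply/ffunP => A; rewrite !ffunE if_same.
apply: contrapT => /eqP /mlead_supp /h e; move: lt; rewrite -e; lia.
Qed.

Let df_wedge_subspace : subspace (df_wedge f).
Proof.
split; first by apply/df_wedgeP; split=> [A _|]; rewrite ffunE //; apply: ideal0.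
move=> a u v /df_wedgeP [hu hu'] /df_wedgeP [hv hv']; apply/df_wedgeP; split.
  by move=> A hA; rewrite !ffunE hu // hv // scaler0 addr0.
by rewrite !ffunE; apply: idealD => //; apply: idealZ.
Qed.

Let top_form_linear : linear top_form.
Proof.
by move=> a u v; apply/ffunP => A; rewrite !ffunE; case: eqP => // _; rewrite scaler0 addr0.
Qed.

Lemma mu'_small (k : int) : k < n%:Z -> mu' f k = 0%N.
Proof.
move=> lt; apply: dim_quotE => //; exists (fun=> 0); split; first by case.
  move=> w [/(Omega_top_small lt) -> _]; exists (fun=> 0).
  by rewrite big_ord0 subr0; case: df_wedge_subspace.
by move=> c _ [].
Qed.

Variable l : S.
Hypotheses (hl : l \is 1.-homog) (hm : primary (adjoin J l)).

(** Polynomials of order at least j; only monomial degrees matter for powers of the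
    maximal ideal. *)
Let low j : set S := [set p | forall m, (mdeg m < j)%N -> p@_m = 0].

Let low_ideal j : ideal (low j).
Proof.
split; rewrite /low /=.
- by move=> m _; rewrite mcoeff0.
- by move=> a b ha hb m hmj; rewrite mcoeffD ha // hb // addr0.
- move=> c a ha m hmj; rewrite mcoeffM big1 // => -[k1 k2] /= /eqP e.
  rewrite ha ?mulr0 //; move: e => /(congr1 mdeg); rewrite mdegD; lia.
Qed.

Let lowM i j a b : low i a -> low j b -> low (i + j) (a * b).
Proof.
move=> ha hb m hmj; rewrite mcoeffM big1 // => -[k1 k2] /= /eqP e.
have [lt|le] := ltnP (mdeg k1) i; first by rewrite ha ?mul0r.
rewrite hb ?mulr0 //; move: e => /(congr1 mdeg); rewrite mdegD; lia.
Qed.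

Let gen_sub (I X : set S) : ideal I -> X `<=` I -> ideal_gen X `<=` I.
Proof.
move=> hI sX a [s [hs ->]]; apply: ideal_sum_seq => // x /hs [_ hx].
by apply: idealM => //; apply: sX.
Qed.

Let pow_low j : ideal_pow (@max_ideal K n) j `<=` low j.
Proof.
apply: gen_sub => // a [c hc ->].
have {}hc i : low 1 (c i).
  apply: gen_sub (hc i) => // x [k ->] m; rewrite ltnS leqn0 mdeg_eq0 => /eqP ->.
  by rewrite mcoeffX; case: eqP => // /(congr1 mdeg); rewrite mdeg1 mdeg0.
elim: j c hc {a} => [|j ih] c hc; first by move=> m.
rewrite big_ord_recr /=; have := lowM (ih _ (fun i => hc (widen_ord (leqnSn j) i))) (hc ord_max).
by rewrite addn1.
Qed.

Let pow_lin j : ideal_pow (@max_ideal K n) j (l ^+ j).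
Proof.
exists [:: (1, l ^+ j)]; split; last by rewrite big_seq1 mul1r.
move=> x; rewrite inE => /eqP -> /=; split => //; exists (fun=> l); last first.
  by rewrite prodr_const card_ord.
move=> _; exists [seq (l@_(U_(i)) *: 1, 'X_i) | i <- enum 'I_n]; split.
  by move=> y /mapP[i _ ->] /=; split => //; exists i.
rewrite big_map big_enum /= {1}(linear_formE hl).
by apply: eq_bigr => i _; rewrite -scalerAl mul1r.
Qed.

Lemma M'_preP w : M'_pre f w <-> is_form n w /\ sat J l (w top).
Proof.
split=> [[hw [j0 hj]]|[hw [M hM]]]; split => //.
  exists j0; have /df_wedgeP [_] := hj j0 (leqnn _) _ (pow_lin j0).
  by have [_ ->] := form_mul_top (l ^+ j0) hw.
have hC := colon_ideal hJ (w top).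
have hr : rad (colon J (w top)) l by exists M; rewrite /colon /= mulrC.
have mC : primary (colon J (w top)).
  by move=> i; apply: (rad_adjoin hC (sub_colon hJ _) hr); apply: hm.
have [k0 hk0] := primary_degE hC mC.
exists k0 => j le p /pow_low hp; apply/df_wedgeP.
have [h1 ->] := form_mul_top p hw; split => //.
rewrite mulrC; apply: hk0 => m; rewrite mcoeff_msupp; apply: contraNT.
by rewrite -ltnNge => lt; rewrite hp //; apply: leq_trans le.
Qed.

Let M'_subspace : subspace (M'_pre f).
Proof.
have hs := sat_ideal l hJ.
split; first by apply/M'_preP; split=> [A _|]; rewrite ffunE //; apply: ideal0.
move=> a u v /M'_preP [hu hu'] /M'_preP [hv hv']; apply/M'_preP; split.
  by move=> A hA; rewrite !ffunE hu // hv // scaler0 addr0.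
by rewrite !ffunE; apply: idealD => //; apply: idealZ.
Qed.

Lemma mu''_sat (k : nat) : mu'' f (k + n)%N = hilbert (sat J l) k.
Proof.
apply: dim_quotE => //; have hs := sat_ideal l hJ.
apply: (dimq_transport top_form_linear (@homogs_subspace K n k) _ _ _ _ (hilbertP k hs)) => //.
- move=> p hp; apply/Omega_top_homog; rewrite top_formE; split => //.
  exact: top_form_is.
- move=> p hp; split => [/M'_preP [_]|h]; first by rewrite top_formE.
  by apply/M'_preP; rewrite top_formE; split => //; apply: top_form_is.
- move=> w /Omega_top_homog [hw hk]; exists (w top) => //.
  by rewrite -is_form_top // subrr; case: M'_subspace.
Qed.

Lemma mu''_small (k : int) : k < n%:Z -> mu'' f k = 0%N.
Proof.
move=> lt; apply: dim_quotE => //; exists (fun=> 0); split; first by case.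
  move=> w /(Omega_top_small lt) ->; exists (fun=> 0).
  by rewrite big_ord0 subr0; case: M'_subspace.
by move=> c _ [].
Qed.

Lemma mu'_sat (k : nat) : hilbert J k = (hilbert (sat J l) k + mu' f (k + n)%N)%N.
Proof.
have hs := sat_ideal l hJ; have sS := @homogs_subspace K n k.
have sJ := ideal_subspace hJ; have ss := ideal_subspace hs.
have sub : homogs k `&` sat J l `<=` @homogs K n k by move=> x [].
have [m _ hm'] := spanq_dimq sJ (spanq_sub (dimq_span (hilbertP k hJ)) sub (@subset_refl _ J)).
rewrite (hilbert_dimq hJ (dimq_add sS sJ ss (@sub_sat _ _ J l) (hilbertP k hs) hm')).
congr (_ + _)%N; apply/esym/dim_quotE => //.
apply: (dimq_transport top_form_linear _ _ _ _ _ hm') => //.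
- exact: subspaceI.
- move=> p [hp hps]; split.
    by apply/Omega_top_homog; rewrite top_formE; split => //; apply: top_form_is.
  by apply/M'_preP; rewrite top_formE; split => //; apply: top_form_is.
- move=> p _; split => [/df_wedgeP [_]|h]; first by rewrite top_formE.
  by apply/df_wedgeP; rewrite top_formE; split => //; apply: top_form_is.
- move=> w [/Omega_top_homog [hw hk] /M'_preP [_ hws]]; exists (w top) => //.
  by rewrite -is_form_top // subrr; case: df_wedge_subspace.
Qed.

End Forms.

(** * The dimension formula *)

(** (t ^ d - t) / (t - 1) is t times [geom d.-1]. *)
Lemma gamma_geom n d (m : nat) : (0 < d)%N ->
  gamma n d m = if (m < n)%N then 0 else (geom d.-1 ^+ n)`_(m - n).
Proof.
move=> d0; rewrite -coefXnM /gamma.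
suff -> : gamma_poly n d = 'X^n * geom d.-1 ^+ n by [].
have x0 : ('X - 1 : {poly int}) ^+ n != 0 by rewrite expf_neq0 // polyXsubC_eq0.
apply: (mulIf x0); rewrite gamma_polyP -!exprMn; congr (_ ^+ n).
have -> : 'X * geom d.-1 * ('X - 1) = - ('X * (geom d.-1 * (1 - 'X))) :> {poly int} by ring.
by rewrite geom_mul -{1}(prednK d0) exprS; ring.
Qed.

Lemma List_InP (T : eqType) (x : T) (s : seq T) : List.In x s <-> x \in s.
Proof.
elim: s => //= y s ih; rewrite inE; split=> [[->|/ih ->]|/orP[/eqP->|/ih]].
- by rewrite eqxx.
- by rewrite orbT.
- by left.
- by right.
Qed.

Lemma NoDup_map (T : eqType) (U : Type) (g : T -> U) (s : seq T) : uniq s ->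
  {in s &, injective g} -> List.NoDup (map g s).
Proof.
elim: s => [_ _|x s ih /= /andP[xs us] inj]; first by constructor.
constructor; last first.
  by apply: ih => // y z hy hz; apply: inj; rewrite inE ?hy ?hz orbT.
move=> /List.in_map_iff [y [e /List_InP hy]].
by move/negP: xs; apply; rewrite -(inj _ _ _ _ e) // inE ?eqxx ?hy ?orbT.
Qed.

Section Main.
Variables (K : numClosedFieldType) (n d : nat) (f : {mpoly K[n]}).
Hypotheses (n_ge2 : (2 <= n)%N) (f_homog : f \is d.-homog).
Notation S := {mpoly K[n]}.
Let J := gen_ideal (partials f).
Let hJ : ideal J. Proof. exact: gen_ideal_ideal. Qed.

Lemma singP v : sing f v <-> zero_of J (v 0).
Proof.
split=> [h|h p [i ->]]; last by apply: h; apply: mem_partial.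
apply: (gen_ideal_sub (eval_ideal (v 0))) => u /mapP[j _ ->] /=.
by apply: h; exists j.
Qed.

(** The gradient of a linear form is a nonzero constant, so M = 0, there are no
    singular points, and the gamma_k vanish. *)
Lemma formula_linear (k : int) : d = 1%N -> f != 0 ->
  gamma n d k - (mu' f k)%:Z =
  (mu'' f k)%:Z + (mu'' f ((n * d)%N%:Z - k))%:Z - (tau_Z f)%:Z.
Proof.
move=> d1 f0; have n0 : (0 < n)%N by apply: ltnW.
have hf1 : f \is 1.-homog by rewrite -d1.
have J1 : J 1.
  have [i hi] : exists i, f@_(U_(i)) != 0.
    apply: contrapT => /forallNP h; move/eqP: f0; apply.
    rewrite (linear_formE hf1) big1 // => i _.
    by move/negP/negPn: (h i) => /eqP ->; rewrite scale0r.
  have hp : f^`M(i) = (f@_(U_(i)))%:MP.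
    rewrite {1}(linear_formE hf1) raddf_sum (bigD1 i) //= mderivZ mderivX mnm1E eqxx.
    have -> : (U_(i) - U_(i) = 0 :> 'X_{1..n})%MM.
      by apply/mnmP => j; rewrite mnmBE mnm0E subnn.
    rewrite mpolyX0 scale1r big1 ?addr0.
      by rewrite -mul_mpolyC mulr1.
    move=> j ji; rewrite mderivZ mderivX mnm1E (negbTE ji) scale0r scaler0 //.
  have := idealM hJ (f@_(U_(i)))^-1%:MP (mem_partial f i).
  by rewrite hp -mpolyCM mulVf // mpolyC1.
have JT p : J p by rewrite -[p]mulr1; apply: idealM.
have gn : gamma n d k = 0.
  rewrite /gamma; case: k => // m.
  have x0 : ('X - 1 : {poly int}) ^+ n != 0 by rewrite expf_neq0 // polyXsubC_eq0.
  have : gamma_poly n d * ('X - 1) ^+ n = 0.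
    by rewrite gamma_polyP d1 expr1 subrr expr0n; case: (n) n0.
  by move/eqP; rewrite mulf_eq0 (negbTE x0) orbF => /eqP ->; rewrite coef0.
have [l hl hlv] : exists2 l : S, l \is 1.-homog & primary (adjoin J l).
  exists 'X_(Ordinal n0); first exact: homogs_var.
  by move=> i; exists 1%N; apply: sub_adjoin.
have h0 i : hilbert J i = 0%N by apply/hilbert_eq0.
have hs i : hilbert (sat J l) i = 0%N.
  by apply/hilbert_eq0 => [|p _]; [apply: sat_ideal | apply: sub_sat].
have m'' i : mu'' f i = 0%N.
  have [lt|le] := ltP i n%:Z; first by rewrite (mu''_small n0 hl hlv).
  have -> : i = (`|i|%N - n + n)%N by lia.
  by rewrite (mu''_sat n0 hl hlv) hs.
have m' i : mu' f i = 0%N.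
  have [lt|le] := ltP i n%:Z; first by rewrite (mu'_small n0 f).
  have -> : i = (`|i|%N - n + n)%N by lia.
  by have := mu'_sat n0 hl hlv (`|i| - n)%N; rewrite h0 hs.
have t0 : tau_Z f = 0%N.
  rewrite /tau_Z (_ : Sigma f = set0) ?fsbig_set0 //.
  apply/seteqP; split => // z [v [/singP hv _ _]].
  by have := hv _ J1; rewrite meval1 => /eqP; rewrite oner_eq0.
by rewrite gn m' !m'' t0.
Qed.

Hypothesis dim_sing : zariski_dim_le (sing f) 1.
Hypothesis d_ge2 : (2 <= d)%N.
Let n0 : (0 < n)%N. Proof. exact: ltnW. Qed.
Let d0 : (0 < d)%N. Proof. exact: ltnW. Qed.

Let ph : {in partials f, forall g, g \is d.-1.-homog}.
Proof. exact: partials_homog f_homog. Qed.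

Let gJ : graded J.
Proof. by apply: gen_ideal_graded => u /ph hu; exists d.-1. Qed.

Lemma sing_cone v : sing f v -> line v `<=` sing f.
Proof.
move=> /singP hv w [c ->]; apply/singP.
apply: (gen_ideal_sub (eval_ideal _)) => u /[dup] hu /mem_gen_ideal/hv uv /=.
rewrite (meval_homog (c := c) (ph hu) (v := v 0)) ?uv ?mulr0 // => i.
by rewrite mxE.
Qed.

Lemma Sigma_finite : finite_set (Sigma f).
Proof.
apply: cone_lines_finite => //; last exact: sing_cone.
by exists [set p | exists i : 'I_n, p = f^`M(i)].
Qed.

Lemma Sigma_pick z : Sigma f z ->
  [/\ sing f (vpick z), vpick z != 0 & z = <[vpick z]>%VS].
Proof.
move=> [v [sv v0 ez]].
have p0 : vpick z != 0.
  by rewrite vpick0 ez; apply: contra v0 => /eqP e; have := memv_line v; rewrite e memv0.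
have : vpick z \in z by apply: memv_pick.
rewrite {2}ez => /vlineP [c ec].
have c0 : c != 0 by apply: contra_neq p0 => e; rewrite ec e scale0r.
split => //; first by apply: (sing_cone sv); exists c.
rewrite [LHS]ez; apply/eqP; rewrite eqEsubv -!memvE; apply/andP; split.
  by apply/vlineP; exists c^-1; rewrite ec scalerA mulVf // scale1r.
by apply/vlineP; exists c.
Qed.

Let zs_spec : {zs : seq {vspace 'rV[K]_n} | uniq zs /\ Sigma f = [set` zs]}.
Proof.
apply: cid; have [s e] := (finite_seqP _).1 Sigma_finite.
exists (undup s); split; first exact: undup_uniq.
by rewrite e; apply/seteqP; split => z /=; rewrite mem_undup.
Qed.

Let zs := proj1_sig zs_spec.

Let zsP z : z \in zs <-> Sigma f z.
Proof. by have [_ ->] := proj2_sig zs_spec. Qed.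

Let coords (z : {vspace 'rV[K]_n}) : 'I_n -> K := vpick z 0.

Let coordsP v : List.In v (map coords zs) <-> exists2 z, Sigma f z & v = coords z.
Proof.
split=> [/List.in_map_iff [z [<- /List_InP/zsP hz]]|[z /zsP/List_InP hz ->]]; first by exists z.
by apply/List.in_map_iff; exists z.
Qed.

(** A linear form avoiding the singular points has no common zero with J except
    the origin. *)
Lemma good_form : exists l : S, [/\ l \is 1.-homog, l != 0, primary (adjoin J l) &
  forall v, List.In v (map coords zs) -> l.@[v] != 0].
Proof.
have [v|l hl hlv] := avoiding_form (vs := (fun=> 1) :: map coords zs).
  case=> [<-|/coordsP [z /Sigma_pick [_ /rV0Pn h _] ->]] //.
  by exists (Ordinal n0); rewrite oner_neq0.
exists l; split => //.
- apply/eqP => l0; have := hlv _ (or_introl erefl).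
  by rewrite l0 meval0 eqxx.
- apply: no_zero_primary; [exact: adjoin_ideal | exact: adjoin_graded hl |].
  move=> v hv i; apply: contrapT => /eqP vi.
  pose w : 'rV[K]_n := \row_j v j.
  have ev : v = w 0 by apply/funext => j; rewrite mxE.
  have sw : sing f w.
    by apply/singP => p hp; rewrite -ev; apply: hv; apply: sub_adjoin.
  have w0 : w != 0 by apply/rV0Pn; exists i; rewrite mxE.
  have hS : Sigma f <[w]>%VS by exists w.
  have [_ _ e] := Sigma_pick hS.
  have : w \in <[w]>%VS by apply: memv_line.
  rewrite e => /vlineP [c ec].
  have lv : l.@[v] = 0 by apply: hv; apply: adjoin_gen.
  have /negP := hlv (coords <[w]>%VS) (or_intror ((coordsP _).2 (ex_intro2 _ _ _ hS erefl))).
  apply; apply/eqP; have := lv.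
  rewrite (meval_homog (c := c) (v := coords <[w]>%VS) hl) => [|j].
    move/eqP; rewrite expr1 mulf_eq0 => /orP[/eqP c0|/eqP //].
    by move: w0; rewrite ec c0 scale0r eqxx.
  by rewrite ev {1}ec mxE.
- by move=> v hv; apply: hlv; right.
Qed.

Let l_stable (l : S) v : l \is 1.-homog -> primary (adjoin J l) -> l.@[v] != 0 ->
  exists t k0, forall k, (k0 <= k)%N -> hilbert (loc J v) k = t.
Proof.
by move=> hl hm lv; have [k0 [t h]] := loc_stable hJ gJ hl hm lv; exists t, k0.
Qed.

(** The total Tjurina number is the degree of the projective scheme defined by J. *)
Lemma tau_stable (l : S) : l \is 1.-homog -> primary (adjoin J l) ->
    (forall v, List.In v (map coords zs) -> l.@[v] != 0) ->
  exists k0, forall k, (k0 <= k)%N -> hilbert J k = tau_Z f.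
Proof.
move=> hl hm hlv.
pose t v := xget 0%N [set t | exists k0, forall k, (k0 <= k)%N -> hilbert (loc J v) k = t].
have tP v : List.In v (map coords zs) ->
    exists k0, forall k, (k0 <= k)%N -> hilbert (loc J v) k = t v.
  by move=> /hlv lv; apply: (xgetPex 0%N (l_stable hl hm lv)).
have coords_span z z' (c : K) : Sigma f z -> Sigma f z' ->
    (forall i, coords z i = c * coords z' i) -> z = z'.
  move=> /Sigma_pick [_ v0 ez] /Sigma_pick [_ w0 ez'] h.
  have e : vpick z = c *: vpick z' by apply/rowP => i; rewrite mxE; apply: h.
  have c0 : c != 0 by apply: contra_neq v0 => c0; rewrite e c0 scale0r.
  rewrite ez ez'; apply/eqP; rewrite eqEsubv -!memvE; apply/andP; split.
    by apply/vlineP; exists c.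
  by apply/vlineP; exists c^-1; rewrite e scalerA mulVf // scale1r.
have [||||k0 hk0] := sum_of_multiplicities hJ gJ hl hm (zs := map coords zs) _ _ (t := t) _ _ tP.
- exact: hlv.
- move=> v hv [i vi]; pose w : 'rV[K]_n := \row_j v j.
  have ev : v = w 0 by apply/funext => j; rewrite mxE.
  have w0 : w != 0 by apply/rV0Pn; exists i; rewrite mxE.
  have hS : Sigma f <[w]>%VS by exists w; split => //; apply/singP; rewrite -ev.
  have [_ _ e] := Sigma_pick hS.
  have : w \in <[w]>%VS by apply: memv_line.
  rewrite e => /vlineP [c ec].
  exists (coords <[w]>%VS); first by apply/coordsP; exists <[w]>%VS.
  by exists c => j; rewrite ev {1}ec mxE.
- apply: NoDup_map; first by have [] := proj2_sig zs_spec.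
  move=> z z' /zsP hz /zsP hz' e; apply: (coords_span z z' 1 hz hz') => i.
  by rewrite e mul1r.
- move=> _ _ /coordsP [z hz ->] /coordsP [z' hz' ->] ne [c hc]; apply: ne.
  by rewrite (coords_span _ _ _ hz' hz hc).
exists k0 => k /hk0 ->; have [uz ez] := proj2_sig zs_spec.
rewrite /tau_Z ez -fsbig_seq // big_map; apply: eq_big_seq => z /zsP hz.
have [_ v0 _] := Sigma_pick hz; rewrite /tjurina_at; case: pickP => [i vi|h].
  have [|k1 hk1] := tP (coords z); first by apply/coordsP; exists z.
  by rewrite (tjurina_stable d0 f_homog vi hk1).
by case/rV0Pn: v0 => i; rewrite h.
Qed.

Lemma formula_general (k : int) :
  gamma n d k - (mu' f k)%:Z =
  (mu'' f k)%:Z + (mu'' f ((n * d)%N%:Z - k))%:Z - (tau_Z f)%:Z.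
Proof.
have [l [hl l0 hm hlv]] := good_form.
have [k0 hk0] := tau_stable hl hm hlv.
have e0 : (0 < d.-1)%N by lia.
have sz : size (partials f) = n by rewrite size_map size_enum_ord.
have [gs [g [s1 s2 s3 s4]]] := reduce_generators e0 hl l0 sz ph hm.
have := hilbert_symmetry n0 e0 hl s2 s1 s4; rewrite s3 -/J.
move=> [k1 [tau [h1 h2 h3]]].
have {h1}et : tau = tau_Z f by rewrite -(h1 (k0 + k1)%N) ?leq_addl // hk0 ?leq_addr.
rewrite et in h2 h3.
set N0 := (n * d.-2)%N in h2 h3.
have eN : (n * d = N0 + n + n)%N.
  rewrite /N0 -!addnA addnn -mul2n mulnC -[in RHS](mulnC d.-2) -mulnDl.
  by congr (_ * _)%N; lia.
(* Top forms have degree at least n, so only the second mu'' and tau remain. *)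
have [lt|le] := ltP k n%:Z.
  have -> : gamma n d k = 0.
    case: k lt => // m lt; rewrite gamma_geom // (_ : (m < n)%N) //; lia.
  rewrite (mu'_small n0 f) // (mu''_small n0 hl hm lt).
  have [q eq] : exists q : nat, (n * d)%N%:Z - k = (q + n)%N.
    by exists (absz ((n * d)%N%:Z - k - n%:Z)%R); lia.
  by rewrite eq (mu''_sat n0 hl hm) h2; lia.
have -> : k = ((`|k| - n) + n)%N by lia.
set m := (`|k| - n)%N.
rewrite gamma_geom // ltnNge leq_addl addnK /=.
pose C := hilbert J m; pose A := hilbert (sat J l) m; pose B := hilbert (sat J l) (N0 - m).
pose G : int := (geom d.-1 ^+ n)`_m; rewrite -/G.
have e1 : C%:Z = G + (tau_Z f)%:Z - (if (m <= N0)%N then B%:Z else 0).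
  exact: h3.
have e2 : C = (A + mu' f (m + n)%N)%N := mu'_sat n0 hl hm m.
have e3 : mu'' f (m + n)%N = A := mu''_sat n0 hl hm m.
have e4 : mu'' f ((n * d)%N%:Z - (m + n)%N%:Z) = (if (m <= N0)%N then B else 0%N).
  case: leqP => [lem|ltm]; last by apply: (mu''_small n0 hl hm); lia.
  have -> : (n * d)%N%:Z - (m + n)%N%:Z = (N0 - m + n)%N%:Z by lia.
  exact: (mu''_sat n0 hl hm).
rewrite e3 e4; clearbody A B C G; move: e1; case: ifP => _; lia.
Qed.

End Main.

(** A polynomial of degree 0 involves no variable, which leaves the cases d = 1 and
    d >= 2. *)
Theorem main_formula (K : numClosedFieldType) (n d : nat) (f : {mpoly K[n]})
    (n_ge2 : (2 <= n)%N) (f_homog : f \is d.-homog)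
    (dim_sing : zariski_dim_le (sing f) 1) (f_vars : ~ fewer_variables f) (k : int) :
  gamma n d k - (mu' f k)%:Z =
  (mu'' f k)%:Z + (mu'' f ((n * d)%N%:Z - k))%:Z - (tau_Z f)%:Z.
Proof.
pose i0 : 'I_n := Ordinal (ltnW n_ge2).
have f0 : f != 0.
  apply/eqP => f0; apply: f_vars; exists 1%:M; first exact: unitmx1.
  by exists i0 => m; rewrite f0 /linear_subst comp_mpoly0 msupp0.
have d0 : (0 < d)%N.
  rewrite lt0n; apply/eqP => d0; apply: f_vars; exists 1%:M; first exact: unitmx1.
  exists i0 => m.
  have -> : f = (f@_0)%:MP.
    apply/mpolyP => m'; rewrite mcoeffC; case: (eqVneq 0%MM m') => [<-|ne].
      by rewrite mulr1.
    rewrite mulr0; apply: (dhomog_nemf_coeff f_homog).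
    by rewrite d0 mdeg_eq0 eq_sym.
  rewrite /linear_subst comp_mpolyC msuppC; case: ifP => // _.
  by rewrite inE => /eqP ->; rewrite mnm0E.
have [d1|d_neq1] := eqVneq d 1%N; first exact: formula_linear.
by apply: formula_general => //; lia.
Qed.

Theorem corollary4 (R : realType) (n d : nat) (f : {mpoly R[i][n]})
    (n_ge2 : (2 <= n)%N)
    (f_homog : f \is d.-homog)
    (dim_sing : zariski_dim_le (sing f) 1)
    (f_vars : ~ fewer_variables f)
    (k : int) :
  gamma n d k - (mu' f k)%:Z =
  (mu'' f k)%:Z + (mu'' f ((n * d)%N%:Z - k))%:Z - (tau_Z f)%:Z.
Proof. exact: main_formula. Qed.
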